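(* There is an algorithm that, given $\epsilon>0$ and $s>p\ge 2$ ($s<\infty$), computes for any $A\in\mathbb{R}^{n\times d}$, $b\in\mathbb{R}^n$ an $\epsilon$-approximate solution to the $\ell_s$-regression problem in at most $$O\left(s\cdot n^{\frac{\nu}{1+\nu}}\log^2\frac{n}{\epsilon}\right)$$ iterations, where $\nu:=\frac1p-\frac1s$, each of which can be implemented in $O(d)$ time plus the time needed to solve $\tilde O(1)$ smoothed $\ell_p$-regression problems, i.e. problems of the form $$\min_{x\in\mathbb{R}^d} g^\top x+\|\tilde A x-\tilde b\|_2^2+\|Cx-h\|_p^p .$$
   Context: $\ell_s$-regression problem: given $2\le s<\infty$, $\epsilon>0$, $A\in\mathbb{R}^{n\times d}$ and $b\in\mathbb{R}^n$, find $\tilde x\in\mathbb{R}^d$ such that $\|A\tilde x-b\|_s^s\le(1+\epsilon)\min_{x\in\mathbb{R}^d}\|Ax-b\|_s^s$; such an $\tilde x$ is called an $\epsilon$-approximate solution. In the smoothed $\ell_p$-regression problems, $g\in\mathbb{R}^d$ and $\tilde A,C$ are real matrices with $d$ columns, $\tilde b,h$ are real vectors of compatible dimension (they are chosen by the algorithm). $\|\cdot\|_p$ is the standard $\ell_p$ norm. $\tilde O(\cdot)$ hides factors depending on $p$ and $s$ and factors polynomial in $\log n$. *)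

(* Defs.v *)
From HB Require Import structures.
From mathcomp Require Import all_boot all_order all_algebra.
From mathcomp Require Import reals exp.

Set Implicit Arguments.
Unset Strict Implicit.
Unset Printing Implicit Defensive.

Import Order.TTheory GRing.Theory Num.Theory.
Local Open Scope ring_scope.

Definition lp_norm (R : realType) (m : nat) (p : R) (v : 'cV[R]_m) : R :=
  (\sum_(i < m) `|v i 0| `^ p) `^ p^-1.

Definition is_minimizer (R : realType) (T : Type) (f : T -> R) (x : T) : Prop :=
  forall y, f x <= f y.

Definition regression_obj (R : realType) (s : R) (n d : nat)
    (A : 'M[R]_(n, d)) (b : 'cV[R]_n) (x : 'cV[R]_d) : R :=
  lp_norm s (A *m x - b) `^ s.

Definition approx_solution (R : realType) (s eps : R) (n d : nat)
    (A : 'M[R]_(n, d)) (b : 'cV[R]_n) (xt : 'cV[R]_d) : Prop :=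
  exists2 xmin, is_minimizer (regression_obj s A b) xmin &
    regression_obj s A b xt <= (1 + eps) * regression_obj s A b xmin.

Record smoothed_problem (R : realType) (d : nat) := SmoothedProblem {
  rows2 : nat;
  rowsp : nat;
  sp_g : 'cV[R]_d;
  sp_A : 'M[R]_(rows2, d);
  sp_b : 'cV[R]_rows2;
  sp_C : 'M[R]_(rowsp, d);
  sp_h : 'cV[R]_rowsp }.

Definition smoothed_obj (R : realType) (p : R) (d : nat)
    (q : smoothed_problem R d) (x : 'cV[R]_d) : R :=
  ((sp_g q)^T *m x) 0 0
  + lp_norm 2 (sp_A q *m x - sp_b q) ^+ 2
  + lp_norm p (sp_C q *m x - sp_h q) `^ p.

(* Nothing is assumed of the answer to a problem without a minimizer
   (the linear term can make the objective unbounded below). *)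
Definition smoothed_solver (R : realType) (p : R) (d : nat)
    (solver : smoothed_problem R d -> 'cV[R]_d) : Prop :=
  forall q, (exists x, is_minimizer (smoothed_obj p q) x) ->
    is_minimizer (smoothed_obj p q) (solver q).

(* A uniform real-RAM: a program is a finite piece of syntax, containing no real
   constant, that acts on natural-number variables (which address the memory and
   can be cast to reals) and on real arrays with two natural-number indices.
   Reals support unit-cost field operations, power, logarithm and comparison;
   there is no rounding of a real to a natural number and no multiplication of
   natural numbers, so that unit cost cannot be abused for bit manipulation. *)

Inductive nexpr : Type :=
| NConst of nat
| NVar of nat
| NAdd of nexpr & nexpr
| NSub of nexpr & nexpr.

Inductive rexpr : Type :=
| RNat of nexpr
| RGet of nat & nexpr & nexpr
| RAdd of rexpr & rexpr
| RSub of rexpr & rexpr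
| RMul of rexpr & rexpr
| RDiv of rexpr & rexpr
| RPow of rexpr & rexpr
| RLn of rexpr.

Inductive bexpr : Type :=
| BNle of nexpr & nexpr
| BRle of rexpr & rexpr
| BNot of bexpr
| BAnd of bexpr & bexpr.

(* [Solve m2 mp g A b C h x] poses the problem whose data are in the arrays
   g, A, b, C, h, the matrices A and C having m2 and mp rows, and stores the
   solver's answer in the array x. A vector v is stored as v[i][0]. *)
Inductive cmd : Type :=
| Skip
| NSet of nat & nexpr
| RSet of nat & nexpr & nexpr & rexpr
| Seq of cmd & cmd
| If of bexpr & cmd & cmd
| While of bexpr & cmd
| Solve (m2 mp : nexpr) (g A b C h x : nat).

Fixpoint nsize (e : nexpr) : nat :=
  match e with
  | NConst _ | NVar _ => 1
  | NAdd e1 e2 | NSub e1 e2 => (nsize e1 + nsize e2).+1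
  end.

Fixpoint rsize (e : rexpr) : nat :=
  match e with
  | RNat i => (nsize i).+1
  | RGet _ i j => (nsize i + nsize j).+1
  | RAdd e1 e2 | RSub e1 e2 | RMul e1 e2 | RDiv e1 e2 | RPow e1 e2 =>
      (rsize e1 + rsize e2).+1
  | RLn e1 => (rsize e1).+1
  end.

Fixpoint bsize (e : bexpr) : nat :=
  match e with
  | BNle e1 e2 => (nsize e1 + nsize e2).+1
  | BRle e1 e2 => (rsize e1 + rsize e2).+1
  | BNot e1 => (bsize e1).+1
  | BAnd e1 e2 => (bsize e1 + bsize e2).+1
  end.

Record store (R : realType) := Store {
  nvar : nat -> nat;
  rarr : nat -> nat -> nat -> R }.

Fixpoint neval (R : realType) (st : store R) (e : nexpr) : nat :=
  match e with
  | NConst k => k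
  | NVar x => nvar st x
  | NAdd e1 e2 => (neval st e1 + neval st e2)%N
  | NSub e1 e2 => (neval st e1 - neval st e2)%N
  end.

Fixpoint reval (R : realType) (st : store R) (e : rexpr) : R :=
  match e with
  | RNat i => (neval st i)%:R
  | RGet a i j => rarr st a (neval st i) (neval st j)
  | RAdd e1 e2 => reval st e1 + reval st e2
  | RSub e1 e2 => reval st e1 - reval st e2
  | RMul e1 e2 => reval st e1 * reval st e2
  | RDiv e1 e2 => reval st e1 / reval st e2
  | RPow e1 e2 => reval st e1 `^ reval st e2
  | RLn e1 => ln (reval st e1)
  end.

Fixpoint beval (R : realType) (st : store R) (e : bexpr) : bool :=
  match e with
  | BNle e1 e2 => (neval st e1 <= neval st e2)%N
  | BRle e1 e2 => reval st e1 <= reval st e2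
  | BNot e1 => ~~ beval st e1
  | BAnd e1 e2 => beval st e1 && beval st e2
  end.

Definition set_nvar (R : realType) (st : store R) (x v : nat) : store R :=
  Store (fun y => if y == x then v else nvar st y) (rarr st).

Definition set_rarr (R : realType) (st : store R) (a i j : nat) (v : R)
    : store R :=
  Store (nvar st) (fun a' i' j' =>
    if [&& a' == a, i' == i & j' == j] then v else rarr st a' i' j').

Definition get_mx (R : realType) (st : store R) (a m d : nat) : 'M[R]_(m, d) :=
  \matrix_(i < m, j < d) rarr st a i j.

Definition get_cv (R : realType) (st : store R) (a m : nat) : 'cV[R]_m :=
  \col_(i < m) rarr st a i 0%N.

(* The entry of a matrix at natural-number indices, 0 out of bounds. *)
Definition entry (R : realType) (m d : nat) (M : 'M[R]_(m, d)) (i j : nat) : R :=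
  match insub i, insub j with
  | Some i', Some j' => M i' j'
  | _, _ => 0
  end.

Definition set_cv (R : realType) (st : store R) (a m : nat) (v : 'cV[R]_m)
    : store R :=
  Store (nvar st) (fun a' i j =>
    if [&& a' == a, (i < m)%N & j == 0%N] then entry v i 0 else rarr st a' i j).

(* The cost of a computation: the number of elementary operations, and for each
   problem handed to the solver its two numbers of rows. *)
Record cost := Cost { ops : nat; queries : seq (nat * nat) }.

Definition cost_add (c1 c2 : cost) : cost :=
  Cost (ops c1 + ops c2) (queries c1 ++ queries c2).

Inductive exec (R : realType) (d : nat)
    (solver : smoothed_problem R d -> 'cV[R]_d)
    : cmd -> store R -> store R -> cost -> Prop :=
| ExecSkip st : exec solver Skip st st (Cost 1 [::])
| ExecNSet st x e :
    exec solver (NSet x e) st (set_nvar st x (neval st e))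
      (Cost (nsize e).+1 [::])
| ExecRSet st a i j e :
    exec solver (RSet a i j e) st
      (set_rarr st a (neval st i) (neval st j) (reval st e))
      (Cost (nsize i + nsize j + rsize e).+1 [::])
| ExecSeq c1 c2 st1 st2 st3 k1 k2 :
    exec solver c1 st1 st2 k1 -> exec solver c2 st2 st3 k2 ->
    exec solver (Seq c1 c2) st1 st3 (cost_add k1 k2)
| ExecIf e c1 c2 st st' k :
    exec solver (if beval st e then c1 else c2) st st' k ->
    exec solver (If e c1 c2) st st' (cost_add (Cost (bsize e).+1 [::]) k)
| ExecWhileF e c st :
    ~~ beval st e ->
    exec solver (While e c) st st (Cost (bsize e).+1 [::])
| ExecWhileT e c st1 st2 st3 k1 k2 :
    beval st1 e ->
    exec solver c st1 st2 k1 -> exec solver (While e c) st2 st3 k2 ->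
    exec solver (While e c) st1 st3
      (cost_add (Cost (bsize e).+1 [::]) (cost_add k1 k2))
| ExecSolve m2 mp g A b C h x st :
    let r2 := neval st m2 in
    let rp := neval st mp in
    exec solver (Solve m2 mp g A b C h x) st
      (set_cv st x (solver
         (SmoothedProblem (get_cv st g d) (get_mx st A r2 d) (get_cv st b r2)
            (get_mx st C rp d) (get_cv st h rp))))
      (Cost (nsize m2 + nsize mp).+1 [:: (r2, rp)]).

(* Memory layout. Natural-number variables: 0 is n, 1 is d, 2 is the halting
   flag. Real arrays: 0 is A, 1 is b, 2 holds eps, s, p in its first column,
   3 is the output vector. Everything else is initially zero. *)
Definition init_store (R : realType) (s p eps : R) (n d : nat)
    (A : 'M[R]_(n, d)) (b : 'cV[R]_n) : store R :=
  Store
    (fun x => nth 0%N [:: n; d] x)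
    (fun a i j =>
       match a with
       | 0 => entry A i j
       | 1 => entry b i j
       | 2 => if j == 0%N then nth 0 [:: eps; s; p] i else 0
       | _ => 0
       end).

Definition halted (R : realType) (st : store R) : bool := nvar st 2 != 0%N.

Definition output (R : realType) (d : nat) (st : store R) : 'cV[R]_d :=
  get_cv st 3 d.

(* An iterative algorithm is given by the program of one iteration, repeated
   until the halting flag is set; there is no work outside the iterations.
   The sequence collects the costs of the successive iterations. *)
Inductive iterates (R : realType) (d : nat)
    (solver : smoothed_problem R d -> 'cV[R]_d) (body : cmd)
    : store R -> seq cost -> store R -> Prop :=
| IterStop st : halted st -> iterates solver body st [::] st
| IterStep st1 st2 st3 k ks :
    ~~ halted st1 -> exec solver body st1 st2 k ->
    iterates solver body st2 ks st3 ->
    iterates solver body st1 (k :: ks) st3.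

(* Number of reals describing a problem with r.1 and r.2 rows: g and the rows
   of the matrices together with their right-hand sides. *)
Definition problem_size (d : nat) (r : nat * nat) : nat :=
  (d + (r.1 + r.2) * d.+1)%N.

(* One iteration takes O(d) time plus the time of at most N smoothed problems
   with O(n) rows. The time of a problem includes the time linear in its size
   in which its data are written and read. *)
Definition iteration_cost_bound (R : realType) (K n d : nat) (N : R) (c : cost)
    : bool :=
  [&& (size (queries c))%:R <= N,
      all (fun r => r.1 + r.2 <= K * n)%N (queries c) &
      (ops c <= K * (d + \sum_(r <- queries c) problem_size d r))%N].

(* Logarithm inside asymptotic bounds, bounded away from 0. *)
Definition logb (R : realType) (x : R) : R := Num.max 1 (ln x).

(* Main.v *)
Require Import Defs.
From HB Require Import structures.
From mathcomp Require Import all_boot all_order all_algebra.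
From mathcomp Require Import reals sequences exp.
From mathcomp Require boolp classical_sets topology normedtype derive.
From mathcomp Require Import ring lra zify.
Import Order.TTheory GRing.Theory Num.Theory.
Local Open Scope ring_scope.

(** Write [y = A x - b] and [F x] for the s-th power of the s-norm of [y]. The
    algorithm keeps a point [x] and a number [G] that bounds the gap
    [F x - min F], and lowers [G] by a constant factor in each phase.

    If the gap exceeds [G / 2], expanding [F] at [x] ([norm_powR_upper],
    [norm_powR_lower]) shows that some step [v] has slope [- G], quadratic part
    [O(G)] and s-norm of [A v] at most [r = O(G^(1/s))] ([cheap_direction]), and
    that any step with these properties up to constants lowers [F] by a constant
    fraction of [G] once it is scaled down ([phase_progress]). A phase looks for
    such a step with queries in the p-norm only, by multiplicative weights
    with width reduction. Every coordinate has a weight [w_i], initially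
    [n^(-1/s)], and the oracle minimizes a penalty for the slope, the quadratic
    part, and the p-norm of [A v / r] with coefficients [w_i^(s-p)]. Let
    [load_i = |A v / r|_i] at the minimizer, and let the potential be the sum of
    the [w_i^s].

    - If the loads are moderate, [w] grows by a small multiple of the loads and
      [v] is added to an accumulator (a flow step). The weights then dominate
      the accumulated loads, so a bounded potential bounds the s-norm of the
      average step ([phase_inv_flow]).
    - Otherwise the coefficients of the overloaded coordinates, those whose load
      is much larger than their weight, are doubled (a width step). Strong
      convexity of the oracle's objective makes its minimum grow by a fixed
      fraction of the overloaded part ([oracle_min_widen]), and this growth
      pays for the growth of the potential ([phase_inv_widen]).

    The cheap step bounds the minimum by two plus the potential
    ([oracle_obj_cheap]), so both stay bounded. With
    [T = n^(nu/(1+nu))], flow steps have length of order [1/T], hence there are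
    [O(T)] of them, and the growth in a width step is of order at least [1/T],
    hence there are [O(T)] of these too: [gain_bound] and [overload_ge] are where
    the exponent comes from. If the gap is below [G / 2] the phase may achieve
    nothing, but then [G] may be lowered anyway, and a candidate is only accepted
    if it does not increase [F].

    The p-norm minimizer is a first point with [F x <= n^s * min F], so
    [O(log n + log (n / eps))] phases suffice. Each phase step makes
    one query; constants depending on [p] and [s] and one factor [log n] are
    absorbed by packing a quota of such steps into one iteration.

    A step of the program consists of lists of array assignments; in a list no
    array is written twice or after it has been read, so that all assignments hold as equations
    in the final store ([runs_compile]); branches inside a step are replaced by
    arithmetic with indicators. *)

Set Implicit Arguments.
Unset Strict Implicit.
Unset Printing Implicit Defensive.

(** * Power inequalities *)

Section PowerInequalities.
Variable R : realType.
Implicit Types a b t x y p q s : R.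

(** Young's inequality, read as the tangent bound of a convex function. Most
    estimates on powers below come from it, without derivatives. *)
Lemma powR_tangent s a b : 1 <= s -> 0 <= a -> 0 <= b ->
  a `^ s + s * a `^ (s - 1) * (b - a) <= b `^ s.
Proof.
move=> s1 a0 b0; have s0 : 0 < s by lra.
case: (eqVneq s 1) => [->|sn1].
  by rewrite subrr !powRr0 !powRr1 //; lra.
have s1' : 0 < s - 1 by rewrite subr_gt0 lt_neqAle eq_sym sn1.
have qE : s^-1 + (s / (s - 1))^-1 = 1.
  by rewrite invf_div; field; rewrite !gt_eqF.
have := @conjugate_powR R b (a `^ (s - 1)) s (s / (s - 1)) b0 (powR_ge0 _ _)
  s0 (divr_gt0 s0 s1') qE.
rewrite -powRrM mulrC [(s - 1) * _]mulrCA divff ?gt_eqF// mulr1.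
rewrite invf_div -(ler_pM2l s0) => H.
have aE : a * a `^ (s - 1) = a `^ s by rewrite mulr_powRB1.
have -> : s * a `^ (s - 1) * (b - a)
    = s * (a `^ (s - 1) * b) - s * (a * a `^ (s - 1)) by ring.
rewrite aE.
have : s * (b `^ s / s + a `^ s * ((s - 1) / s)) = b `^ s + (s - 1) * a `^ s.
  by field; rewrite gt_eqF.
by move=> E; rewrite E in H; lra.
Qed.

Lemma powR_superadd q x y : 1 <= q -> 0 <= x -> 0 <= y ->
  x `^ q + y `^ q <= (x + y) `^ q.
Proof.
move=> q1 x0 y0; have q0 : 0 < q by lra.
rewrite -(mulr_powRB1 x0 q0) -(mulr_powRB1 y0 q0).
rewrite -(@mulr_powRB1 _ (x + y)) ?addr_ge0// mulrDl.
by apply: lerD; apply: ler_wpM2l => //; apply: ge0_ler_powR;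
  rewrite ?nnegrE//; lra.
Qed.

Lemma powR_midpoint q x y : 1 <= q -> 0 <= x -> 0 <= y ->
  2 * ((x + y) / 2) `^ q <= x `^ q + y `^ q.
Proof.
move=> q1 x0 y0; have m0 : 0 <= (x + y) / 2 by lra.
have := powR_tangent q1 m0 x0; have := powR_tangent q1 m0 y0.
set m := (X in X `^ q); set k := q * _ => H1 H2.
have : k * (y - m) + k * (x - m) = 0 by rewrite /m; field.
by lra.
Qed.

Lemma powR_add_le r x y : 0 <= r -> 0 <= x -> 0 <= y ->
  (x + y) `^ r <= 2 `^ r * (x `^ r + y `^ r).
Proof.
move=> r0 x0 y0.
suff H a b : 0 <= a -> a <= b -> (a + b) `^ r <= 2 `^ r * (a `^ r + b `^ r).
  by case: (leP x y) => [|/ltW] xy; [|rewrite addrC [x `^ r + _]addrC]; exact: H.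
move=> a0 ab; have b0 : 0 <= b by lra.
apply: le_trans (_ : (2 * b) `^ r <= _).
  by apply: ge0_ler_powR; rewrite ?nnegrE; lra.
by rewrite powRM//; apply: ler_wpM2l; rewrite ?powR_ge0// lerDr powR_ge0.
Qed.

Lemma norm_powR_sqr p a : `|a| `^ p = (a * a) `^ (p / 2).
Proof.
have -> : a * a = `|a| `^ 2 by rewrite (powR_mulrn 2 (normr_ge0 a)) real_normK ?num_real ?expr2.
by rewrite -powRrM mulrCA mulfV ?mulr1 // pnatr_eq0.
Qed.

Lemma powRMB2 p a : 2 < p -> `|a| `^ (p - 2) * a ^+ 2 = `|a| `^ p.
Proof.
move=> p2; have -> : a ^+ 2 = `|a| * `|a| by rewrite -expr2 real_normK ?num_real.
have -> : p - 2 = p - 1 - 1 by ring.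
by rewrite mulrC -mulrA !mulr_powRB1//; lra.
Qed.

Lemma powRMB1 p a : 2 < p -> `|a| `^ (p - 2) * `|a| = `|a| `^ (p - 1).
Proof.
by move=> p2; rewrite (_ : p - 2 = p - 1 - 1) ?[_ * `|a|]mulrC ?mulr_powRB1 //; [lra|ring].
Qed.

(** The parallelogram law for exponent [2], pushed to exponent [p] by
    superadditivity and convexity of [x `^ (p / 2)]: uniform convexity without
    any derivative. *)
Lemma norm_powR_midpoint p a b : 2 <= p ->
  `|(a + b) / 2| `^ p + `|(a - b) / 2| `^ p <= (`|a| `^ p + `|b| `^ p) / 2.
Proof.
move=> p2; have q1 : 1 <= p / 2 by lra.
rewrite !norm_powR_sqr.
have sq0 (c : R) : 0 <= c * c by rewrite -expr2 sqr_ge0.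
apply: le_trans (powR_superadd q1 (sq0 _) (sq0 _)) _.
have -> : (a + b) / 2 * ((a + b) / 2) + (a - b) / 2 * ((a - b) / 2)
  = (a * a + b * b) / 2 by field.
by have := powR_midpoint q1 (sq0 a) (sq0 b); lra.
Qed.

(** The derivative of [`|a| `^ s / s], as an odd function. *)
Definition spow s a : R := `|a| `^ (s - 2) * a.

Lemma spow_abs s a : 2 < s -> `|spow s a| = `|a| `^ (s - 1).
Proof.
by move=> s2; rewrite /spow normrM ger0_norm ?powR_ge0// powRMB1.
Qed.

Lemma spowM s a : 2 < s -> spow s a * a = `|a| `^ s.
Proof. by move=> s2; rewrite /spow -mulrA -expr2 powRMB2. Qed.

Lemma norm_powR_tangent s a b : 2 < s ->
  `|a| `^ s + s * spow s a * (b - a) <= `|b| `^ s.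
Proof.
move=> s2; have s1 : 1 <= s by lra.
have := powR_tangent s1 (normr_ge0 a) (normr_ge0 b).
have E : `|a| `^ (s - 1) * `|a| = `|a| `^ s by rewrite mulrC mulr_powRB1//; lra.
have : spow s a * b <= `|a| `^ (s - 1) * `|b|.
  by rewrite -spow_abs// -normrM ler_norm.
have Ea := spowM a s2; move: E Ea.
move: (spow s a) (_ `^ (s - 1)) => u v E Ea le_ub H.
have s0 : 0 <= s by lra.
have := ler_wpM2l s0 le_ub.
have -> : s * u * (b - a) = s * (u * b) - s * (u * a) by ring.
have : s * v * (`|b| - `|a|) = s * (v * `|b|) - s * (v * `|a|) by ring.
by rewrite E Ea; lra.
Qed.

(** For arguments of the same sign this is the tangent bound with exponent
    [s - 1]; for opposite signs the two terms are bounded one by one. *)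
Lemma spow_lipschitz s a b : 2 < s ->
  `|spow s a - spow s b| <= (s - 1) * Num.max `|a| `|b| `^ (s - 2) * `|a - b|.
Proof.
move=> s2.
have s1 : 1 <= s - 1 by lra.
have diffp x y : 0 <= x -> x <= y ->
    y `^ (s - 1) - x `^ (s - 1) <= (s - 1) * y `^ (s - 2) * (y - x).
  move=> x0 xy; have y0 : 0 <= y by lra.
  have := powR_tangent s1 y0 x0.
  have -> : s - 1 - 1 = s - 2 by ring.
  move: (_ * y `^ _) => k; nra.
have nneg x : 0 <= x -> spow s x = x `^ (s - 1).
  by move=> x0; rewrite -{2}(ger0_norm x0) -powRMB1// /spow (ger0_norm x0).
have spowN x : spow s (- x) = - spow s x by rewrite /spow normrN mulrN.
have same x y : 0 <= x -> x <= y ->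
    `|spow s y - spow s x| <= (s - 1) * Num.max `|y| `|x| `^ (s - 2) * `|y - x|.
  move=> x0 xy; have y0 : 0 <= y by lra.
  rewrite !nneg// !ger0_norm ?subr_ge0//; last first.
    by apply: ge0_ler_powR; rewrite ?nnegrE//; lra.
  by rewrite max_l// diffp.
have mixed x y : x <= 0 -> 0 <= y ->
    `|spow s y - spow s x| <= (s - 1) * Num.max `|y| `|x| `^ (s - 2) * `|y - x|.
  move=> x0 y0; rewrite -[in spow s x](opprK x) spowN opprK.
  rewrite !nneg ?oppr_ge0// (ger0_norm (_ : 0 <= _ + _)) ?addr_ge0 ?powR_ge0//.
  have -> : `|y - x| = y + - x by rewrite ger0_norm//; lra.
  have -> : `|x| = - x by rewrite ler0_norm.
  have -> : `|y| = y by rewrite ger0_norm.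
  have nx0 : 0 <= - x by lra.
  move: (- x) nx0 => z z0.
  have mono u : 0 <= u -> u <= Num.max y z ->
      u `^ (s - 1) <= Num.max y z `^ (s - 2) * u.
    move=> u0 um; rewrite -{1}(ger0_norm u0) -powRMB1// ger0_norm//.
    by apply: ler_wpM2r => //; apply: ge0_ler_powR; rewrite ?nnegrE//; lra.
  have := mono y y0; rewrite le_max lexx => /(_ isT) Hy.
  have := mono z z0; rewrite le_max lexx orbT => /(_ isT) Hz.
  have M0 : 0 <= Num.max y z `^ (s - 2) by exact: powR_ge0.
  move: (Num.max y z `^ _) M0 Hy Hz => M M0 Hy Hz.
  have := mulr_ge0 M0 (addr_ge0 y0 z0); nra.
have sym x y : `|spow s y - spow s x| <= (s - 1) * Num.max `|y| `|x| `^ (s - 2) * `|y - x| ->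
    `|spow s x - spow s y| <= (s - 1) * Num.max `|x| `|y| `^ (s - 2) * `|x - y|.
  by rewrite distrC (distrC y) maxC.
have neg x y : `|spow s (- y) - spow s (- x)|
      <= (s - 1) * Num.max `|- y| `|- x| `^ (s - 2) * `|- y - - x| ->
    `|spow s y - spow s x| <= (s - 1) * Num.max `|y| `|x| `^ (s - 2) * `|y - x|.
  by rewrite !spowN !normrN -!opprD !normrN.
case: (leP 0 a) => a0; case: (leP 0 b) => b0.
- by case: (leP a b) => [|/ltW] ab; [apply: sym|]; apply: same.
- by apply: mixed => //; exact: ltW.
- by apply: sym; apply: mixed => //; exact: ltW.
- apply: neg; have na : 0 <= - a by lra.
  have nb : 0 <= - b by lra.
  by case: (leP (- a) (- b)) => [|/ltW] ab; [apply: sym|]; apply: same.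
Qed.

Definition c_up s : R := s * s * 2 `^ s.
Definition c_low s : R := (2 `^ (s + 1))^-1.

(** The tangent bound at [a + t] has slope [spow s (a + t)], which the
    Lipschitz bound trades for the slope at [a]. *)
Lemma norm_powR_upper s a t : 2 < s ->
  `|a + t| `^ s
  <= `|a| `^ s + s * spow s a * t
     + c_up s * (`|a| `^ (s - 2) * t ^+ 2 + `|t| `^ s).
Proof.
move=> s2.
have := norm_powR_tangent (a + t) a s2.
have := spow_lipschitz (a + t) a s2.
have -> : a + t - a = t by ring.
have -> : a - (a + t) = - t by ring.
set D := spow s (a + t); set d := spow s a.
set M := Num.max _ _ => L T.
have s0 : 0 < s by lra.
have HM : M `^ (s - 2) <= 2 `^ (s - 2) * (`|a| `^ (s - 2) + `|t| `^ (s - 2)).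
  apply: le_trans (powR_add_le _ _ _); rewrite ?normr_ge0//; last lra.
  apply: ge0_ler_powR; rewrite ?nnegrE /M ?le_max ?normr_ge0 //; [lra|exact: addr_ge0|].
  by rewrite ge_max ler_normD lerDl normr_ge0.
have t20 : 0 <= t ^+ 2 by exact: sqr_ge0.
have H1 : (D - d) * t <= (s - 1) * M `^ (s - 2) * t ^+ 2.
  apply: le_trans (ler_norm _) _; rewrite normrM.
  apply: le_trans (ler_wpM2r (normr_ge0 t) L) _.
  by rewrite -[leLHS]mulrA -expr2 real_normK ?num_real.
have E : `|t| `^ s = `|t| `^ (s - 2) * t ^+ 2 by rewrite powRMB2.
rewrite E -mulrDl.
set U := _ + `|t| `^ (s - 2) in HM *.
have U0 : 0 <= U by rewrite addr_ge0 ?powR_ge0.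
apply: le_trans (_ : `|a| `^ s + s * d * t + s * ((s - 1) * M `^ (s - 2) * t ^+ 2) <= _).
  by have := ler_wpM2l (ltW s0) H1; lra.
rewrite lerD2l /c_up.
have P : 2 `^ (s - 2) <= 2 `^ s :> R by apply: ler_powR; lra.
have H2 : M `^ (s - 2) <= 2 `^ s * U by apply: le_trans HM _; exact: ler_wpM2r.
have H3 : (s - 1) * M `^ (s - 2) <= s * (2 `^ s * U).
  by apply: ler_pM => //; rewrite ?powR_ge0//; lra.
have := ler_wpM2l (ltW s0) (ler_wpM2r t20 H3); lra.
Qed.

(** At the midpoint [m] of [a] and [a + t], with [h = t / 2], convexity leaves
    the power [s / 2] of [m ^+ 2 + h ^+ 2]. Superadditivity bounds it below with
    the s-th power of [h], the tangent bound with the square of [h]; so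
    twice the power is at least the sum of both second-order terms. *)
Lemma norm_powR_lower s a t : 2 < s ->
  `|a| `^ s + s * spow s a * t
     + c_low s * (`|a| `^ (s - 2) * t ^+ 2 + `|t| `^ s)
  <= `|a + t| `^ s.
Proof.
move=> s2; have s0 : 0 < s by lra.
pose m := a + t / 2; pose h := t / 2; pose q := s / 2.
have q1 : 1 <= q by rewrite /q; lra.
have sq0 (c : R) : 0 <= c * c by rewrite -expr2 sqr_ge0.
have A1 := norm_powR_tangent a m s2.
have A2 := powR_midpoint q1 (sq0 (a + t)) (sq0 a).
have mid : ((a + t) * (a + t) + a * a) / 2 = m * m + h * h by rewrite /m /h; field.
rewrite mid -!norm_powR_sqr in A2.
have A3 := powR_superadd q1 (sq0 m) (sq0 h).
have A4 := powR_tangent q1 (sq0 m) (addr_ge0 (sq0 m) (sq0 h)).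
have qq : (q - 1) = (s - 2) / 2 by rewrite /q; field.
rewrite qq -!norm_powR_sqr in A3 A4.
have hh : m * m + h * h - m * m = h ^+ 2 by ring.
rewrite hh in A4.
have ma : s * spow s a * (m - a) = s * spow s a * t / 2 by rewrite /m; field.
rewrite ma in A1.
pose P := `|m| `^ (s - 2) * h ^+ 2; pose Q := `|h| `^ s.
have P0 : 0 <= P by rewrite mulr_ge0 ?powR_ge0 ?sqr_ge0.
have Q0 : 0 <= Q by exact: powR_ge0.
have B1 : `|a| `^ (s - 2) * t ^+ 2 <= 2 `^ s * (P + Q).
  have ha : `|a| <= `|m| + `|h|.
    by rewrite (_ : a = m - h) ?ler_normB // /m /h; ring.
  have : `|a| `^ (s - 2) <= 2 `^ (s - 2) * (`|m| `^ (s - 2) + `|h| `^ (s - 2)).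
    apply: le_trans (powR_add_le _ _ _); rewrite ?normr_ge0//; last lra.
    by apply: ge0_ler_powR; rewrite ?nnegrE //; [lra|exact: addr_ge0].
  have -> : 2 `^ s * (P + Q) = (2 `^ (s - 2) * (`|m| `^ (s - 2) + `|h| `^ (s - 2))) * t ^+ 2.
    rewrite /Q -(powRMB2 h s2) /P -mulrDl.
    have := @powRMB2 s (2 : R) s2; rewrite (ger0_norm (ler0n _ 2)) => <-.
    have -> : t ^+ 2 = 2 ^+ 2 * h ^+ 2 by rewrite /h; field.
    by ring.
  by apply: ler_wpM2r; exact: sqr_ge0.
have B2 : `|t| `^ s = 2 `^ s * Q.
  have -> : t = 2 * h by rewrite /h; field.
  by rewrite normrM powRM// ger0_norm.
have A5 : s / 2 * P = q * `|m| `^ (s - 2) * h ^+ 2 by rewrite mulrA.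
have K0 : 0 < 2 `^ s :> R by exact: powR_gt0.
rewrite /c_low powRD; last by rewrite pnatr_eq0 implybT.
rewrite powRr1//.
apply: le_trans (_ : `|a| `^ s + s * spow s a * t + (P + Q) <= _).
  rewrite lerD2l ler_pdivrMl ?mulr_gt0// B2.
  have := mulr_ge0 (ltW K0) P0; have := mulr_ge0 (ltW K0) Q0; lra.
have : P <= q * `|m| `^ (s - 2) * h ^+ 2 by rewrite -A5 ler_peMl//; lra.
by rewrite /Q; lra.
Qed.

Lemma ler_powRD s x t : 1 <= s -> 0 <= x -> 0 <= t ->
  (x + t) `^ s <= x `^ s + s * 2 `^ s * (x `^ (s - 1) * t + t `^ s).
Proof.
move=> s1 x0 t0.
have H := powR_tangent s1 (addr_ge0 x0 t0) x0.
have K : (x + t) `^ (s - 1) <= 2 `^ s * (x `^ (s - 1) + t `^ (s - 1)).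
  apply: le_trans (powR_add_le _ x0 t0) _; first lra.
  by apply: ler_wpM2r; rewrite ?addr_ge0 ?powR_ge0//; apply: ler_powR; lra.
have E : t * t `^ (s - 1) = t `^ s by rewrite mulr_powRB1//; lra.
have s0 : 0 <= s by lra.
have := ler_wpM2l s0 (ler_wpM2r t0 K).
have -> : s * (2 `^ s * (x `^ (s - 1) + t `^ (s - 1)) * t)
  = s * 2 `^ s * (x `^ (s - 1) * t + t * t `^ (s - 1)) by ring.
by rewrite E; lra.
Qed.

End PowerInequalities.

(** * Existence of minimizers *)

Section Minimizers.
Import boolp classical_sets topology normedtype derive.
Import numFieldNormedType.Exports.
Variable R : realType.

(** The tangent bound in both directions; it stands in for continuity of the
    power at 0, where the power is not differentiable if [q = 1]. *)
Lemma norm_powR_near (q a b : R) : 1 <= q -> `|a - b| <= 1 ->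
  `| `|a| `^ q - `|b| `^ q| <= q * (`|a| + 1) `^ (q - 1) * `|a - b|.
Proof.
move=> q1 ab.
have half (x y : R) : `|x| <= `|a| + 1 -> `|x - y| = `|a - b| ->
    `|x| `^ q - `|y| `^ q <= q * (`|a| + 1) `^ (q - 1) * `|a - b|.
  move=> xa xy; have := powR_tangent q1 (normr_ge0 x) (normr_ge0 y).
  have P0 : 0 <= `|x| `^ (q - 1) by exact: powR_ge0.
  have PM : `|x| `^ (q - 1) <= (`|a| + 1) `^ (q - 1).
    by apply: ge0_ler_powR; rewrite ?nnegrE //; [lra|exact: addr_ge0].
  have D : `|x| - `|y| <= `|a - b|.
    by rewrite -xy; apply: le_trans (ler_norm _) (ler_dist_dist _ _).
  have q0 : 0 <= q by lra.
  have := ler_wpM2l (mulr_ge0 q0 P0) D.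
  have := ler_wpM2l q0 (ler_wpM2r (normr_ge0 (a - b)) PM); lra.
rewrite ler_norml; apply/andP; split; last by apply: half => //; lra.
rewrite lerNl opprB; apply: half; last exact: distrC.
have -> : b = a - (a - b) by ring.
by apply: le_trans (ler_normB _ _) _; rewrite lerD2l.
Qed.

Lemma continuous_norm_powR (q : R) : 1 <= q ->
  continuous (fun t : R => `|t| `^ q).
Proof.
move=> q1 a; apply/cvgrPdist_le => /= e e0.
have K0 : 0 < q * (`|a| + 1) `^ (q - 1).
  by rewrite mulr_gt0 ?powR_gt0 ?ltr_wpDl //; lra.
near=> b.
have ab : `|a - b| <= 1 by near: b; exact: cvgr_dist_le.
apply: le_trans (norm_powR_near q1 ab) _.
rewrite -ler_pdivlMl// mulrC.
by near: b; apply: cvgr_dist_le => //; rewrite divr_gt0.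
Unshelve. all: by end_near. Qed.

Lemma continuous_sum (T : topologicalType) (I : Type) (r : seq I)
    (F : I -> T -> R) : (forall i, continuous (F i)) ->
  continuous (fun z => \sum_(i <- r) F i z).
Proof.
move=> Fc; elim: r => [|i r IHr] z.
  rewrite (_ : (fun _ => _) = fun=> 0); first exact: cvg_cst.
  by apply/funext => w; rewrite big_nil.
rewrite (_ : (fun _ => _) = F i \+ (fun z => \sum_(i <- r) F i z)).
  by apply: (@cvgD _ R^o); [exact: Fc|exact: IHr].
by apply/funext => w; rewrite big_cons.
Qed.

(** A sum of powers of residuals of a linear map attains its minimum even if
    the map is not injective: it only depends on the image point, and the rank
    factorization parametrizes the image by an injective map, for which
    sublevel sets lie in a box. *)
Lemma sum_norm_powR_minimizer (N d : nat) (B : 'M[R]_(N, d)) (b q : 'I_N -> R) :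
  (forall i, 1 <= q i) ->
  exists x : 'cV[R]_d, forall y : 'cV[R]_d,
    \sum_i `|(B *m x) i 0 - b i| `^ q i <= \sum_i `|(B *m y) i 0 - b i| `^ q i.
Proof.
move=> q1; pose C := col_base B; pose L := pinvmx C.
have LC : L *m C = 1%:M by apply: mulVpmx; exact: col_base_full.
pose h (z : 'rV[R]_(\rank B)) : R := \sum_i `|(C *m z^T) i 0 - b i| `^ q i.
have h0 z : 0 <= h z by apply: sumr_ge0 => i _; exact: powR_ge0.
have hx (x : 'cV[R]_d) :
    \sum_i `|(B *m x) i 0 - b i| `^ q i = h (row_base B *m x)^T.
  by rewrite /h trmxK mulmxA mulmx_base.
have [R' RR'] : exists R', row_base B *m R' = 1%:M.
  by apply/row_freeP; exact: row_base_free.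
have q0 i : 0 < q i by have := q1 i; lra.
pose H := h 0 + 1.
pose Y := \sum_i (`|b i| + H `^ (q i)^-1).
pose M := \sum_j \sum_i `|L j i| * Y.
have H0 : 0 <= H by rewrite addr_ge0.
have Y0 : 0 <= Y by apply: sumr_ge0 => i _; rewrite addr_ge0 ?powR_ge0.
have Mbox z : h z <= h 0 -> forall j, `|z 0 j| <= M.
  move=> hz j.
  have yb i : `|(C *m z^T) i 0| <= Y.
    have t0 : `|(C *m z^T) i 0 - b i| `^ q i <= H.
      apply: le_trans (_ : h z <= _); last by rewrite /H; lra.
      by rewrite /h (bigD1 i)//= lerDl; apply: sumr_ge0 => k _; exact: powR_ge0.
    have t1 : `|(C *m z^T) i 0 - b i| <= H `^ (q i)^-1.
      rewrite -[leLHS](@powRr1 R)// -(@divff _ (q i)) ?gt_eqF// powRrM.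
      by apply: ge0_ler_powR; rewrite ?nnegrE ?powR_ge0 // invr_ge0 ltW.
    apply: le_trans (_ : `|b i| + H `^ (q i)^-1 <= _).
      rewrite -[X in `|X|](subrK (b i)) addrC; apply: le_trans (ler_normD _ _) _.
      by rewrite lerD2l.
    rewrite /Y (bigD1 i)//= lerDl; apply: sumr_ge0 => k _.
    by rewrite addr_ge0 ?powR_ge0.
  have -> : z 0 j = (L *m (C *m z^T)) j 0 by rewrite mulmxA LC mul1mx mxE.
  rewrite mxE; apply: le_trans (ler_norm_sum _ _ _) _.
  apply: le_trans (_ : \sum_i `|L j i| * Y <= _).
    by apply: ler_sum => i _; rewrite normrM; apply: ler_wpM2l.
  rewrite /M (bigD1 j)//= lerDl; apply: sumr_ge0 => k _.
  by apply: sumr_ge0 => i _; rewrite mulr_ge0.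
pose K := [set v : 'rV[R]_(\rank B) | forall i, `[- M, M]%classic (v ord0 i)]%classic.
have Kc : compact K.
  apply: (@rV_compact _ _ (fun=> `[- M, M]%classic)).
  by move=> _; exact: segment_compact.
have M0 : 0 <= M.
  by apply: sumr_ge0 => j _; apply: sumr_ge0 => i _; rewrite mulr_ge0.
have K0 : K 0 by move=> i; rewrite mxE /= in_itv/=; lra.
have hc : continuous h.
  apply: continuous_sum => i.
  have cc : continuous (fun z : 'rV[R]_(\rank B) => (C *m z^T) i 0 - b i).
    rewrite (_ : (fun _ => _) = fun z : 'rV[R]_(\rank B) =>
        \sum_j C i j * z 0 j - b i); last first.
      apply/funext => w; rewrite mxE (eq_bigr (fun j => C i j * w 0 j)) //.
      by move=> j _; rewrite [w^T _ _]mxE.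
    move=> z; apply: (@continuousB _ R^o); last exact: cst_continuous.
    apply: continuous_sum => j w; apply: continuousM; first exact: cst_continuous.
    exact: coord_continuous.
  by move=> z; exact: (continuous_comp (cc z) (@continuous_norm_powR (q i) _ _)).
have [z zK zmin] := EVT_min_rV (ex_intro _ _ K0) Kc (continuous_subspaceT hc).
exists (R' *m z^T) => y; rewrite !hx mulmxA RR' mul1mx trmxK.
set w := (_ *m y)^T.
have [hw|hw] := leP (h w) (h 0).
  apply: zmin; rewrite inE => i; have := Mbox _ hw i.
  by rewrite /= in_itv/= ler_norml.
by apply: le_trans (zmin 0 _) (ltW hw); rewrite inE.
Qed.

End Minimizers.

(** * Parameters of the algorithm *)

Section Params.
Variable R : realType.
Implicit Types (p s : R) (n : nat).

Definition iters p s n : R :=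
  let nu := p^-1 - s^-1 in n%:R `^ (nu / (1 + nu)).
(** Total length of the flow steps of a phase, so short that they raise the
    potential by at most [1 / 2]. *)
Definition flow_time s : R := (28 * (s * 2 `^ s))^-1.
(** Multiplying a weight [w] by it doubles the coefficient [w `^ (s - p)]. *)
Definition widen_factor p s : R := 2 `^ (s - p)^-1.
(** A coordinate is overloaded if its load exceeds this multiple of its weight;
    a width step then raises the potential by at most one eighth of what it adds
    to the minimum of the oracle ([widen_weight_pot]). *)
Definition width_ratio p s : R :=
  (8 * widen_factor p s `^ s * 4 `^ p) `^ p^-1.
(** The second factor is such that the other coordinates cannot make the loads
    exceed the threshold for width steps ([width_ratio_flow_step]). *)
Definition flow_coef p s : R :=
  flow_time s * (4 * width_ratio p s `^ s) `^ (- (s - 1)^-1).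
Definition flow_step p s n : R := flow_coef p s / iters p s n.
(** Least increase of the oracle's minimum in a width step. *)
Definition gain p s n : R := (4 `^ p)^-1 / (2 * iters p s n).
Definition step_len s : R := c_low s * flow_time s `^ s / (64 * (c_up s * 2 `^ s)).
(** Number of flow steps plus an upper bound for the number of width steps,
    since the oracle's minimum is at most 4. *)
Definition phase_len p s n : R :=
  flow_time s / flow_step p s n + 8 * 4 `^ p * iters p s n.
(** Factor of [1 + ln n] in the number of steps packed into an iteration: steps
    of a phase relative to [iters], times phases relative to the logarithms. *)
Definition budget p s : R :=
  (flow_time s / flow_coef p s + 8 * 4 `^ p + 1) * (4 * s / step_len s + 1).
Definition weight0 s n : R := n%:R `^ (- s^-1).

Section Bounds.
Variables (p s : R) (n : nat).
Hypotheses (p2 : 2 <= p) (ps : p < s) (n0 : (0 < n)%N).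

Local Ltac slra := have := p2; have := ps; lra.

Lemma natr_ge1 : 1 <= n%:R :> R. Proof. by rewrite ler1n. Qed.

Lemma powR_ge1 (a x : R) : 1 <= a -> 0 <= x -> 1 <= a `^ x.
Proof. by move=> a1 x0; rewrite -(powRr0 a); apply: ler_powR. Qed.

Lemma powR_le1 (a x : R) : 0 < a <= 1 -> 0 <= x -> a `^ x <= 1.
Proof. by move=> a1 x0; rewrite -(powRr0 a); apply: ger_powR. Qed.

Lemma nu_ge0 : 0 <= p^-1 - s^-1.
Proof. by rewrite subr_ge0 lef_pV2 ?posrE; slra. Qed.

Lemma iters_ge1 : 1 <= iters p s n.
Proof.
rewrite /iters; apply: powR_ge1; rewrite ?natr_ge1 // divr_ge0 ?nu_ge0 //.
by rewrite addr_ge0 ?nu_ge0.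
Qed.

Lemma c_low_gt0 : 0 < c_low s :> R.
Proof. by rewrite invr_gt0 powR_gt0. Qed.

Lemma c_low_le1 : c_low s <= 1 :> R.
Proof. by rewrite invf_le1 ?powR_gt0//; apply: powR_ge1; slra. Qed.

Lemma c_up_ge1 : 1 <= c_up s :> R.
Proof.
have : 1 <= 2 `^ s :> R by apply: powR_ge1; slra.
have s2 : 2 < s by slra.
rewrite /c_up => H; have : 1 <= s * s by nra.
nra.
Qed.

Lemma flow_time_gt0 : 0 < flow_time s.
Proof. by rewrite invr_gt0 !mulr_gt0 ?powR_gt0//; slra. Qed.

Lemma flow_time_le1 : flow_time s <= 1.
Proof.
have : 1 <= 2 `^ s :> R by apply: powR_ge1; slra.
move=> H; rewrite invf_le1 ?mulr_gt0 ?powR_gt0//; try slra.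
have s2 : 2 < s by slra.
nra.
Qed.

Lemma flow_timeE : 7 * (s * 2 `^ s) * flow_time s = 1 / 4.
Proof.
rewrite /flow_time; field; rewrite !gt_eqF ?powR_gt0//; slra.
Qed.

Lemma widen_factor_ge1 : 1 <= widen_factor p s.
Proof. by apply: powR_ge1; [slra|rewrite invr_ge0; slra]. Qed.

Lemma widen_factorX : widen_factor p s `^ (s - p) = 2.
Proof. by rewrite -powRrM mulVf ?powRr1//; rewrite gt_eqF; slra. Qed.

Lemma width_ratioX : width_ratio p s `^ p = 8 * widen_factor p s `^ s * 4 `^ p.
Proof.
rewrite -powRrM mulVf ?powRr1 ?gt_eqF//; last slra.
by rewrite !mulr_ge0 ?powR_ge0.
Qed.

Lemma width_ratio_ge1 : 1 <= width_ratio p s.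
Proof.
have h1 : 1 <= widen_factor p s `^ s by apply: powR_ge1; [exact: widen_factor_ge1|slra].
have h2 : 1 <= 4 `^ p :> R by apply: powR_ge1; slra.
apply: powR_ge1; last by rewrite invr_ge0; slra.
nra.
Qed.

Lemma flow_coef_gt0 : 0 < flow_coef p s.
Proof.
have w0 : 0 < width_ratio p s := lt_le_trans ltr01 width_ratio_ge1.
by rewrite /flow_coef !(mulr_gt0, powR_gt0, flow_time_gt0).
Qed.

Let X := 4 * width_ratio p s `^ s.
Let X1 : (1:R) <= X.
Proof.
have : 1 <= width_ratio p s `^ s by apply: powR_ge1; [exact: width_ratio_ge1|slra].
rewrite /X; slra.
Qed.

Let Xi : 0 < X `^ (- (s - 1)^-1) <= 1.
Proof.
rewrite powR_gt0 ?(lt_le_trans _ X1)//= powRN invf_le1 ?powR_gt0 ?(lt_le_trans _ X1)//.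
by apply: powR_ge1 => //; rewrite invr_ge0; slra.
Qed.

Lemma flow_coef_le : flow_coef p s <= flow_time s.
Proof. by rewrite /flow_coef ler_piMr ?(ltW flow_time_gt0)//; case/andP: Xi. Qed.

Lemma flow_step_gt0 : 0 < flow_step p s n.
Proof. by rewrite divr_gt0 ?flow_coef_gt0// (lt_le_trans _ iters_ge1). Qed.

Lemma flow_step_le : flow_step p s n <= flow_coef p s.
Proof.
rewrite ler_pdivrMr ?(lt_le_trans _ iters_ge1)// ler_peMr ?(ltW flow_coef_gt0)//.
exact: iters_ge1.
Qed.

(** Coordinates that are not overloaded account for at most half of the
    threshold beyond which a step is a width step. *)
Lemma width_ratio_flow_step :
  4 * width_ratio p s `^ s <= flow_step p s n `^ (1 - s).
Proof.
have s1 : 0 < s - 1 by slra.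
have e : 1 - s = - (s - 1) by ring.
have XE : (X `^ (- (s - 1)^-1)) `^ (1 - s) = X.
  by rewrite -powRrM e mulrNN mulVf ?gt_eqF// powRr1//; apply: le_trans X1.
rewrite -/X -[leLHS]XE e [leLHS]powRN [leRHS]powRN lef_pV2 ?posrE; first last.
- by apply: powR_gt0; exact: flow_step_gt0.
- by apply: powR_gt0; case/andP: Xi.
apply: ge0_ler_powR; rewrite ?nnegrE ?(ltW flow_step_gt0) ?(ltW s1) //.
  by case/andP: Xi => /ltW.
apply: le_trans flow_step_le _; rewrite /flow_coef ler_piMl ?flow_time_le1//.
by case/andP: Xi => /ltW.
Qed.

(** The exponent in [iters] is the one that balances the gain of a width step
    against the length of a flow step. *)
Lemma gain_bound :
  (2 * iters p s n)^-1
  <= weight0 s n `^ (s - p) * (flow_step p s n `^ (1 - s) / 2) `^ (p / s).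
Proof.
pose nu := p^-1 - s^-1; have nu0 : 0 <= nu by exact: nu_ge0.
have T1 := iters_ge1; have T0 : 0 < iters p s n by apply: lt_le_trans T1.
have nn : n%:R = iters p s n `^ ((1 + nu) / nu).
  rewrite /iters -/nu -powRrM; have -> : nu / (1 + nu) * ((1 + nu) / nu) = 1.
    have : 0 < nu by rewrite /nu subr_gt0 ltf_pV2 ?posrE; slra.
    by move=> nu0'; field; rewrite gt_eqF // gt_eqF // addr_gt0.
  by rewrite powRr1.
have nu0' : 0 < nu by rewrite /nu subr_gt0 ltf_pV2 ?posrE; slra.
have pN : p != 0 by rewrite gt_eqF//; slra.
have sN : s != 0 by rewrite gt_eqF//; slra.
have w0E : weight0 s n `^ (s - p) = iters p s n `^ (- (1 + p - p / s)).
  rewrite /weight0 nn -!powRrM; congr (_ `^ _); rewrite /nu; field.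
  by rewrite pN sN /= !gt_eqF //; [slra|have := p2; have := ps; nra].
rewrite w0E; clear nn w0E; rewrite powRM ?powR_ge0 ?invr_ge0// -powRrM.
have q1 : 0 < p / s <= 1 by rewrite divr_gt0 ?ler_pdivrMr ?mul1r ?(ltW ps); slra.
have h2 : 2^-1 <= 2^-1 `^ (p / s) :> R.
  by apply: ger1_powR; [slra|case/andP: q1].
have e : (1 - s) * (p / s) = - (p - p / s) by field.
have h3 : iters p s n `^ (p - p / s) <= flow_step p s n `^ ((1 - s) * (p / s)).
  have pps : 0 <= p - p / s by case/andP: q1; slra.
  have -> : (1 - s) * (p / s) = -1 * (p - p / s) by rewrite mulN1r.
  rewrite [leRHS]powRrM powR_inv1 ?(ltW flow_step_gt0)//.
  have cT : iters p s n <= (flow_step p s n)^-1.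
    rewrite invf_div ler_pdivlMr ?flow_coef_gt0// ler_piMr ?(ltW T0)//.
    by apply: le_trans flow_coef_le flow_time_le1.
  by apply: ge0_ler_powR; rewrite ?nnegrE ?invr_ge0 ?(ltW T0) ?(ltW flow_step_gt0).
apply: le_trans (_ : iters p s n `^ (- (1 + p - p / s)) *
   (iters p s n `^ (p - p / s) * 2^-1) <= _).
  rewrite mulrA -powRD; last by rewrite (gt_eqF T0) implybT.
  have -> : - (1 + p - p / s) + (p - p / s) = - 1 by ring.
  by rewrite powR_inv1 ?(ltW T0)// invfM mulrC.
by apply: ler_wpM2l; rewrite ?powR_ge0//; apply: ler_pM; rewrite ?powR_ge0 ?invr_ge0.
Qed.

Let cu0 : 0 < c_up s := lt_le_trans ltr01 c_up_ge1.
Let ts0 : 0 < flow_time s `^ s := powR_gt0 s flow_time_gt0.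
Let p20 : 0 < 2 `^ s := @powR_gt0 R 2 s (ltr0Sn R 1).

Lemma step_len_gt0 : 0 < step_len s.
Proof.
apply: divr_gt0; first exact: mulr_gt0 c_low_gt0 ts0.
by apply: mulr_gt0; [|exact: mulr_gt0 cu0 p20].
Qed.

Lemma step_len_le1 : step_len s <= 1.
Proof.
have cu := c_up_ge1.
have p1 : 1 <= 2 `^ s :> R by apply: powR_ge1; slra.
have t1 : flow_time s `^ s <= 1.
  by apply: powR_le1; rewrite ?flow_time_gt0 ?flow_time_le1//; slra.
rewrite ler_pdivrMr ?mul1r; last first.
  by apply: mulr_gt0; [|exact: mulr_gt0 cu0 p20].
apply: le_trans (_ : 1 <= _).
  by have := ler_pM (ltW c_low_gt0) (ltW ts0) c_low_le1 t1; rewrite mul1r.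
have := ler_pM ler01 ler01 cu p1; slra.
Qed.

Lemma step_lenE : step_len s * (c_up s * 2 `^ s) / (c_low s * flow_time s `^ s) = 1 / 64.
Proof.
rewrite /step_len; field.
by rewrite (gt_eqF cu0) (gt_eqF ts0) (gt_eqF p20) (gt_eqF c_low_gt0).
Qed.

End Bounds.
End Params.

(** * The residual problem and the oracle *)

Lemma sum_powR_le (R : realType) (I : finType) (q : R) (a : I -> R) :
  1 <= q -> (forall i, 0 <= a i) ->
  \sum_i a i `^ q <= (\sum_i a i) `^ q.
Proof.
move=> q1 a0.
suff [] : 0 <= \sum_i a i /\ \sum_i a i `^ q <= (\sum_i a i) `^ q by [].
elim/big_rec2: _ => [|i x y _ [x0 IH]].
  by rewrite powR0 //; apply/eqP => q0; rewrite q0 in q1; lra.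
split; first exact: addr_ge0.
apply: le_trans (powR_superadd q1 (a0 i) x0).
by rewrite lerD2l.
Qed.

Section Regression.
Variables (R : realType) (p s : R) (n d : nat) (A : 'M[R]_(n, d)) (b : 'cV[R]_n).
Implicit Types (x v : 'cV[R]_d) (w : 'I_n -> R) (G : R).

Definition resid x i : R := (A *m x - b) i 0.
Definition im v i : R := (A *m v) i 0.
Definition pobj x : R := \sum_i `|resid x i| `^ s.
Definition lin x v : R := \sum_i s * spow s (resid x i) * im v i.
Definition quad x v : R := \sum_i `|resid x i| `^ (s - 2) * im v i ^+ 2.
Definition pot w : R := \sum_i w i `^ s.
(** Bound on the s-norm of the cheap step; loads are measured in this unit. *)
Definition radius G : R := (2 `^ s * (G / c_low s)) `^ s^-1.

(** The slope is prescribed by a penalty rather than by a constraint, to fit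
    the form of a smoothed problem. Its factor makes a value of at most 4 force
    the slope below [- G / 2]. *)
Definition oracle_obj x G w v : R :=
  16 * (lin x v / G + 1) ^+ 2 + c_low s / 2 / G * quad x v
  + \sum_i w i `^ (s - p) * `|im v i / radius G| `^ p.

Definition oracle_min x G w v : Prop := is_minimizer (oracle_obj x G w) v.

Lemma imD v v' i : im (v + v') i = im v i + im v' i.
Proof. by rewrite /im mulmxDr mxE. Qed.

Lemma imZ c v i : im (c *: v) i = c * im v i.
Proof. by rewrite /im -scalemxAr mxE. Qed.

Lemma im0 i : im 0 i = 0.
Proof. by rewrite /im mulmx0 mxE. Qed.

Lemma residD x v i : resid (x + v) i = resid x i + im v i.
Proof. by rewrite /resid /im mulmxDr !mxE addrAC. Qed.

Lemma linD x v v' : lin x (v + v') = lin x v + lin x v'.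
Proof. by rewrite -big_split; apply: eq_bigr => i _; rewrite imD mulrDr. Qed.

Lemma linZ x c v : lin x (c *: v) = c * lin x v.
Proof. by rewrite mulr_sumr; apply: eq_bigr => i _; rewrite imZ; ring. Qed.

Lemma quadZ x c v : quad x (c *: v) = c ^+ 2 * quad x v.
Proof. by rewrite mulr_sumr; apply: eq_bigr => i _; rewrite imZ; ring. Qed.

Lemma quad_ge0 x v : 0 <= quad x v.
Proof. by apply: sumr_ge0 => i _; rewrite mulr_ge0 ?powR_ge0 ?sqr_ge0. Qed.

Lemma pobj_ge0 x : 0 <= pobj x.
Proof. by apply: sumr_ge0 => i _; exact: powR_ge0. Qed.

Lemma oracle_obj_ge0 x G w v : 0 <= G -> 0 <= oracle_obj x G w v.
Proof.
move=> G0; rewrite /oracle_obj; apply: addr_ge0; last first.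
  by apply: sumr_ge0 => i _; rewrite mulr_ge0 ?powR_ge0.
apply: addr_ge0; first by rewrite mulr_ge0 ?sqr_ge0.
rewrite mulr_ge0 ?quad_ge0// divr_ge0// divr_ge0//.
exact: ltW (c_low_gt0 s).
Qed.

Hypotheses (p2 : 2 <= p) (ps : p < s) (n0 : (0 < n)%N).

Lemma s_gt2 : 2 < s. Proof. by have := p2; have := ps; lra. Qed.

Lemma pobj_upper x v :
  pobj (x + v) <= pobj x + lin x v + c_up s * (quad x v + \sum_i `|im v i| `^ s).
Proof.
rewrite -!big_split mulr_sumr -big_split; apply: ler_sum => i _.
by rewrite residD; apply: norm_powR_upper; exact: s_gt2.
Qed.

Lemma pobj_lower x v :
  pobj x + lin x v + c_low s * (quad x v + \sum_i `|im v i| `^ s) <= pobj (x + v).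
Proof.
rewrite -!big_split mulr_sumr -big_split; apply: ler_sum => i _.
by rewrite residD; apply: norm_powR_lower; exact: s_gt2.
Qed.

Lemma radius_gt0 G : 0 < G -> 0 < radius G.
Proof. by move=> G0; rewrite powR_gt0// mulr_gt0 ?divr_gt0 ?powR_gt0 ?c_low_gt0. Qed.

Lemma radiusX G : 0 < G -> radius G `^ s = 2 `^ s * (G / c_low s).
Proof.
move=> G0; have s2 := s_gt2; rewrite -powRrM mulVf ?powRr1 ?gt_eqF//; last lra.
by rewrite mulr_ge0 ?divr_ge0 ?powR_ge0 ?(ltW G0) ?(ltW (c_low_gt0 s)).
Qed.

Lemma sum_im_radius G v : 0 < G ->
  \sum_i `|im v i| `^ s = radius G `^ s * \sum_i `|im v i / radius G| `^ s.
Proof.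
move=> G0; have r0 := radius_gt0 G0; rewrite mulr_sumr; apply: eq_bigr => i _.
rewrite normrM powRM// mulrCA -powRM ?normr_ge0 ?(ltW r0)//.
by rewrite normfV (gtr0_norm r0) divff ?gt_eqF// powR1 mulr1.
Qed.

Lemma residual_arith (e G c q S l : R) : 0 < c -> 0 <= q -> 0 <= S ->
  l + c * (q + S) <= - e -> G / 2 < e -> e <= G ->
  [/\ 0 < G, c * q <= - l, c * S <= - l & G / 2 < - l].
Proof.
move=> c0 q0 S0 H Glo Ghi.
have := mulr_ge0 (ltW c0) q0; have := mulr_ge0 (ltW c0) S0.
by move=> ? ?; split; lra.
Qed.

(** The step to the minimizer, rescaled to decrease the linear part by exactly
    [G], certifies that the oracle has a cheap point. *)
Lemma cheap_direction x y G :
  G / 2 < pobj x - pobj y -> pobj x - pobj y <= G ->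
  exists v, [/\ lin x v = - G, quad x v <= 2 * G / c_low s &
    \sum_i `|im v i / radius G| `^ s <= 1].
Proof.
move=> Glo Ghi; have s2 := s_gt2; have cl0 := c_low_gt0 s.
have s0 : 0 < s by apply: lt_trans s2.
have s1 : 0 <= s - 1 by rewrite subr_ge0 (le_trans _ (ltW s2))// ler1n.
pose u := y - x; have xu : x + u = y by rewrite addrC subrK.
have := pobj_lower x u; rewrite xu; set S := \sum_i _; set l := lin x u; set q := quad x u.
have S0 : 0 <= S by apply: sumr_ge0 => i _; exact: powR_ge0.
have q0 : 0 <= q by exact: quad_ge0.
rewrite -addrA -lerBrDl -opprB => H.
have [G0 H1 H2 H3] := residual_arith cl0 q0 S0 H Glo Ghi.
have l0 : 0 < - l by apply: le_lt_trans H3; rewrite divr_ge0 ?ltW.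
pose k := G / - l.
have k0 : 0 < k by rewrite divr_gt0.
have k2 : k <= 2 by rewrite ler_pdivrMr// mulrC -ler_pdivrMr// ltW.
have kl : k * - l = G by rewrite divfK// gt_eqF.
exists (k *: u); split.
- by rewrite linZ -/l -[k * l]opprK -mulrN kl.
- rewrite quadZ -/q ler_pdivlMr//.
  have -> : k ^+ 2 * q * c_low s = k * (k * (c_low s * q)) by ring.
  have q0' : 0 <= c_low s * q by rewrite mulr_ge0 ?(ltW cl0).
  apply: ler_pM => //; [exact: ltW|by rewrite mulr_ge0 ?(ltW k0)|].
  by rewrite -kl ler_wpM2l// ltW.
- have rs0 : 0 < radius G `^ s by rewrite powR_gt0// radius_gt0.
  rewrite -(ler_pM2l rs0) -sum_im_radius// mulr1 radiusX//.
  under eq_bigr do rewrite imZ normrM powRM//.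
  rewrite -mulr_sumr -/S (gtr0_norm k0) mulrA ler_pdivlMr//.
  have -> : k `^ s * S * c_low s = k `^ s * (c_low s * S) by ring.
  apply: le_trans (_ : k `^ s * - l <= _).
    by apply: ler_wpM2l H2; exact: powR_ge0.
  have -> : k `^ s * - l = k `^ (s - 1) * (k * - l).
    by rewrite mulrA [_ * k]mulrC mulr_powRB1 ?(ltW k0).
  rewrite kl ler_pM2r//; apply: le_trans (_ : 2 `^ (s - 1) <= _).
    by apply: ge0_ler_powR; rewrite ?nnegrE ?(ltW k0).
  by apply: ler_powR; rewrite ?ler1n// lerBlDr lerDl.
Qed.

(** For a load [t] and a weight [w], [w `^ (s - p) * t `^ p] is at most
    the s-th power of the larger one: this replaces Hoelder's inequality. *)
Lemma oracle_obj_cheap x G w v : 0 < G -> (forall i, 0 <= w i) ->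
  lin x v = - G -> quad x v <= 2 * G / c_low s ->
  \sum_i `|im v i / radius G| `^ s <= 1 ->
  oracle_obj x G w v <= 2 + pot w.
Proof.
move=> G0 w0 lv qv sv; have cl0 := c_low_gt0 s.
have s2 := s_gt2; have p2' := p2; have ps' := ps.
rewrite /oracle_obj lv mulNr divff ?gt_eqF// addNr expr0n mulr0 add0r.
have -> : 2 + pot w = 1 + (pot w + 1) by ring.
apply: lerD.
  have k0 : 0 <= c_low s / 2 / G by rewrite divr_ge0 ?(ltW G0)// divr_ge0 ?(ltW cl0).
  apply: le_trans (ler_wpM2l k0 qv) _.
  suff -> : c_low s / 2 / G * (2 * G / c_low s) = 1 by [].
  by field; rewrite !gt_eqF.
apply: le_trans (_ : pot w + \sum_i `|im v i / radius G| `^ s <= _); last by rewrite lerD2l.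
rewrite -big_split; apply: ler_sum => i _ /=.
set t := `|_|; have t0 : 0 <= t by exact: normr_ge0.
have spE (y : R) : 0 <= y -> y `^ (s - p) * y `^ p = y `^ s.
  move=> y0; case: (eqVneq y 0) => [->|yN].
    by rewrite [0 `^ p]powR0 ?gt_eqF ?mulr0 ?powR0 ?gt_eqF//; lra.
  by rewrite -powRD ?subrK// yN implybT.
have [wt|/ltW tw] := leP (w i) t.
- apply: le_trans (_ : t `^ s <= _); last by rewrite lerDr powR_ge0.
  rewrite -spE//; apply: ler_wpM2r; first exact: powR_ge0.
  by apply: ge0_ler_powR; rewrite ?nnegrE//; lra.
- apply: le_trans (_ : w i `^ s <= _); last by rewrite lerDl powR_ge0.
  rewrite -spE//; apply: ler_wpM2l; first exact: powR_ge0.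
  by apply: ge0_ler_powR; rewrite ?nnegrE//; lra.
Qed.

Lemma oracle_min_mono x G w w' v v' : (forall i, 0 <= w i) ->
  (forall i, w i <= w' i) -> oracle_min x G w v ->
  oracle_obj x G w v <= oracle_obj x G w' v'.
Proof.
move=> w0 ww mv; apply: le_trans (mv v') _; rewrite lerD2l.
apply: ler_sum => i _; apply: ler_wpM2r; first exact: powR_ge0.
have ps' := ps; have w'0 := le_trans (w0 i) (ww i).
by apply: ge0_ler_powR; rewrite ?nnegrE//; lra.
Qed.

(** Strong convexity of the oracle's objective at its minimizer, measured in
    the weighted p-norm. *)
Lemma oracle_min_gap x G w v v' : 0 < G -> oracle_min x G w v ->
  oracle_obj x G w v
  + 2 * \sum_i w i `^ (s - p) * `|(im v i - im v' i) / radius G / 2| `^ p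
  <= oracle_obj x G w v'.
Proof.
move=> G0 mv; have := mv (2^-1 *: (v + v')).
rewrite /oracle_obj; set r := radius G.
set P := fun y => \sum_i w i `^ (s - p) * `|im y i / r| `^ p.
rewrite -/(P v) -/(P v') -/(P (2^-1 *: (v + v'))).
set D := \sum_i _ => H.
have HP : P (2^-1 *: (v + v')) + D <= (P v + P v') / 2.
  rewrite -!big_split mulr_suml; apply: ler_sum => i _ /=.
  rewrite -!mulrDr -[leRHS]mulrA; apply: ler_wpM2l; first exact: powR_ge0.
  rewrite imZ imD.
  have -> : 2^-1 * (im v i + im v' i) / r = (im v i / r + im v' i / r) / 2 by ring.
  rewrite mulrBl; exact: norm_powR_midpoint.
have HQ : quad x (2^-1 *: (v + v')) <= (quad x v + quad x v') / 2.
  rewrite -big_split mulr_suml; apply: ler_sum => i _ /=.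
  rewrite imZ imD -mulrDr -[leRHS]mulrA; apply: ler_wpM2l; first exact: powR_ge0.
  by have := sqr_ge0 (im v i - im v' i); nra.
have HL : (lin x (2^-1 *: (v + v')) / G + 1) ^+ 2
    <= ((lin x v / G + 1) ^+ 2 + (lin x v' / G + 1) ^+ 2) / 2.
  rewrite linZ linD.
  have -> : 2^-1 * (lin x v + lin x v') / G = (lin x v / G + lin x v' / G) / 2 by ring.
  by move: (lin x v / G) (lin x v' / G) => a c; have := sqr_ge0 (a - c); nra.
have k0 : 0 <= c_low s / 2 / G.
  by rewrite divr_ge0 ?(ltW G0)// divr_ge0 ?(ltW (c_low_gt0 s)).
have := ler_wpM2l k0 HQ; move: H HL HP.
move: (quad x _) (quad x v) (quad x v') (c_low s / 2 / G) => q1 q2 q3 k.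
move: (P _) (P v) (P v') D => P1 P2 P3 D.
move: (_ ^+ 2) (_ ^+ 2) (_ ^+ 2) => l1 l2 l3.
lra.
Qed.

(** Uniform convexity applied to [(a - c) / 2] and [c / 2], whose midpoint is
    [a / 4]. *)
Lemma powR_split_ge (a c : R) :
  (4 `^ p)^-1 * `|a| `^ p <= 2 * `|(a - c) / 2| `^ p + `|c| `^ p.
Proof.
have p2' := p2.
have := norm_powR_midpoint ((a - c) / 2) (c / 2) p2.
have -> : ((a - c) / 2 + c / 2) / 2 = a / 4 by field.
have q (y : R) : `|y / 4| `^ p = (4 `^ p)^-1 * `|y| `^ p.
  rewrite normrM (ger0_norm (_ : 0 <= 4^-1)) ?invr_ge0// powRM ?invr_ge0// mulrC.
  by rewrite -powRN -powR_inv1// -powRrM mulN1r.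
have ch : `|c / 2| `^ p <= `|c| `^ p.
  apply: ge0_ler_powR; rewrite ?nnegrE//; first lra.
  rewrite normrM ler_piMr// ger0_norm ?invr_ge0//; lra.
rewrite q; move: (powR_ge0 `|((a - c) / 2 - c / 2) / 2| p) (powR_ge0 `|(a - c) / 2| p).
move: ch; move: (`|c| `^ p) (powR_ge0 `|c| p) => C C0.
lra.
Qed.

(** Doubling the coefficients of the overloaded coordinates raises the
    oracle's value by a constant fraction of their share: the new minimizer
    must either keep half of its load there or move away, and strong convexity
    charges for moving away. *)
Lemma oracle_min_widen x G w w' v v' (S : pred 'I_n) : 0 < G ->
  (forall i, w' i `^ (s - p) = if S i then 2 * w i `^ (s - p) else w i `^ (s - p)) ->
  oracle_min x G w v ->
  oracle_obj x G w v
  + (4 `^ p)^-1 * \sum_(i | S i) w i `^ (s - p) * `|im v i / radius G| `^ p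
  <= oracle_obj x G w' v'.
Proof.
move=> G0 w'E mv; have := oracle_min_gap v' G0 mv.
have -> : oracle_obj x G w' v' = oracle_obj x G w v'
    + \sum_(i | S i) w i `^ (s - p) * `|im v' i / radius G| `^ p.
  rewrite /oracle_obj -[RHS]addrA; congr (_ + _).
  rewrite [in RHS](big_mkcond S) -big_split; apply: eq_bigr => i _ /=.
  by rewrite w'E; case: ifP => _; ring.
move=> H.
suff HS : (4 `^ p)^-1 * \sum_(i | S i) w i `^ (s - p) * `|im v i / radius G| `^ p
  <= 2 * \sum_i w i `^ (s - p) * `|(im v i - im v' i) / radius G / 2| `^ p
    + \sum_(i | S i) w i `^ (s - p) * `|im v' i / radius G| `^ p.
  by lra.
rewrite !(big_mkcond S) /= !mulr_sumr -big_split.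
apply: ler_sum => i _ /=; case: ifP => _; last first.
  by rewrite mulr0 addr0 mulr_ge0// mulr_ge0// powR_ge0.
rewrite mulrCA [2 * _]mulrCA -mulrDr; apply: ler_wpM2l; first exact: powR_ge0.
rewrite mulrBl; exact: powR_split_ge.
Qed.

End Regression.

(** * Analysis of one phase *)

Section Phase.
Variables (R : realType) (p s : R) (n d : nat) (A : 'M[R]_(n, d)) (b : 'cV[R]_n).
Implicit Types (x v acc : 'cV[R]_d) (w : 'I_n -> R) (G : R).
Hypotheses (p2 : 2 <= p) (ps : p < s) (n0 : (0 < n)%N).

Let s2 : 2 < s := s_gt2 p2 ps.
Local Ltac slra := have := p2; have := ps; have := s2; lra.

Notation al := (flow_step p s n).
Notation load G v i := `|im A v i / radius s G|.

Definition flow_weight G w v i : R := w i + al * load G v i.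
Definition widen_weight G w v i : R :=
  if width_ratio p s * w i < load G v i then widen_factor p s * w i else w i.

(** [f] flow steps have been accumulated among the [k] steps of the phase. The
    flow steps and the growth of the oracle's minimum pay for the potential; that
    growth also pays for each of the [k - f] width steps, until the flow time is
    used up and further steps are idle. The accumulator is the sum of the
    flow steps. *)
Definition phase_inv x G w acc (f k : nat) : Prop :=
  [/\ forall i, weight0 s n <= w i,
      forall v, oracle_min p s A b x G w v ->
        pot s w <= 1 + 7 * (s * 2 `^ s) * al * f%:R + oracle_obj p s A b x G w v / 8,
      f%:R <= flow_time s / al + 1,
      forall v, oracle_min p s A b x G w v ->
        flow_time s / al <= f%:R
        \/ (k%:R - f%:R) * gain p s n <= oracle_obj p s A b x G w v &
      [/\ forall i, al * load G acc i <= w i,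
          lin s A b x acc <= - (f%:R * (G / 2)),
          quad s A b x acc <= f%:R ^+ 2 * (8 * G / c_low s) &
          f = 0%N -> acc = 0]].

Let al0 : 0 < al := flow_step_gt0 p2 ps n0.
Let ft0 : 0 < flow_time s := flow_time_gt0 p2 ps.

Lemma weight0_gt0 : 0 < weight0 s n :> R.
Proof. by rewrite powR_gt0// ltr0n. Qed.

Lemma phase_inv_start x G : 0 < G -> phase_inv x G (fun=> weight0 s n) 0 0 0.
Proof.
move=> G0; split=> //.
- move=> v mv; rewrite mulr0 addr0 /pot sumr_const card_ord.
  rewrite -powRrM mulNr mulVf ?gt_eqF//; last slra.
  rewrite powR_inv1 ?ler0n// -[_ *+ n]mulr_natr mulVf ?pnatr_eq0 -?lt0n//.
  by rewrite lerDl divr_ge0// oracle_obj_ge0// ltW.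
- by rewrite addr_ge0// divr_ge0 ?ltW.
- by move=> v mv; right; rewrite subrr mul0r oracle_obj_ge0// ltW.
- split=> [i|||//].
  + by rewrite im0 mul0r normr0 mulr0 ltW// weight0_gt0.
  + by rewrite /lin big1 ?mul0r ?oppr0// => i _; rewrite im0 mulr0.
  + by rewrite /quad big1 ?expr0n ?mul0r// => i _; rewrite im0 expr0n mulr0.
Qed.

Section Good.
Variables (x : 'cV[R]_d) (G : R) (cheap : 'cV[R]_d).
Hypotheses (G0 : 0 < G) (clin : lin s A b x cheap = - G)
  (cquad : quad s A b x cheap <= 2 * G / c_low s)
  (cload : \sum_i load G cheap i `^ s <= 1).

Let obj w v := oracle_obj p s A b x G w v.
Let omin w v := oracle_min p s A b x G w v.

(** Potential and oracle's minimum bound each other: the invariant keeps the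
    potential below [3 / 2] plus an eighth of the minimum, and the cheap step
    keeps the minimum below 2 plus the potential. *)
Lemma phase_bounds w acc f k v : phase_inv x G w acc f k -> omin w v ->
  [/\ pot s w <= 2, obj w v <= 4, 0 <= obj w v & forall i, 0 < w i].
Proof.
move=> [w0 hpot hf _ _] mv.
have wpos i : 0 < w i by apply: lt_le_trans weight0_gt0 (w0 i).
have ob0 : 0 <= obj w v by apply: oracle_obj_ge0; exact: ltW.
have H1 := hpot v mv.
have H2 : obj w v <= 2 + pot s w.
  apply: le_trans (mv cheap) _.
  by apply: (oracle_obj_cheap p2 ps) => // i; exact: ltW.
have alt : al <= flow_time s.
  exact: le_trans (flow_step_le p2 ps n0) (flow_coef_le p2 ps).
have H3 : al * f%:R <= 2 * flow_time s.
  have := ler_wpM2l (ltW al0) hf; rewrite mulrDr mulr1 mulrCA divff ?gt_eqF//.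
  by move: alt; lra.
have H4 : 7 * (s * 2 `^ s) * al * f%:R <= 1 / 2.
  have c0 : 0 <= 7 * (s * 2 `^ s) by rewrite !mulr_ge0 ?powR_ge0//; slra.
  have := ler_wpM2l c0 H3; have := flow_timeE p2 ps; rewrite mulrA.
  by move: (7 * _) => c; lra.
have {}H1 : pot s w <= 1 + 1 / 2 + obj w v / 8 by move: H1 H4; rewrite /obj; lra.
by split=> //; lra.
Qed.

Lemma oracle_step_bounds w acc f k v : phase_inv x G w acc f k -> omin w v ->
  [/\ lin s A b x v <= - (G / 2), quad s A b x v <= 8 * G / c_low s &
      \sum_i w i `^ (s - p) * load G v i `^ p <= obj w v].
Proof.
move=> inv mv; have [_ ob _ _] := phase_bounds inv mv.
have cl0 := c_low_gt0 s; have G0' := G0.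
move: ob; rewrite /obj /oracle_obj.
set L := lin _ _ _ _ _; set Q := quad _ _ _ _ _; set P := \sum_i _.
have P0 : 0 <= P by apply: sumr_ge0 => i _; rewrite mulr_ge0 ?powR_ge0.
have Q0 : 0 <= Q by exact: quad_ge0.
have k0 : 0 < c_low s / 2 / G by rewrite divr_gt0// divr_gt0.
have kQ0 := mulr_ge0 (ltW k0) Q0.
have L0 := sqr_ge0 (L / G + 1).
move=> ob; split.
- have : L / G <= - (1 / 2).
    by move: ob L0; move: (L / G) => t ob _; rewrite leNgt; apply/negP; nra.
  by rewrite ler_pdivrMr//; lra.
- have : c_low s / 2 / G * Q <= 4 by lra.
  rewrite -ler_pdivlMl//.
  suff -> : (c_low s / 2 / G)^-1 * 4 = 8 * G / c_low s by [].
  by field; rewrite !gt_eqF.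
- by lra.
Qed.

(** The first-order term is controlled pointwise by
    [w `^ (s - 1) * l <= w `^ s + w `^ (s - p) * l `^ p], the rest by the
    threshold on the loads. *)
Lemma flow_weight_pot w acc f k v : phase_inv x G w acc f k -> omin w v ->
  \sum_i load G v i `^ s <= al `^ (1 - s) ->
  pot s (flow_weight G w v) <= pot s w + 7 * (s * 2 `^ s) * al.
Proof.
move=> inv mv small; have [hp ho _ wpos] := phase_bounds inv mv.
have [_ _ hl] := oracle_step_bounds inv mv.
have C0 : 0 <= s * 2 `^ s by rewrite mulr_ge0 ?powR_ge0//; slra.
have s0 : 0 < s by slra.
have p0 : 0 < p by slra.
have H1 : \sum_i w i `^ (s - 1) * load G v i <= 6.
  apply: le_trans (_ : pot s w + \sum_i w i `^ (s - p) * load G v i `^ p <= _).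
    rewrite -big_split; apply: ler_sum => i _ /=.
    set l := load G v i; have l0 : 0 <= l by exact: normr_ge0.
    have wi := wpos i.
    have [lw|/ltW wl] := leP l (w i).
    - apply: le_trans (_ : w i `^ s <= _); last by rewrite lerDl mulr_ge0 ?powR_ge0.
      rewrite -(mulr_powRB1 (ltW wi) s0).
      by rewrite [leLHS]mulrC; apply: ler_wpM2r => //; exact: powR_ge0.
    - apply: le_trans (_ : w i `^ (s - p) * l `^ p <= _); last by rewrite lerDr powR_ge0.
      have -> : s - 1 = (s - p) + (p - 1) by ring.
      rewrite powRD ?(gt_eqF wi) ?implybT// -mulrA.
      apply: ler_wpM2l; first exact: powR_ge0.
      rewrite -(mulr_powRB1 l0 p0) [leLHS]mulrC; apply: ler_wpM2l => //.
      by apply: ge0_ler_powR; rewrite ?nnegrE ?(ltW wi)//; slra.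
  by move: hp ho hl; lra.
have H2 : \sum_i (al * load G v i) `^ s <= al.
  rewrite (eq_bigr (fun i => al `^ s * load G v i `^ s)); last first.
    by move=> i _; rewrite powRM ?(ltW al0).
  rewrite -mulr_sumr; apply: le_trans (ler_wpM2l (powR_ge0 _ _) small) _.
  rewrite -powRD ?(gt_eqF al0) ?implybT//.
  by rewrite addrCA subrr addr0 powRr1 ?(ltW al0).
have H3 : pot s (flow_weight G w v) <= pot s w + s * 2 `^ s *
    (al * \sum_i w i `^ (s - 1) * load G v i + \sum_i (al * load G v i) `^ s).
  rewrite mulr_sumr -big_split mulr_sumr -big_split; apply: ler_sum => i _ /=.
  rewrite mulrCA; apply: ler_powRD; rewrite ?(ltW (wpos i)) ?(mulr_ge0 (ltW al0))//.
  by slra.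
apply: le_trans H3 _; rewrite lerD2l.
have -> : 7 * (s * 2 `^ s) * al = s * 2 `^ s * (al * 6 + al) by ring.
apply: (ler_wpM2l C0); apply: lerD => //; exact: (ler_wpM2l (ltW al0)) H1.
Qed.

(** Convexity of the square, for the average of [f.+1] terms. *)
Lemma quadD_le v v' (f : nat) (K : R) : (f = 0%N -> v = 0) ->
  quad s A b x v <= f%:R ^+ 2 * K -> quad s A b x v' <= K ->
  quad s A b x (v + v') <= f.+1%:R ^+ 2 * K.
Proof.
case: f => [|f]; first by move=> /(_ erefl) -> _; rewrite add0r expr1n mul1r.
move=> _ hv hv'; have [c cE] : exists c : R, c = f.+1%:R by eexists.
rewrite -cE in hv; have c0 : 0 < c by rewrite cE ltr0n.
have H : quad s A b x (v + v')
    <= (1 + c^-1) * quad s A b x v + (1 + c) * quad s A b x v'.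
  rewrite !mulr_sumr -big_split; apply: ler_sum => i _ /=.
  rewrite imD [(1 + c^-1) * _]mulrCA [(1 + c) * _]mulrCA -mulrDr; apply: ler_wpM2l; first exact: powR_ge0.
  move: (im A v i) (im A v' i) => e g.
  rewrite -subr_ge0; have -> : (1 + c^-1) * e ^+ 2 + (1 + c) * g ^+ 2 - (e + g) ^+ 2
    = c^-1 * (e - c * g) ^+ 2 by field; rewrite gt_eqF.
  by rewrite mulr_ge0 ?sqr_ge0// invr_ge0 ltW.
apply: le_trans H _.
have -> : f.+2%:R ^+ 2 * K = (1 + c^-1) * (c ^+ 2 * K) + (1 + c) * K.
  by rewrite -(natr1 f.+1) -cE; field; rewrite gt_eqF.
by apply: lerD; apply: ler_wpM2l => //; rewrite addr_ge0 ?invr_ge0 ?(ltW c0).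
Qed.

Lemma phase_inv_flow w acc f k v : phase_inv x G w acc f k -> omin w v ->
  \sum_i load G v i `^ s <= al `^ (1 - s) -> f%:R < flow_time s / al ->
  phase_inv x G (flow_weight G w v) (acc + v) f.+1 k.+1.
Proof.
move=> inv mv small flt; have [hp ho _ wpos] := phase_bounds inv mv.
have [hl hq _] := oracle_step_bounds inv mv.
have hpot := flow_weight_pot inv mv small.
case: inv => iw ip i_f ik [il ilin iq iz].
have ww i : w i <= flow_weight G w v i by rewrite lerDl mulr_ge0// ltW.
have mono v' : obj w v <= obj (flow_weight G w v) v'.
  by apply: (oracle_min_mono ps) => // i; exact: ltW.
split.
- by move=> i; exact: le_trans (ww i).
- move=> v' mv'; apply: le_trans hpot _.
  have := ip v mv; have := mono v'; rewrite -[f.+1%:R]natr1 mulrDr mulr1 /obj; lra.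
- by rewrite -natr1; move: flt; lra.
- move=> v' mv'; right; apply: le_trans (mono v').
  have [|] := ik v mv; first by rewrite leNgt flt.
  by rewrite -[f.+1%:R]natr1 -[k.+1%:R]natr1 /obj; congr (_ * _ <= _); ring.
- split=> [i||//|//].
  + apply: le_trans (_ : al * load G acc i + al * load G v i <= _); last by rewrite lerD.
    rewrite -mulrDr; apply: ler_wpM2l; first exact: ltW.
    by rewrite imD mulrDl ler_normD.
  + by rewrite linD -natr1 mulrDl mul1r opprD lerD.
  + exact: quadD_le.
Qed.

Lemma phase_inv_idle w acc f k : phase_inv x G w acc f k ->
  flow_time s / al <= f%:R -> phase_inv x G w acc f k.+1.
Proof. by move=> [iw ip i_f ik ia] fge; split=> // v mv; left. Qed.

(** The overloaded coordinates carry half of the load that exceeds the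
    threshold, and their weights are bounded below: this is the only place
    where the initial weights, hence the dimension, enter the analysis. *)
Lemma overload_ge w acc f k v : phase_inv x G w acc f k -> omin w v ->
  al `^ (1 - s) < \sum_i load G v i `^ s ->
  (2 * iters p s n)^-1
  <= \sum_(i | width_ratio p s * w i < load G v i) w i `^ (s - p) * load G v i `^ p.
Proof.
move=> inv mv large; have [hp _ _ wpos] := phase_bounds inv mv.
have B1 := width_ratio_ge1 p2 ps; have B0 : 0 < width_ratio p s := lt_le_trans ltr01 B1.
have s0 : 0 <= s by slra.
have ps0 : 0 < p / s by rewrite divr_gt0; slra.
have Hnot : \sum_(i | ~~ (width_ratio p s * w i < load G v i)) load G v i `^ s
    <= al `^ (1 - s) / 2.
  apply: le_trans (_ : \sum_i (width_ratio p s * w i) `^ s <= _).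
    rewrite big_mkcond; apply: ler_sum => i _.
    case: ifP => [|_]; last exact: powR_ge0.
    rewrite -leNgt => h; apply: ge0_ler_powR => //; rewrite nnegrE ?normr_ge0//.
    by rewrite mulr_ge0 ?ltW.
  rewrite (eq_bigr (fun i => width_ratio p s `^ s * w i `^ s)); last first.
    by move=> i _; rewrite powRM ?(ltW B0) ?(ltW (wpos i)).
  rewrite -mulr_sumr; have := width_ratio_flow_step p2 ps n0.
  have := ler_wpM2l (powR_ge0 (width_ratio p s) s) hp; rewrite /pot.
  by move: (_ `^ s * _) => y; lra.
have Hin : al `^ (1 - s) / 2
    <= \sum_(i | width_ratio p s * w i < load G v i) load G v i `^ s.
  have := large; rewrite (bigID (fun i => width_ratio p s * w i < load G v i)) /=.
  by move: Hnot; lra.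
apply: le_trans (gain_bound p2 ps n0) _.
apply: le_trans (_ : weight0 s n `^ (s - p) *
  \sum_(i | width_ratio p s * w i < load G v i) load G v i `^ p <= _); last first.
  rewrite mulr_sumr; apply: ler_sum => i _; apply: ler_wpM2r; first exact: powR_ge0.
  case: inv => iw _ _ _ _.
  by apply: ge0_ler_powR; rewrite ?nnegrE ?(ltW weight0_gt0) ?(ltW (wpos i))//; slra.
apply: ler_wpM2l; first exact: powR_ge0.
apply: le_trans (_ : (\sum_(i | width_ratio p s * w i < load G v i)
    load G v i `^ s) `^ (p / s) <= _).
  apply: ge0_ler_powR; rewrite ?nnegrE ?(ltW ps0) ?divr_ge0 ?powR_ge0//.
  by apply: sumr_ge0 => i _; exact: powR_ge0.
have q1 : 1 <= s / p by rewrite ler_pdivlMr ?mul1r ?ltW//; slra.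
pose a i := if width_ratio p s * w i < load G v i then load G v i `^ p else 0.
have a0 i : 0 <= a i by rewrite /a; case: ifP => // _; exact: powR_ge0.
have := sum_powR_le q1 a0.
have spN : p * (s / p) = s by field; rewrite gt_eqF//; slra.
have -> : \sum_i a i = \sum_(i | width_ratio p s * w i < load G v i) load G v i `^ p.
  by rewrite [RHS]big_mkcond.
have -> : \sum_i a i `^ (s / p)
   = \sum_(i | width_ratio p s * w i < load G v i) load G v i `^ s.
  rewrite [RHS]big_mkcond; apply: eq_bigr => i _; rewrite /a; case: ifP => _.
    by rewrite -powRrM spN.
  by rewrite powR0// gt_eqF// (lt_le_trans _ q1).
set X := \sum_(i | _) _; set Y := \sum_(i | _) _ => XY.
have Y0 : 0 <= Y by apply: sumr_ge0 => i _; exact: powR_ge0.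
have X0 : 0 <= X by apply: sumr_ge0 => i _; exact: powR_ge0.
have -> : Y = (Y `^ (s / p)) `^ (p / s).
  rewrite -powRrM; have -> : s / p * (p / s) = 1 by field; rewrite !gt_eqF//; slra.
  by rewrite powRr1.
by apply: ge0_ler_powR; rewrite ?nnegrE ?powR_ge0 ?(ltW ps0).
Qed.

Lemma widen_weight_pot w v : (forall i, 0 < w i) ->
  pot s (widen_weight G w v) <= pot s w + (4 `^ p)^-1 *
    (\sum_(i | width_ratio p s * w i < load G v i) w i `^ (s - p) * load G v i `^ p) / 8.
Proof.
move=> wpos.
have B1 := width_ratio_ge1 p2 ps; have B0 : 0 < width_ratio p s := lt_le_trans ltr01 B1.
have o1 := widen_factor_ge1 p2 ps; have o0 := lt_le_trans ltr01 o1.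
rewrite mulr_sumr mulr_suml big_mkcond -big_split; apply: ler_sum => i _ /=.
rewrite /widen_weight; case: ifP => h; last by rewrite addr0.
rewrite powRM ?(ltW o0) ?(ltW (wpos i))//.
apply: le_trans (_ : widen_factor p s `^ s * w i `^ s <= _) => //.
apply: le_trans (_ : (4 `^ p)^-1 * (w i `^ (s - p) * load G v i `^ p) / 8 <= _); last first.
  by rewrite lerDr powR_ge0.
have -> : w i `^ s = w i `^ (s - p) * w i `^ p.
  by rewrite -powRD ?subrK// (gt_eqF (wpos i)) implybT.
have hB : width_ratio p s `^ p * w i `^ p <= load G v i `^ p.
  rewrite -powRM ?(ltW B0) ?(ltW (wpos i))//.
  apply: ge0_ler_powR; rewrite ?nnegrE ?mulr_ge0 ?(ltW B0) ?(ltW (wpos i)) ?(ltW h)//.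
  by slra.
rewrite (width_ratioX p2 ps) in hB.
have p40 : 0 < 4 `^ p :> R by rewrite powR_gt0.
have -> : (4 `^ p)^-1 * (w i `^ (s - p) * load G v i `^ p) / 8
  = w i `^ (s - p) * (load G v i `^ p / (8 * 4 `^ p)) by field; rewrite gt_eqF.
rewrite mulrCA; apply: ler_wpM2l; first exact: powR_ge0.
rewrite ler_pdivlMr ?mulr_gt0//; apply: le_trans hB.
by rewrite le_eqVlt; apply/orP; left; apply/eqP; ring.
Qed.

Lemma phase_inv_widen w acc f k v : phase_inv x G w acc f k -> omin w v ->
  al `^ (1 - s) < \sum_i load G v i `^ s ->
  phase_inv x G (widen_weight G w v) acc f k.+1.
Proof.
move=> inv mv large; have [hp ho _ wpos] := phase_bounds inv mv.
have hS := overload_ge inv mv large; have hpot := widen_weight_pot v wpos.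
have o1 := widen_factor_ge1 p2 ps; have o0 := lt_le_trans ltr01 o1.
have p40 : 0 < 4 `^ p :> R by rewrite powR_gt0.
case: inv => iw ip i_f ik [il ilin iq iz].
have ww i : w i <= widen_weight G w v i.
  by rewrite /widen_weight; case: ifP => // _; rewrite ler_peMl// ltW.
have step v' : obj w v + (4 `^ p)^-1 * (\sum_(i | width_ratio p s * w i < load G v i)
    w i `^ (s - p) * load G v i `^ p) <= obj (widen_weight G w v) v'.
  apply: (@oracle_min_widen R p s n d A b p2 x G w (widen_weight G w v) v v'
    (fun i => width_ratio p s * w i < load G v i)) => // i.
  rewrite /widen_weight; case: ifP => // _.
  by rewrite powRM ?(ltW o0) ?(ltW (wpos i))// widen_factorX.
split=> //.
- by move=> i; exact: le_trans (ww i).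
- move=> v' mv'; apply: le_trans hpot _.
  by have := ip v mv; have := step v'; rewrite /obj; lra.
- move=> v' mv'; have [|H] := ik v mv; [by left|right].
  apply: le_trans (step v').
  have i40 : 0 <= (4 `^ p)^-1 :> R by rewrite invr_ge0 ltW.
  have := ler_wpM2l i40 hS; move: H; rewrite /gain -[k.+1%:R]natr1 /obj.
  by move: (_ / _) => g; lra.
- by split=> // i; exact: le_trans (ww i).
Qed.

(** The number of steps rules out that the phase is still short of flow steps,
    so the average accumulated step has all properties of the cheap step up to
    constants; [step_len] makes the second-order terms at most an eighth of the
    slope. *)
Lemma phase_progress w acc f k v : phase_inv x G w acc f k -> omin w v ->
  phase_len p s n <= k%:R ->
  pobj s A b (x + (step_len s / f%:R) *: acc) <= pobj s A b x - step_len s * G / 4.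
Proof.
move=> inv mv klen; have [hp ho _ wpos] := phase_bounds inv mv.
case: inv => iw ip i_f ik [il ilin iq _].
have T1 := iters_ge1 p2 ps n0; have T0 := lt_le_trans ltr01 T1.
have p40 : 0 < 4 `^ p :> R by rewrite powR_gt0.
have fge : flow_time s / al <= f%:R.
  have [//|H] := ik v mv; rewrite leNgt; apply/negP => flt.
  have gE : gain p s n * (8 * 4 `^ p * iters p s n) = 4.
    by rewrite /gain; field; rewrite !gt_eqF.
  have g0 : 0 < gain p s n by rewrite divr_gt0 ?invr_gt0// mulr_gt0.
  have : 8 * 4 `^ p * iters p s n < k%:R - f%:R.
    by move: klen flt; rewrite /phase_len; lra.
  rewrite -(ltr_pM2l g0) gE mulrC.
  by move: H ho; rewrite /obj; lra.
have fp : 0 < f%:R :> R by apply: lt_le_trans fge; rewrite divr_gt0.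
have st0 := step_len_gt0 p2 ps; have st1 := step_len_le1 p2 ps.
have cl0 := c_low_gt0 s; have cu0 : 0 < c_up s := lt_le_trans ltr01 (c_up_ge1 p2 ps).
have ts0 : 0 < flow_time s `^ s by rewrite powR_gt0.
have p20 : 0 < 2 `^ s :> R by rewrite powR_gt0.
pose e := step_len s; rewrite -/e in st0 st1.
pose u := f%:R^-1 *: acc.
have -> : (step_len s / f%:R) *: acc = e *: u by rewrite scalerA.
have Hl : lin s A b x u <= - (G / 2).
  rewrite linZ mulrC ler_pdivrMr//; apply: le_trans ilin _.
  by rewrite mulNr mulrC.
have Hq : quad s A b x u <= 8 * G / c_low s.
  rewrite quadZ exprVn mulrC ler_pdivrMr ?exprn_gt0//.
  by rewrite mulrC.
have Hload i : flow_time s * load G u i <= w i.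
  apply: le_trans (il i); rewrite imZ -mulrA normrM mulrA.
  apply: ler_wpM2r => //; rewrite gtr0_norm ?invr_gt0//.
  by rewrite ler_pdivrMr// mulrC -ler_pdivrMr.
have r0 : 0 < radius s G `^ s by rewrite powR_gt0// radius_gt0.
have Hs : \sum_i `|im A u i| `^ s <= 2 * (2 `^ s * (G / c_low s)) / flow_time s `^ s.
  rewrite (sum_im_radius s A u G0) -(radiusX p2 ps G0).
  rewrite ler_pdivlMr// -mulrA [2 * _]mulrC; apply: ler_wpM2l; first exact: ltW.
  apply: le_trans hp; rewrite mulr_suml; apply: ler_sum => i _.
  rewrite mulrC -powRM ?(ltW ft0)//.
  have W := wpos i.
  by apply: ge0_ler_powR; rewrite ?nnegrE ?(ltW W) ?(mulr_ge0 (ltW ft0))//; slra.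
apply: le_trans (pobj_upper A b p2 ps x (e *: u)) _.
rewrite linZ quadZ.
have -> : \sum_i `|im A (e *: u) i| `^ s = e `^ s * \sum_i `|im A u i| `^ s.
  rewrite mulr_sumr; apply: eq_bigr => i _.
  by rewrite imZ normrM powRM// (gtr0_norm st0).
have es : e `^ s <= e ^+ 2.
  rewrite -(powR_mulrn 2 (ltW st0)); apply: ger_powR; first by rewrite st0.
  by slra.
set S := \sum_i _ in Hs *; have S0 : 0 <= S by apply: sumr_ge0 => i _; exact: powR_ge0.
have q0 : 0 <= quad s A b x u by exact: quad_ge0.
have K1 : e ^+ 2 * quad s A b x u + e `^ s * S <= e ^+ 2 * (quad s A b x u + S).
  by rewrite mulrDr lerD2l ler_wpM2r.
have t1 : flow_time s `^ s <= 1.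
  apply: powR_le1; last by slra.
  by rewrite ft0 (flow_time_le1 p2 ps).
have twos : 4 <= 2 `^ s :> R.
  have -> : 4 = 2 `^ 2%:R :> R by rewrite powR_mulrn// expr2 -natrM.
  by apply: ler_powR; [lra|slra].
pose Z := 2 `^ s * G / (c_low s * flow_time s `^ s).
have Z1 : 8 * G / c_low s <= 2 * Z.
  rewrite /Z ler_pdivrMr//.
  have -> : 2 * (2 `^ s * G / (c_low s * flow_time s `^ s)) * c_low s
    = 2 * (2 `^ s * G) / flow_time s `^ s by field; rewrite !gt_eqF.
  rewrite ler_pdivlMr//.
  by apply: le_trans (_ : 8 * G <= _); [rewrite ler_piMr|]; move: twos G0; nra.
have Z2 : S <= 2 * Z.
  apply: le_trans Hs _; rewrite le_eqVlt; apply/orP; left; apply/eqP.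
  by rewrite /Z; field; rewrite !gt_eqF.
have ZE : c_up s * e * Z = G / 64.
  have := step_lenE p2 ps; rewrite -/e => E.
  have -> : c_up s * e * Z
    = e * (c_up s * 2 `^ s) / (c_low s * flow_time s `^ s) * G.
    by rewrite /Z; ring.
  by rewrite E; field.
have K2 : c_up s * (e ^+ 2 * quad s A b x u + e `^ s * S) <= e * (G / 16).
  apply: le_trans (ler_wpM2l (ltW cu0) K1) _.
  apply: le_trans (_ : c_up s * (e ^+ 2 * (4 * Z)) <= _).
    apply: ler_wpM2l; first exact: ltW.
    by apply: ler_wpM2l; [exact: sqr_ge0|move: Hq Z1 Z2; lra].
  have -> : c_up s * (e ^+ 2 * (4 * Z)) = e * (4 * (c_up s * e * Z)) by ring.
  by rewrite ZE; apply: ler_wpM2l; [exact: ltW|move: G0; lra].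
have := ler_wpM2l (ltW st0) Hl; move: K2; rewrite -/e.
have eG := mulr_gt0 st0 G0.
move: (c_up s * _) => X.
by lra.
Qed.

End Good.
End Phase.

(** * Single-assignment array programs *)

(** Extents of loops. [DimRowsS] is one more than the number of rows: the
    quadratic part of a query has one row per row of the instance and one for
    the slope. *)
Inductive dim := DimRows | DimCols | DimOne | DimRowsS.

Definition dim_expr (m : dim) : nexpr :=
  match m with
  | DimRows => NVar 0
  | DimCols => NVar 1
  | DimOne => NConst 1
  | DimRowsS => NAdd (NConst 1) (NVar 0)
  end.

Definition dim_val (n d : nat) (m : dim) : nat :=
  match m with
  | DimRows => n
  | DimCols => d
  | DimOne => 1
  | DimRowsS => n.+1
  end.

Definition row_like (m : dim) :=
  match m with DimRows | DimRowsS => true | _ => false end.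
Definition col_like (m : dim) := if m is DimCols then true else false.

(** [SSet a r c e] fills the array [a] with [e], [SSum a r c e] fills its first
    column with the sums of [e] over the inner index. *)
Inductive stmt :=
| SSet of nat & dim & dim & rexpr
| SSum of nat & dim & dim & rexpr
| SSolve (m2 mp : nexpr) (g A b C h x : nat).

Definition row_var : nat := 5.
Definition col_var : nat := 6.

Definition for_loop (x : nat) (m : nexpr) (body : cmd) : cmd :=
  Seq (NSet x (NConst 0))
    (While (BNot (BNle m (NVar x)))
       (Seq body (NSet x (NAdd (NVar x) (NConst 1))))).

Definition compile_stmt (t : stmt) : cmd :=
  match t with
  | SSet a r c e =>
      for_loop row_var (dim_expr r)
        (for_loop col_var (dim_expr c) (RSet a (NVar row_var) (NVar col_var) e))
  | SSum a r c e =>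
      for_loop row_var (dim_expr r)
        (Seq (RSet a (NVar row_var) (NConst 0) (RNat (NConst 0)))
           (for_loop col_var (dim_expr c)
              (RSet a (NVar row_var) (NConst 0)
                 (RAdd (RGet a (NVar row_var) (NConst 0)) e))))
  | SSolve m2 mp g A b C h x => Solve m2 mp g A b C h x
  end.

Definition compile (P : seq stmt) : cmd :=
  foldr (fun t c => Seq (compile_stmt t) c) Skip P.

Fixpoint expr_reads (e : rexpr) : seq nat :=
  match e with
  | RNat _ => [::]
  | RGet a _ _ => [:: a]
  | RAdd e1 e2 | RSub e1 e2 | RMul e1 e2 | RDiv e1 e2 | RPow e1 e2 =>
      expr_reads e1 ++ expr_reads e2
  | RLn e1 => expr_reads e1
  end.

Definition target (t : stmt) : nat :=
  match t with SSet a _ _ _ | SSum a _ _ _ => a | SSolve _ _ _ _ _ _ _ x => x end.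

Definition reads (t : stmt) : seq nat :=
  match t with
  | SSet _ _ _ e | SSum _ _ _ e => expr_reads e
  | SSolve _ _ g A b C h _ => [:: g; A; b; C; h]
  end.

Fixpoint dim_nexpr (e : nexpr) : bool :=
  match e with
  | NConst _ => true
  | NVar x => (x == 0%N) || (x == 1%N)
  | NAdd e1 e2 | NSub e1 e2 => dim_nexpr e1 && dim_nexpr e2
  end.

Definition stmt_ok (t : stmt) : bool :=
  match t with
  | SSet _ r c _ | SSum _ r c _ =>
      ~~ (row_like r && row_like c) && ~~ (col_like r && col_like c)
  | SSolve m2 mp _ _ _ _ _ _ => dim_nexpr m2 && dim_nexpr mp
  end.

(** No statement writes an array that it or an earlier statement reads or
    writes. *)
Fixpoint single_assignment (P : seq stmt) : bool :=
  if P is t :: P' then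
    [&& stmt_ok t, target t \notin reads t,
        all (fun u => target u \notin target t :: reads t) P' &
        single_assignment P']
  else true.

Definition stmt_size (t : stmt) : nat :=
  match t with
  | SSet _ _ _ e | SSum _ _ _ e => rsize e
  | SSolve m2 mp _ _ _ _ _ _ => nsize m2 + nsize mp
  end.

Definition code_size (P : seq stmt) : nat :=
  foldr (fun t k => 8 * (stmt_size t + 30) + k)%N 1%N P.

Lemma entry_ord (R : realType) m d (M : 'M[R]_(m, d)) (i : 'I_m) (j : 'I_d) :
  entry M i j = M i j.
Proof. by rewrite /entry !valK. Qed.

Section Semantics.
Variables (R : realType) (d : nat) (solver : smoothed_problem R d -> 'cV[R]_d).
Implicit Types (st : store R) (t : stmt) (P : seq stmt).

Definition at_index st (i j : nat) : store R :=
  set_nvar (set_nvar st row_var i) col_var j.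

Definition store_problem st (m2 mp : nexpr) (g A b C h : nat) :=
  SmoothedProblem (get_cv st g d) (get_mx st A (neval st m2) d)
    (get_cv st b (neval st m2)) (get_mx st C (neval st mp) d)
    (get_cv st h (neval st mp)).

(** A statement as an equation about one store, in which its target and the
    arrays that it reads are all looked up. *)
Definition holds st t : Prop :=
  match t with
  | SSet a r c e => forall i j : nat,
      (i < neval st (dim_expr r))%N -> (j < neval st (dim_expr c))%N ->
      rarr st a i j = reval (at_index st i j) e
  | SSum a r c e => forall i : nat, (i < neval st (dim_expr r))%N ->
      rarr st a i 0%N =
        \sum_(0 <= j < neval st (dim_expr c)) reval (at_index st i j) e
  | SSolve m2 mp g A b C h x =>
      get_cv st x d = solver (store_problem st m2 mp g A b C h)
  end.

Definition queries_of st (P : seq stmt) : seq (nat * nat) :=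
  flatten [seq (if t is SSolve m2 mp _ _ _ _ _ _
                then [:: (neval st m2, neval st mp)] else [::]) | t <- P].

Definition loop_var (x : nat) : bool := (x == row_var) || (x == col_var).

Definition same_vars st st' : Prop :=
  forall x, ~~ loop_var x -> nvar st' x = nvar st x.

Definition agree (S : seq nat) st st' : Prop :=
  forall a, a \in S -> forall i j, rarr st' a i j = rarr st a i j.

Lemma neval_at e st st' i j : same_vars st st' ->
  neval (at_index st' i j) e = neval (at_index st i j) e.
Proof.
move=> sv; elim: e => //= [x|e1 -> e2 ->|e1 -> e2 ->] //.
case: eqP => // /eqP xc; case: eqP => // /eqP xr.
by apply: sv; rewrite /loop_var negb_or xr xc.
Qed.

Lemma reval_at e st st' i j : same_vars st st' ->
  agree (expr_reads e) st st' ->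
  reval (at_index st' i j) e = reval (at_index st i j) e.
Proof.
move=> sv; elim: e => //= [e|a e1 e2|e1 IH1 e2 IH2|e1 IH1 e2 IH2|e1 IH1 e2 IH2
  |e1 IH1 e2 IH2|e1 IH1 e2 IH2|e IH] ag.
- by rewrite (neval_at _ _ _ sv).
- by rewrite !(neval_at _ _ _ sv); apply: ag; rewrite inE.
all: try (rewrite IH1 ?IH2 // => b sb; apply: ag; rewrite /= mem_cat;
  rewrite sb ?orbT //).
by rewrite IH.
Qed.

Lemma neval_dim e st st' : dim_nexpr e -> same_vars st st' ->
  neval st' e = neval st e.
Proof.
move=> + sv; elim: e => //= [x|e1 IH1 e2 IH2|e1 IH1 e2 IH2].
- by move=> /orP[] /eqP ->; apply: sv.
- by move=> /andP[/IH1 -> /IH2 ->].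
- by move=> /andP[/IH1 -> /IH2 ->].
Qed.

Lemma dim_expr_dim m : dim_nexpr (dim_expr m). Proof. by case: m. Qed.

Lemma holds_agree t st st' : stmt_ok t -> same_vars st st' ->
  agree (target t :: reads t) st st' -> holds st t -> holds st' t.
Proof.
move=> ok sv; case: t ok => [a r c e|a r c e|m2 mp g A b C h x] /= ok ag.
- rewrite !(neval_dim (dim_expr_dim _) sv) => H i j ir jc.
  rewrite ag ?mem_head// H//; apply/esym/reval_at => // a' a'e.
  by apply: ag; rewrite inE a'e orbT.
- rewrite !(neval_dim (dim_expr_dim _) sv) => H i ir.
  rewrite ag ?mem_head// H//; apply: eq_big_nat => j _; apply/esym/reval_at => // a' a'e.
  by apply: ag; rewrite inE a'e orbT.
- case/andP: ok => o2 op; rewrite /store_problem.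
  rewrite (neval_dim o2 sv) (neval_dim op sv).
  have cv y m : y \in [:: x; g; A; b; C; h] -> get_cv st' y m = get_cv st y m.
    by move=> yin; apply/matrixP => i j; rewrite !mxE ag.
  have mx y m : y \in [:: x; g; A; b; C; h] -> get_mx st' y m d = get_mx st y m d.
    by move=> yin; apply/matrixP => i j; rewrite !mxE ag.
  by rewrite !cv ?mx ?inE ?eqxx ?orbT.
Qed.

(** A total-correctness triple with cost. *)
Definition runs (c : cmd) st (k : nat) (qs : seq (nat * nat))
    (Q : store R -> Prop) : Prop :=
  exists st' co, [/\ exec solver c st st' co, queries co = qs,
    (ops co <= k)%N & Q st'].

(** Invariant rule; the body may change the loop variable only temporarily. *)
Lemma runs_for (x : nat) (m : nexpr) (body : cmd) (N k : nat)
    (I : nat -> store R -> Prop) st :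
  I 0%N (set_nvar st x 0) ->
  (forall i st', (i <= N)%N -> nvar st' x = i -> I i st' -> neval st' m = N) ->
  (forall i st', (i < N)%N -> nvar st' x = i -> I i st' ->
    runs body st' k [::] (fun st'' => nvar st'' x = i /\ I i.+1 (set_nvar st'' x i.+1))) ->
  runs (for_loop x m body) st (N * (k + nsize m + 10) + nsize m + 10) [::]
    (fun st' => nvar st' x = N /\ I N st').
Proof.
move=> I0 IN Istep.
suff H : forall r i st', (r + i = N)%N -> nvar st' x = i -> I i st' ->
    runs (While (BNot (BNle m (NVar x)))
       (Seq body (NSet x (NAdd (NVar x) (NConst 1))))) st'
      (r * (k + nsize m + 10) + nsize m + 5) [::] (fun st' => nvar st' x = N /\ I N st').
  have x0 : nvar (set_nvar st x 0) x = 0%N by rewrite /= eqxx.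
  have [st' [co [ex qs os Q]]] := H N 0%N _ (addn0 N) x0 I0.
  exists st', (cost_add (Cost 2 [::]) co); split=> //=.
  - by apply: ExecSeq ex; exact: ExecNSet.
  - by lia.
elim=> [|r IH] i st' riN xi Ii.
  exists st', (Cost (nsize m + 1).+2.+1 [::]); split=> //; last by rewrite -riN.
  - have -> : (nsize m + 1).+2.+1 = (bsize (BNot (BNle m (NVar x)))).+1 by rewrite /=; lia.
    apply: ExecWhileF; rewrite /= negbK xi (IN i) //; lia.
  - by rewrite /=; lia.
have iN : (i < N)%N by lia.
have [st1 [c1 [e1 q1 o1 [x1 I1]]]] := Istep i st' iN xi Ii.
have x2 : nvar (set_nvar st1 x i.+1) x = i.+1 by rewrite /= eqxx.
have riN' : (r + i.+1 = N)%N by lia.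
have [st2 [c2 [e2 q2 o2 Q2]]] := IH i.+1 _ riN' x2 I1.
exists st2, (cost_add (Cost (bsize (BNot (BNle m (NVar x)))).+1 [::])
   (cost_add (cost_add c1 (Cost 4 [::])) c2)); split=> //.
- apply: ExecWhileT e2; first by rewrite /= xi (IN i st' (ltnW iN) xi Ii) -ltnNge.
  apply: ExecSeq e1 _.
  have -> : set_nvar st1 x i.+1 = set_nvar st1 x (neval st1 (NAdd (NVar x) (NConst 1))).
    by rewrite /= x1 addn1.
  exact: ExecNSet.
- by rewrite /= q1 q2.
- by rewrite /=; lia.
Qed.

Lemma runs_weaken c st k k' qs (Q Q' : store R -> Prop) : (k <= k')%N ->
  (forall st', Q st' -> Q' st') -> runs c st k qs Q -> runs c st k' qs Q'.
Proof.
move=> kk QQ [st' [co [e q o H]]]; exists st', co; split=> //; last exact: QQ.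
exact: leq_trans kk.
Qed.

Lemma runs_rset a i j e st :
  runs (RSet a i j e) st (nsize i + nsize j + rsize e).+1 [::]
    (eq (set_rarr st a (neval st i) (neval st j) (reval st e))).
Proof. by eexists; eexists; split; [exact: ExecRSet| | |]. Qed.

Lemma runs_seq c1 c2 st k1 k2 qs1 qs2 (Q1 Q2 : store R -> Prop) :
  runs c1 st k1 qs1 Q1 -> (forall st', Q1 st' -> runs c2 st' k2 qs2 Q2) ->
  runs (Seq c1 c2) st (k1 + k2) (qs1 ++ qs2) Q2.
Proof.
move=> [st1 [co1 [e1 q1 o1 H1]]] /(_ _ H1) [st2 [co2 [e2 q2 o2 H2]]].
exists st2, (cost_add co1 co2); split=> //; first exact: ExecSeq e2.
- by rewrite /= q1 q2.
- by rewrite /= leq_add.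
Qed.

Lemma reval_ext e st st' : nvar st =1 nvar st' -> agree (expr_reads e) st st' ->
  reval st e = reval st' e.
Proof.
move=> nv; have ne i : neval st i = neval st' i.
  by elim: i => //= i -> j ->.
elim: e => //= [i|a e1 e2|e1 IH1 e2 IH2|e1 IH1 e2 IH2|e1 IH1 e2 IH2
  |e1 IH1 e2 IH2|e1 IH1 e2 IH2|e IH] ag.
- by rewrite ne.
- by rewrite !ne ag ?mem_head.
all: try (rewrite IH1 ?IH2 // => b sb; apply: ag; rewrite /= mem_cat;
  rewrite sb ?orbT //).
by rewrite IH.
Qed.

Definition only_writes (a : nat) st st' : Prop :=
  forall b, b != a -> forall i j, rarr st' b i j = rarr st b i j.

Lemma only_writes_agree a S st st' : only_writes a st st' -> a \notin S -> agree S st st'.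
Proof.
move=> ow aS b bS; apply: ow; apply/eqP => ba.
by move: aS; rewrite -ba bS.
Qed.

Lemma reval_current a e st st' i j : a \notin expr_reads e ->
  same_vars st st' -> only_writes a st st' ->
  nvar st' row_var = i -> nvar st' col_var = j ->
  reval st' e = reval (at_index st i j) e.
Proof.
move=> ae sv ow ri cj; apply: reval_ext => [x|b be i' j'].
  rewrite /=; case: eqP => [->//|/eqP xc]; case: eqP => [->//|/eqP xr].
  by apply: sv; rewrite /loop_var negb_or xr xc.
by rewrite /= -(only_writes_agree ow ae).
Qed.

Lemma same_vars_set st st' x v : loop_var x -> same_vars st st' ->
  same_vars st (set_nvar st' x v).
Proof. by move=> lx sv y ly /=; case: eqP => [yx|_]; [rewrite yx lx in ly|exact: sv]. Qed.

Section Dims.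
Variables (st : store R) (n : nat).
Hypotheses (st_n : nvar st 0%N = n) (st_d : nvar st 1%N = d).

Lemma neval_dim_expr m : neval st (dim_expr m) = dim_val n d m.
Proof. by case: m => //=; rewrite st_n. Qed.

Lemma neval_same st' m : same_vars st st' -> neval st' (dim_expr m) = dim_val n d m.
Proof. by move=> sv; rewrite (neval_dim (dim_expr_dim m) sv) neval_dim_expr. Qed.

Lemma nsize_dim m : (nsize (dim_expr m) <= 3)%N. Proof. by case: m. Qed.

Lemma dim_val_mul r c : ~~ (row_like r && row_like c) && ~~ (col_like r && col_like c) ->
  (dim_val n d r * dim_val n d c <= n.+1 * d.+1)%N.
Proof. by case: r; case: c => //= _; nia. Qed.

Lemma dim_val_le m : (dim_val n d m <= n.+1 * d.+1)%N.
Proof. by case: m => /=; nia. Qed.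

Lemma loop_cost k N M X q1 q2 : (N * M <= X)%N -> (N <= X)%N -> (0 < X)%N ->
  (q1 <= 3)%N -> (q2 <= 3)%N ->
  (N * (5 + (M * (k + 8 + q1 + 10) + q1 + 10) + q2 + 10) + q2 + 10
    <= 8 * (k + 30) * X)%N.
Proof.
move=> NM NX X0 h1 h2.
have H1 : (N * M * (k + 21) <= X * (k + 21))%N by rewrite leq_mul2r NM orbT.
apply: leq_trans (_ : N * M * (k + 21) + 31 * N + 13 <= _)%N; last by nia.
have : (N * M * q1 <= N * M * 3)%N by rewrite leq_mul2l h1 orbT.
have : (N * q1 <= N * 3)%N by rewrite leq_mul2l h1 orbT.
have : (N * q2 <= N * 3)%N by rewrite leq_mul2l h2 orbT.
by nia.
Qed.

Lemma runs_set a r c e : a \notin expr_reads e -> stmt_ok (SSet a r c e) ->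
  runs (compile_stmt (SSet a r c e)) st (8 * (rsize e + 30) * (n.+1 * d.+1)) [::]
    (fun st' => [/\ same_vars st st', only_writes a st st' & holds st' (SSet a r c e)]).
Proof.
move=> ae ok; set N := dim_val n d r; set M := dim_val n d c.
pose done_at st' i j := rarr st' a i j = reval (at_index st i j) e.
pose I i st' := [/\ same_vars st st', only_writes a st st' &
  forall i' j, (i' < i)%N -> (j < M)%N -> done_at st' i' j].
have base : runs (compile_stmt (SSet a r c e)) st
   (N * (M * ((rsize e).+3 + nsize (dim_expr c) + 10) + nsize (dim_expr c) + 10
     + nsize (dim_expr r) + 10) + nsize (dim_expr r) + 10)%N [::]
   (fun st' => nvar st' row_var = N /\ I N st').
  apply: runs_for.
  - by split=> // x lx /=; case: eqP => // xr; rewrite xr in lx.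
  - by move=> i st' _ _ [sv _ _]; exact: neval_same.
  move=> i st' iN ri [sv ow H].
  pose J j st2 := [/\ same_vars st st2, only_writes a st st2, nvar st2 row_var = i,
    forall i' j, (i' < i)%N -> (j < M)%N -> done_at st2 i' j &
    forall j', (j' < j)%N -> done_at st2 i j'].
  apply: (@runs_weaken _ _ _ _ _ (fun st2 => nvar st2 col_var = M /\ J M st2)).
  - exact: leqnn.
  - move=> st2 [_ [sv2 ow2 r2 H2 H2']]; split=> //; split=> //; first exact: same_vars_set.
    move=> i' j; rewrite ltnS leq_eqVlt => /orP[/eqP ->|]; [exact: H2'|exact: H2].
  apply: runs_for.
  - by split=> //; exact: same_vars_set.
  - by move=> j st2 _ _ [sv2 _ _ _ _]; exact: neval_same.
  move=> j st2 jM cj [sv2 ow2 r2 H2 H2'].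
  apply: runs_weaken (runs_rset _ _ _ _ _) => [|st3 <-]; first by rewrite /=; lia.
  rewrite /= r2 cj; split; first by [].
  have dn i' j' : (i', j') != (i, j) -> done_at st2 i' j' ->
      done_at (set_nvar (set_rarr st2 a i j (reval st2 e)) col_var j.+1) i' j'.
    move=> ne; rewrite /done_at /= eqxx /=; case: andP => // -[/eqP ii /eqP jj].
    by rewrite ii jj eqxx in ne.
  split=> //.
  - by apply: same_vars_set.
  - by move=> b ba i' j' /=; rewrite (negPf ba) /= ow2.
  - move=> i' j' ii jM'; apply: dn; last exact: H2.
    by rewrite xpair_eqE negb_and (ltn_eqF ii).
  - move=> j'; rewrite ltnS leq_eqVlt => /orP[/eqP ->|jj].
      by rewrite /done_at /= !eqxx /=; exact: (reval_current ae).
    by apply: dn; [rewrite xpair_eqE negb_and (ltn_eqF jj) orbT|exact: H2'].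
apply: runs_weaken base.
- apply: leq_trans (loop_cost (rsize e) (dim_val_mul ok) (dim_val_le r) _
    (nsize_dim c) (nsize_dim r)) => //.
  by rewrite -/N -/M; nia.
- move=> st' [_ [sv ow H]]; split=> // i j.
  rewrite !(neval_same _ sv) => ir jc; rewrite H//.
  by apply/esym/reval_at => //; exact: only_writes_agree ae.
Qed.

Lemma runs_sum a r c e : a \notin expr_reads e -> stmt_ok (SSum a r c e) ->
  runs (compile_stmt (SSum a r c e)) st (8 * (rsize e + 30) * (n.+1 * d.+1)) [::]
    (fun st' => [/\ same_vars st st', only_writes a st st' & holds st' (SSum a r c e)]).
Proof.
move=> ae ok; set N := dim_val n d r; set M := dim_val n d c.
pose partial st' i m :=
  rarr st' a i 0%N = \sum_(0 <= j < m) reval (at_index st i j) e.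
pose I i st' := [/\ same_vars st st', only_writes a st st' &
  forall i', (i' < i)%N -> partial st' i' M].
have base : runs (compile_stmt (SSum a r c e)) st
   (N * (5 + (M * ((rsize e).+4.+4 + nsize (dim_expr c) + 10) + nsize (dim_expr c) + 10)
     + nsize (dim_expr r) + 10) + nsize (dim_expr r) + 10)%N [::]
   (fun st' => nvar st' row_var = N /\ I N st').
  apply: runs_for.
  - by split=> // x lx /=; case: eqP => // xr; rewrite xr in lx.
  - by move=> i st' _ _ [sv _ _]; exact: neval_same.
  move=> i st' iN ri [sv ow H].
  pose J j st2 := [/\ same_vars st st2, only_writes a st st2, nvar st2 row_var = i,
    forall i', (i' < i)%N -> partial st2 i' M & partial st2 i j].
  apply: (@runs_seq _ _ _ _ _ [::] [::] (fun st2 => J 0%N st2)).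
    apply: runs_weaken (runs_rset _ _ _ _ _) => [//|st2 <-]; rewrite /= ri.
    split=> //.
    + by move=> b ba i' j' /=; rewrite (negPf ba) /= ow.
    + by move=> i' ii; rewrite /partial /= (ltn_eqF ii) andbF; exact: H.
    + by rewrite /partial /= !eqxx big_geq.
  move=> st1 [sv1 ow1 r1 H1 H1'].
  apply: (@runs_weaken _ _ _ _ _ (fun st2 => nvar st2 col_var = M /\ J M st2)).
  - exact: leqnn.
  - move=> st2 [_ [sv2 ow2 r2 H2 H2']]; split=> //; split=> //; first exact: same_vars_set.
    move=> i'; rewrite ltnS leq_eqVlt => /orP[/eqP ->|]; [exact: H2'|exact: H2].
  apply: runs_for.
  - by split=> //; exact: same_vars_set.
  - by move=> j st2 _ _ [sv2 _ _ _ _]; exact: neval_same.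
  move=> j st2 jM cj [sv2 ow2 r2 H2 H2'].
  apply: runs_weaken (runs_rset _ _ _ _ _) => [|st3 <-]; first by rewrite /=; lia.
  rewrite /= r2; split; first exact: cj.
  split=> //.
  - by apply: same_vars_set.
  - by move=> b ba i' j' /=; rewrite (negPf ba) /= ow2.
  - move=> i' ii; rewrite /partial /= (ltn_eqF ii) andbF; exact: H2.
  - rewrite /partial /= !eqxx /= big_nat_recr//= H2'; congr (_ + _).
    exact: (reval_current ae).
apply: runs_weaken base.
- apply: leq_trans (loop_cost (rsize e) (dim_val_mul ok) (dim_val_le r) _
    (nsize_dim c) (nsize_dim r)) => //.
  by rewrite -/N -/M; nia.
- move=> st' [_ [sv ow H]]; split=> // i.
  rewrite !(neval_same _ sv) => ir; rewrite H//; apply: eq_big_nat => j _.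
  by apply/esym/reval_at => //; exact: only_writes_agree ae.
Qed.

Lemma runs_solve m2 mp g A b C h x : x \notin [:: g; A; b; C; h] ->
  stmt_ok (SSolve m2 mp g A b C h x) ->
  runs (compile_stmt (SSolve m2 mp g A b C h x)) st
    (8 * (nsize m2 + nsize mp + 30) * (n.+1 * d.+1)) [:: (neval st m2, neval st mp)]
    (fun st' => [/\ same_vars st st', only_writes x st st' &
       holds st' (SSolve m2 mp g A b C h x)]).
Proof.
move=> xe ok; eexists; eexists; split; [exact: ExecSolve|by []| |].
  rewrite /=; have : (0 < n.+1 * d.+1)%N by [].
  by move: (nsize m2) (nsize mp) (n.+1 * d.+1)%N => q1 q2 X; nia.
set st' := set_cv _ _ _; have sv : same_vars st st' by [].
have ow : only_writes x st st' by move=> y yx i j; rewrite /= (negPf yx).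
split=> //=; rewrite /store_problem.
case/andP: ok => o2 op; rewrite (neval_dim o2 sv) (neval_dim op sv).
have ag := only_writes_agree ow xe.
have cv y m : y \in [:: g; A; b; C; h] -> get_cv st' y m = get_cv st y m.
  by move=> yin; apply/matrixP => i j; rewrite !mxE ag.
have mx y m : y \in [:: g; A; b; C; h] -> get_mx st' y m d = get_mx st y m d.
  by move=> yin; apply/matrixP => i j; rewrite !mxE ag.
rewrite (cv g) ?(cv b) ?(cv h) ?(mx A) ?(mx C) ?inE ?eqxx ?orbT//.
apply/matrixP => i j; rewrite ord1 mxE /st' /= eqxx ltn_ord /=.
exact: (entry_ord _ i 0).
Qed.

Lemma runs_stmt t : stmt_ok t -> target t \notin reads t ->
  runs (compile_stmt t) st (8 * (stmt_size t + 30) * (n.+1 * d.+1)) (queries_of st [:: t])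
    (fun st' => [/\ same_vars st st', only_writes (target t) st st' & holds st' t]).
Proof.
case: t => [a r c e|a r c e|m2 mp g A b C h x] ok nr.
- exact: runs_set.
- exact: runs_sum.
- exact: runs_solve.
Qed.

End Dims.

Lemma queries_of_same st st' P : all stmt_ok P -> same_vars st st' ->
  queries_of st' P = queries_of st P.
Proof.
move=> + sv; elim: P => //= t P IH /andP[ok /IH]; rewrite /queries_of /= => ->.
congr (_ ++ _); case: t ok => //= m2 mp _ _ _ _ _ _ /andP[o2 op].
by rewrite (neval_dim o2 sv) (neval_dim op sv).
Qed.

Lemma single_assignment_ok P : single_assignment P -> all stmt_ok P.
Proof. by elim: P => //= t P IH /and4P[-> _ _ /IH]. Qed.

(** In a single-assignment program no array read by a statement changes
    afterwards, so all statements hold as equations in the final store. *)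
Lemma runs_compile P st n : nvar st 0%N = n -> nvar st 1%N = d -> single_assignment P ->
  runs (compile P) st (code_size P * (n.+1 * d.+1)) (queries_of st P)
    (fun st' => [/\ same_vars st st',
       forall b, b \notin map target P -> forall i j, rarr st' b i j = rarr st b i j &
       forall t, List.In t P -> holds st' t]).
Proof.
elim: P st => [|t P IH] st stn std.
  by move=> _; exists st, (Cost 1 [::]); split=> //; first exact: ExecSkip.
rewrite [single_assignment _]/= => /and4P[ok nr later sa].
have -> : queries_of st (t :: P) = queries_of st [:: t] ++ queries_of st P.
  by rewrite /queries_of /= cats0.
have -> : (code_size (t :: P) * (n.+1 * d.+1) = 8 * (stmt_size t + 30) * (n.+1 * d.+1)
    + code_size P * (n.+1 * d.+1))%N by rewrite /= mulnDl.
apply: runs_seq (runs_stmt stn std ok nr) _ => st1 [sv1 ow1 h1].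
rewrite -(queries_of_same (single_assignment_ok sa) sv1).
have stn1 : nvar st1 0%N = n by rewrite sv1.
have std1 : nvar st1 1%N = d by rewrite sv1.
apply: runs_weaken (IH st1 stn1 std1 sa) => // st2 [sv2 fr2 h2].
have later' b : b \in target t :: reads t -> b \notin map target P.
  have : all (fun c => c \notin target t :: reads t) (map target P) by rewrite all_map.
  by move=> /allP al bin; apply/negP => /al; rewrite bin.
split=> //.
- by move=> x lx; rewrite sv2// sv1.
- move=> b; rewrite /= inE negb_or => /andP[bt bP] i j.
  by rewrite fr2// ow1.
- move=> u /= [<-|]; last exact: h2.
  by apply: holds_agree h1 => // b bin i j; rewrite fr2// later'.
Qed.

End Semantics.

(** * Objectives of the queries *)

Section SmoothedObjective.
Variables (R : realType) (p : R).
Hypothesis (p2 : 2 <= p).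

Lemma lp_normX (q : R) m (v : 'cV[R]_m) : 0 < q ->
  lp_norm q v `^ q = \sum_i `|v i 0| `^ q.
Proof.
move=> q0; rewrite /lp_norm -powRrM mulVf ?gt_eqF// powRr1//.
by apply: sumr_ge0 => i _; exact: powR_ge0.
Qed.

Lemma lp_norm2X m (v : 'cV[R]_m) : lp_norm 2 v ^+ 2 = \sum_i (v i 0) ^+ 2.
Proof.
rewrite -powR_mulrn ?powR_ge0// lp_normX//; apply: eq_bigr => i _.
by rewrite powR_mulrn// real_normK ?num_real.
Qed.

Lemma smoothed_minimizer_exists d (q : smoothed_problem R d) :
  sp_g q = 0 -> exists x, is_minimizer (smoothed_obj p q) x.
Proof.
move=> g0; have p0 : 0 < p by have := p2; lra.
pose bq (i : 'I_(rows2 q + rowsp q)) :=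
  match split i with inl j => sp_b q j 0 | inr j => sp_h q j 0 end.
pose e (i : 'I_(rows2 q + rowsp q)) : R := if split i then 2 else p.
have e1 i : 1 <= e i by rewrite /e; have p2' := p2; case: (split i) => j /=; lra.
have [x xmin] := sum_norm_powR_minimizer (col_mx (sp_A q) (sp_C q)) bq e1.
have objE y : smoothed_obj p q y =
    \sum_i `|(col_mx (sp_A q) (sp_C q) *m y) i 0 - bq i| `^ e i.
  rewrite /smoothed_obj g0 trmx0 mul0mx mxE add0r lp_norm2X lp_normX//.
  rewrite big_split_ord /=; congr (_ + _); apply: eq_bigr => i _.
  - rewrite /bq /e mul_col_mx col_mxEu (unsplitK (inl i)) !mxE.
    by rewrite powR_mulrn// real_normK ?num_real.
  - by rewrite /bq /e mul_col_mx col_mxEd (unsplitK (inr i)) !mxE.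
by exists x => y; rewrite !objE; exact: xmin.
Qed.

Lemma pobj_minimizer_exists (s : R) n d (A : 'M[R]_(n, d)) (b : 'cV[R]_n) : 2 < s ->
  exists x, is_minimizer (pobj s A b) x.
Proof.
move=> s2; have s1 (i : 'I_n) : 1 <= s by lra.
have [x xmin] := sum_norm_powR_minimizer A (fun i => b i 0) s1.
have objE y : pobj s A b y = \sum_i `|(A *m y) i 0 - b i 0| `^ s.
  by apply: eq_bigr => i _; rewrite /resid !mxE.
by exists x => y; rewrite !objE; exact: xmin.
Qed.

Lemma regression_objE (s : R) n d (A : 'M[R]_(n, d)) (b : 'cV[R]_n) x : 0 < s ->
  regression_obj s A b x = pobj s A b x.
Proof. by move=> s0; rewrite /regression_obj lp_normX. Qed.

Lemma store_problemE d st m2 mp (g A2 b2 C h : nat) (v : 'cV[R]_d) :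
  smoothed_obj p (store_problem d st m2 mp g A2 b2 C h) v =
  \sum_(j < d) rarr st g j 0%N * v j 0
  + \sum_(0 <= i < neval st m2)
      (\sum_(j < d) rarr st A2 i j * v j 0 - rarr st b2 i 0%N) ^+ 2
  + \sum_(0 <= i < neval st mp)
      `|\sum_(j < d) rarr st C i j * v j 0 - rarr st h i 0%N| `^ p.
Proof.
rewrite /smoothed_obj /= lp_norm2X lp_normX; last by have := p2; lra.
rewrite !big_mkord; congr (_ + _ + _).
- by rewrite mxE; apply: eq_bigr => j _; rewrite !mxE.
- apply: eq_bigr => i _; congr (_ ^+ 2); rewrite !mxE; congr (_ - _).
  by apply: eq_bigr => j _; rewrite !mxE.
- apply: eq_bigr => i _; congr (`|_| `^ _); rewrite !mxE; congr (_ - _).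
  by apply: eq_bigr => j _; rewrite !mxE.
Qed.

End SmoothedObjective.

(** * The parameters as expressions *)

Definition e_nat (k : nat) : rexpr := RNat (NConst k).
Definition e_opp (e : rexpr) : rexpr := RSub (e_nat 0) e.
Definition e_inv (e : rexpr) : rexpr := RDiv (e_nat 1) e.
Definition e_abs (e : rexpr) : rexpr := RPow (RMul e e) (e_inv (e_nat 2)).
(** The indicator of positivity, by [0 / 0 = 0]. *)
Definition e_pos (e : rexpr) : rexpr :=
  RDiv (RAdd e (e_abs e)) (RAdd e (e_abs e)).
Definition e_rows : rexpr := RNat (NVar 0).
Definition e_scalar (a : nat) : rexpr := RGet a (NConst 0) (NConst 0).
Definition e_eps : rexpr := RGet 2 (NConst 0) (NConst 0).
Definition e_s : rexpr := RGet 2 (NConst 1) (NConst 0).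
Definition e_p : rexpr := RGet 2 (NConst 2) (NConst 0).

Definition e_iters : rexpr :=
  let nu := RSub (e_inv e_p) (e_inv e_s) in
  RPow e_rows (RDiv nu (RAdd (e_nat 1) nu)).
Definition e_low : rexpr := e_inv (RPow (e_nat 2) (RAdd e_s (e_nat 1))).
Definition e_up : rexpr := RMul (RMul e_s e_s) (RPow (e_nat 2) e_s).
Definition e_flow_time : rexpr :=
  e_inv (RMul (e_nat 28) (RMul e_s (RPow (e_nat 2) e_s))).
Definition e_widen_factor : rexpr := RPow (e_nat 2) (e_inv (RSub e_s e_p)).
Definition e_width_ratio : rexpr :=
  RPow (RMul (RMul (e_nat 8) (RPow e_widen_factor e_s)) (RPow (e_nat 4) e_p))
    (e_inv e_p).
Definition e_flow_coef : rexpr :=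
  RMul e_flow_time (RPow (RMul (e_nat 4) (RPow e_width_ratio e_s))
    (e_opp (e_inv (RSub e_s (e_nat 1))))).
Definition e_flow_step : rexpr := RDiv e_flow_coef e_iters.
Definition e_step_len : rexpr :=
  RDiv (RMul e_low (RPow e_flow_time e_s))
    (RMul (e_nat 64) (RMul e_up (RPow (e_nat 2) e_s))).
Definition e_phase_len : rexpr :=
  RAdd (RDiv e_flow_time e_flow_step)
    (RMul (RMul (e_nat 8) (RPow (e_nat 4) e_p)) e_iters).
Definition e_weight0 : rexpr := RPow e_rows (e_opp (e_inv e_s)).

Definition e_budget : rexpr :=
  RMul (RAdd (RAdd (RDiv e_flow_time e_flow_coef) (RMul (e_nat 8) (RPow (e_nat 4) e_p)))
      (e_nat 1))
    (RAdd (RDiv (RMul (e_nat 4) e_s) e_step_len) (e_nat 1)).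

Section Expressions.
Variables (R : realType) (n d : nat) (eps s p : R).
Implicit Type st : store R.

Lemma reval_inv st e : reval st (e_inv e) = (reval st e)^-1.
Proof. exact: div1r. Qed.

Lemma reval_abs st e : reval st (e_abs e) = `|reval st e|.
Proof.
rewrite -[LHS]/((reval st e * reval st e) `^ reval st (e_inv (e_nat 2))).
by rewrite reval_inv -div1r -norm_powR_sqr powRr1.
Qed.

Lemma reval_pos st e : reval st (e_pos e) = (0 < reval st e)%R%:R.
Proof.
rewrite -[LHS]/((reval st e + reval st (e_abs e))
  / (reval st e + reval st (e_abs e))).
rewrite reval_abs; case: ltP => [e0|e0].
  by rewrite gtr0_norm// divff// gt_eqF// addr_gt0.
by rewrite ler0_norm// subrr mul0r.
Qed.

Definition has_params st : Prop :=
  [/\ nvar st 0%N = n, nvar st 1%N = d, rarr st 2%N 0%N 0%N = eps,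
      rarr st 2%N 1%N 0%N = s & rarr st 2%N 2%N 0%N = p].

Lemma has_params_at st i j : has_params st -> has_params (at_index st i j).
Proof. by []. Qed.

Section Params.
Variable st : store R.
Hypothesis hst : has_params st.

Lemma reval_rows : reval st e_rows = n%:R.
Proof. by case: hst => /= ->. Qed.

Lemma reval_eps : reval st e_eps = eps.
Proof. by case: hst => /=. Qed.

Lemma reval_s : reval st e_s = s.
Proof. by case: hst => /=. Qed.

Lemma reval_p : reval st e_p = p.
Proof. by case: hst => /=. Qed.

Lemma reval_iters : reval st e_iters = iters p s n.
Proof.
rewrite /iters -reval_rows -reval_s -reval_p -!reval_inv; reflexivity.
Qed.

Lemma reval_low : reval st e_low = c_low s.
Proof. by rewrite reval_inv /c_low -reval_s. Qed.

Lemma reval_up : reval st e_up = c_up s.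
Proof. by rewrite /c_up -reval_s. Qed.

Lemma reval_flow_time : reval st e_flow_time = flow_time s.
Proof. by rewrite reval_inv /flow_time -reval_s. Qed.

Lemma reval_widen_factor : reval st e_widen_factor = widen_factor p s.
Proof. by rewrite /widen_factor -reval_s -reval_p -div1r. Qed.

Lemma reval_width_ratio : reval st e_width_ratio = width_ratio p s.
Proof.
by rewrite /width_ratio -reval_widen_factor -reval_s -reval_p -div1r.
Qed.

Lemma reval_flow_coef : reval st e_flow_coef = flow_coef p s.
Proof.
by rewrite /flow_coef -reval_flow_time -reval_width_ratio -reval_s -div1r -sub0r.
Qed.

Lemma reval_flow_step : reval st e_flow_step = flow_step p s n.
Proof. by rewrite /flow_step -reval_flow_coef -reval_iters. Qed.

Lemma reval_step_len : reval st e_step_len = step_len s.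
Proof. by rewrite /step_len -reval_low -reval_up -reval_flow_time -reval_s. Qed.

Lemma reval_phase_len : reval st e_phase_len = phase_len p s n.
Proof.
by rewrite /phase_len -reval_flow_step -reval_flow_time -reval_iters -reval_p.
Qed.

Lemma reval_weight0 : reval st e_weight0 = weight0 s n.
Proof. by rewrite /weight0 -reval_rows -reval_s -div1r -sub0r. Qed.

Lemma reval_budget : reval st e_budget = budget p s.
Proof.
by rewrite /budget -reval_step_len -reval_flow_time -reval_flow_coef -reval_s -reval_p.
Qed.

End Params.
End Expressions.

(** * The program and its effect on the state *)

Definition e_row (a : nat) : rexpr := RGet a (NVar row_var) (NConst 0).
Definition e_col (a : nat) : rexpr := RGet a (NVar col_var) (NConst 0).
Definition e_entry (a : nat) : rexpr := RGet a (NVar row_var) (NVar col_var).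
Definition e_trans (a : nat) : rexpr := RGet a (NVar col_var) (NVar row_var).
(** The indicator of the last of the rows [0], ..., [n], by truncated
    subtraction. *)
Definition e_last : rexpr :=
  RNat (NSub (NAdd (NConst 1) (NVar row_var)) (NVar 0)).

(* Variables and arrays of the program; the prefix [t_] marks temporaries. *)
Notation v_started := 3%N (only parsing).
Notation v_count := 4%N (only parsing).
Notation a_mat := 0%N (only parsing).
Notation a_rhs := 1%N (only parsing).
Notation a_x := 3%N (only parsing).
Notation a_w := 4%N (only parsing).
Notation a_acc := 5%N (only parsing).
Notation a_gap := 6%N (only parsing).
Notation a_flows := 7%N (only parsing).
Notation a_steps := 8%N (only parsing).
Notation a_goal := 9%N (only parsing).
Notation t_radius := 19%N (only parsing).
Notation t_mul := 20%N (only parsing).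
Notation t_res := 21%N (only parsing).
Notation t_curv := 22%N (only parsing).
Notation t_grad := 23%N (only parsing).
Notation t_A := 24%N (only parsing).
Notation t_b := 25%N (only parsing).
Notation t_C := 26%N (only parsing).
Notation t_g := 27%N (only parsing).
Notation t_h := 28%N (only parsing).
Notation t_v := 29%N (only parsing).
Notation t_im := 30%N (only parsing).
Notation t_load := 31%N (only parsing).
Notation t_sum := 32%N (only parsing).
Notation t_small := 33%N (only parsing).
Notation t_flow := 34%N (only parsing).
Notation t_w := 35%N (only parsing).
Notation t_acc := 36%N (only parsing).
Notation t_flows := 37%N (only parsing).
Notation t_steps := 38%N (only parsing).
Notation t_end := 39%N (only parsing).
Notation t_cand := 40%N (only parsing).
Notation t_cmul := 41%N (only parsing).
Notation t_cobj := 42%N (only parsing).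
Notation t_obj := 43%N (only parsing).
Notation t_accept := 44%N (only parsing).
Notation t_x' := 45%N (only parsing).
Notation t_gap' := 46%N (only parsing).
Notation t_w' := 47%N (only parsing).
Notation t_acc' := 48%N (only parsing).
Notation t_flows' := 49%N (only parsing).
Notation t_steps' := 50%N (only parsing).

Definition e_not (e : rexpr) : rexpr := RSub (e_nat 1) e.

(** Builds the query of [oracle_obj]: square roots of the coefficients multiply
    the rows of the instance, and the slope is an additional last row. *)
Definition oracle_code : seq stmt := [::
  SSet t_radius DimOne DimOne (RPow (RMul (RPow (e_nat 2) e_s)
    (RDiv (e_scalar a_gap) e_low)) (e_inv e_s));
  SSum t_mul DimRows DimCols (RMul (e_entry a_mat) (e_col a_x));
  SSet t_res DimRows DimOne (RSub (e_row t_mul) (e_row a_rhs));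
  SSet t_curv DimRows DimOne (RPow (e_abs (e_row t_res)) (RSub e_s (e_nat 2)));
  SSum t_grad DimCols DimRows
    (RMul (RMul e_s (RMul (e_col t_curv) (e_col t_res))) (e_trans a_mat));
  SSet t_A DimRowsS DimCols
    (RAdd (RMul (RPow (RMul (RDiv (RDiv e_low (e_nat 2)) (e_scalar a_gap))
             (e_row t_curv)) (e_inv (e_nat 2))) (e_entry a_mat))
          (RMul e_last (RMul (RDiv (e_nat 4) (e_scalar a_gap)) (e_col t_grad))));
  SSet t_b DimRowsS DimOne (RMul e_last (e_opp (e_nat 4)));
  SSet t_C DimRows DimCols
    (RMul (RDiv (RPow (e_row a_w) (RDiv (RSub e_s e_p) e_p)) (e_scalar t_radius))
       (e_entry a_mat));
  SSet t_g DimCols DimOne (e_nat 0);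
  SSet t_h DimRows DimOne (e_nat 0);
  SSolve (NAdd (NConst 1) (NVar 0)) (NVar 0) t_g t_A t_b t_C t_h t_v ].

(** Computes the next state from the answer, in temporaries. Both outcomes of
    every test are computed and combined by indicators. *)
Definition update_code : seq stmt := [::
  SSum t_im DimRows DimCols (RMul (e_entry a_mat) (e_col t_v));
  SSet t_load DimRows DimOne (e_abs (RDiv (e_row t_im) (e_scalar t_radius)));
  SSum t_sum DimOne DimRows (RPow (e_col t_load) e_s);
  SSet t_small DimOne DimOne
    (e_not (e_pos (RSub (e_scalar t_sum) (RPow e_flow_step (RSub (e_nat 1) e_s)))));
  SSet t_flow DimOne DimOne (RMul (e_scalar t_small)
    (e_pos (RSub (RDiv e_flow_time e_flow_step) (e_scalar a_flows))));
  SSet t_w DimRows DimOne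
    (RAdd (RAdd (e_row a_w)
      (RMul (e_scalar t_flow) (RMul e_flow_step (e_row t_load))))
      (RMul (RMul (e_not (e_scalar t_small))
         (e_pos (RSub (e_row t_load) (RMul e_width_ratio (e_row a_w)))))
         (RMul (RSub e_widen_factor (e_nat 1)) (e_row a_w))));
  SSet t_acc DimCols DimOne
    (RAdd (e_row a_acc) (RMul (e_scalar t_flow) (e_row t_v)));
  SSet t_flows DimOne DimOne (RAdd (e_scalar a_flows) (e_scalar t_flow));
  SSet t_steps DimOne DimOne (RAdd (e_scalar a_steps) (e_nat 1));
  SSet t_end DimOne DimOne
    (e_not (e_pos (RSub e_phase_len (e_scalar t_steps))));
  SSet t_cand DimCols DimOne (RAdd (e_row a_x)
    (RMul (RDiv e_step_len (e_scalar t_flows)) (e_row t_acc)));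
  SSum t_cmul DimRows DimCols (RMul (e_entry a_mat) (e_col t_cand));
  SSum t_cobj DimOne DimRows
    (RPow (e_abs (RSub (e_col t_cmul) (e_col a_rhs))) e_s);
  SSum t_obj DimOne DimRows (RPow (e_abs (e_col t_res)) e_s);
  SSet t_accept DimOne DimOne (RMul (e_scalar t_end)
    (e_not (e_pos (RSub (e_scalar t_cobj) (e_scalar t_obj)))));
  SSet t_x' DimCols DimOne (RAdd (e_row a_x)
    (RMul (e_scalar t_accept) (RSub (e_row t_cand) (e_row a_x))));
  SSet t_gap' DimOne DimOne (RSub (e_scalar a_gap)
    (RMul (e_scalar t_end) (RDiv (RMul e_step_len (e_scalar a_gap)) (e_nat 4))));
  SSet t_w' DimRows DimOne (RAdd (e_row t_w)
    (RMul (e_scalar t_end) (RSub e_weight0 (e_row t_w))));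
  SSet t_acc' DimCols DimOne (RMul (e_not (e_scalar t_end)) (e_row t_acc));
  SSet t_flows' DimOne DimOne (RMul (e_not (e_scalar t_end)) (e_scalar t_flows));
  SSet t_steps' DimOne DimOne (RMul (e_not (e_scalar t_end)) (e_scalar t_steps)) ].

(** Copies the next state back; it is separate since these arrays have been
    read before. *)
Definition commit_code : seq stmt := [::
  SSet a_x DimCols DimOne (e_row t_x');
  SSet a_gap DimOne DimOne (e_scalar t_gap');
  SSet a_w DimRows DimOne (e_row t_w');
  SSet a_acc DimCols DimOne (e_row t_acc');
  SSet a_flows DimOne DimOne (e_scalar t_flows');
  SSet a_steps DimOne DimOne (e_scalar t_steps') ].

(** With no quadratic part and the instance itself as p-norm part, the query
    asks for the p-norm minimizer. *)
Definition init_code : seq stmt := [::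
  SSet t_g DimCols DimOne (e_nat 0);
  SSolve (NConst 0) (NVar 0) t_g t_g t_g a_mat a_rhs a_x;
  SSum t_mul DimRows DimCols (RMul (e_entry a_mat) (e_col a_x));
  SSum t_obj DimOne DimRows
    (RPow (e_abs (RSub (e_col t_mul) (e_col a_rhs))) e_s);
  SSet a_goal DimOne DimOne
    (RDiv (RMul e_eps (e_scalar t_obj)) (RPow e_rows e_s));
  SSet a_gap DimOne DimOne (e_scalar t_obj);
  SSet a_w DimRows DimOne e_weight0;
  SSet a_acc DimCols DimOne (e_nat 0);
  SSet a_flows DimOne DimOne (e_nat 0);
  SSet a_steps DimOne DimOne (e_nat 0) ].

Definition init_step : cmd := Seq (compile init_code) (NSet v_started (NConst 1)).

Definition search_code : seq stmt := oracle_code ++ update_code.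

Definition halt_test : cmd :=
  If (BRle (e_scalar a_gap) (e_scalar a_goal)) (NSet 2 (NConst 1)) Skip.

Definition micro_step : cmd :=
  Seq (compile search_code) (Seq (compile commit_code) halt_test).

Definition e_quota : rexpr := RMul e_budget (RAdd (e_nat 1) (RLn e_rows)).

Definition main_step : cmd :=
  Seq (NSet v_count (NConst 0))
    (While (BRle (RNat (NVar v_count)) e_quota)
       (Seq micro_step (NSet v_count (NAdd (NVar v_count) (NConst 1))))).

Definition iteration : cmd :=
  If (BNle (NConst 1) (NVar v_started)) main_step init_step.

Fixpoint all_hold (R : realType) d (solver : smoothed_problem R d -> 'cV[R]_d)
    (st : store R) (P : seq stmt) : Prop :=
  if P is t :: P' then holds solver st t /\ all_hold solver st P' else True.

Lemma all_holdP (R : realType) d (solver : smoothed_problem R d -> 'cV[R]_d)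
    (st : store R) P :
  (forall t, List.In t P -> holds solver st t) -> all_hold solver st P.
Proof.
elim: P => //= t P IH H; split; first by apply: H; left.
by apply: IH => u uP; apply: H; right.
Qed.

Lemma search_code_ok : single_assignment search_code. Proof. by []. Qed.
Lemma commit_code_ok : single_assignment commit_code. Proof. by []. Qed.
Lemma init_code_ok : single_assignment init_code. Proof. by []. Qed.

(* Simplification stops at these expressions, whose values are known. *)
Opaque e_abs e_pos e_eps e_s e_p e_rows e_low e_up e_iters e_flow_time e_widen_factor
  e_width_ratio e_flow_coef e_flow_step e_step_len e_phase_len e_weight0 e_budget.

Lemma evalE (R : realType) n d (eps s p : R) st : has_params n d eps s p st ->
  forall i j,
  (reval (at_index st i j) e_rows = n%:R) *
  (reval (at_index st i j) e_eps = eps) *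
  (reval (at_index st i j) e_s = s) *
  (reval (at_index st i j) e_p = p) *
  (reval (at_index st i j) e_low = c_low s) *
  (reval (at_index st i j) e_flow_time = flow_time s) *
  (reval (at_index st i j) e_widen_factor = widen_factor p s) *
  (reval (at_index st i j) e_width_ratio = width_ratio p s) *
  (reval (at_index st i j) e_flow_step = flow_step p s n) *
  (reval (at_index st i j) e_step_len = step_len s) *
  (reval (at_index st i j) e_phase_len = phase_len p s n) *
  (reval (at_index st i j) e_weight0 = weight0 s n).
Proof.
move=> hp i j; have h := has_params_at i j hp.
rewrite (reval_rows h) (reval_eps h) (reval_s h) (reval_p h) (reval_low h).
rewrite (reval_flow_time h) (reval_widen_factor h) (reval_width_ratio h).
rewrite (reval_flow_step h) (reval_step_len h) (reval_phase_len h).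
by rewrite (reval_weight0 h).
Qed.

Lemma get_cvE (R : realType) (st : store R) a m v : get_cv st a m = v ->
  forall i : 'I_m, rarr st a i 0%N = v i 0.
Proof. by move=> <- i; rewrite mxE. Qed.

Lemma powR_halfX2 (R : realType) (a : R) : 0 <= a -> (a `^ (1 / 2)) ^+ 2 = a.
Proof.
by move=> a0; rewrite -powR_mulrn ?powR_ge0// -powRrM div1r mulVf ?powRr1// pnatr_eq0.
Qed.

Lemma not_pos (R : realType) (a c : R) : 1 - (0 < a - c)%R%:R = (a <= c)%R%:R :> R.
Proof. by rewrite subr_gt0 leNgt; case: (c < a); rewrite ?subrr ?subr0. Qed.

Section MicroStep.
Variables (R : realType) (p s eps : R) (n d : nat) (A : 'M[R]_(n, d)) (b : 'cV[R]_n).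
Variable solver : smoothed_problem R d -> 'cV[R]_d.
Hypothesis p2 : 2 <= p.
Hypothesis solverP : smoothed_solver p solver.

Record mstate := MState {
  m_x : 'cV[R]_d; m_gap : R; m_w : 'I_n -> R; m_acc : 'cV[R]_d;
  m_flows : nat; m_steps : nat }.

Definition flow_ok (m : mstate) (v : 'cV[R]_d) : bool :=
  \sum_i `|im A v i / radius s (m_gap m)| `^ s <= flow_step p s n `^ (1 - s).

Definition next_search (m : mstate) (v : 'cV[R]_d) : mstate :=
  if flow_ok m v then
    if (m_flows m)%:R < flow_time s / flow_step p s n then
      MState (m_x m) (m_gap m) (flow_weight p s A (m_gap m) (m_w m) v)
        (m_acc m + v) (m_flows m).+1 (m_steps m).+1
    else MState (m_x m) (m_gap m) (m_w m) (m_acc m) (m_flows m) (m_steps m).+1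
  else MState (m_x m) (m_gap m) (widen_weight p s A (m_gap m) (m_w m) v)
        (m_acc m) (m_flows m) (m_steps m).+1.

Definition candidate (m : mstate) : 'cV[R]_d :=
  m_x m + (step_len s / (m_flows m)%:R) *: m_acc m.

Definition next_phase (m : mstate) : mstate :=
  if phase_len p s n <= (m_steps m)%:R then
    MState (if pobj s A b (candidate m) <= pobj s A b (m_x m)
            then candidate m else m_x m)
      (m_gap m - step_len s * m_gap m / 4) (fun=> weight0 s n) 0 0 0
  else m.

Definition advance (m : mstate) (v : 'cV[R]_d) : mstate := next_phase (next_search m v).

Definition has_inputs (st : store R) : Prop :=
  [/\ has_params n d eps s p st, rarr st a_mat =2 entry A &
      rarr st a_rhs =2 entry b].

Definition represents (st : store R) (m : mstate) : Prop :=
  [/\ get_cv st a_x d = m_x m, rarr st a_gap 0%N 0%N = m_gap m,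
      forall i : 'I_n, rarr st a_w i 0%N = m_w m i, get_cv st a_acc d = m_acc m &
      rarr st a_flows 0%N 0%N = (m_flows m)%:R
      /\ rarr st a_steps 0%N 0%N = (m_steps m)%:R].

Section Search.
Variables (st : store R) (m : mstate).
Hypotheses (hin : has_inputs st) (hm : represents st m).
Hypothesis (hsearch : all_hold solver st search_code).

Local Notation x := (m_x m).
Local Notation G := (m_gap m).
Local Notation v := (get_cv st t_v d).

Let hp : has_params n d eps s p st. Proof. by case: hin. Qed.
Let stn : nvar st 0%N = n. Proof. by case: hp. Qed.
Let std : nvar st 1%N = d. Proof. by case: hp. Qed.
Let matE (i : 'I_n) (j : 'I_d) : rarr st a_mat i j = A i j.
Proof. by case: hin => _ -> _; rewrite entry_ord. Qed.
Let rhsE (i : 'I_n) : rarr st a_rhs i 0%N = b i 0.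
Proof. by case: hin => _ _ ->; exact: (entry_ord b i 0). Qed.
Let xE (j : 'I_d) : rarr st a_x j 0%N = x j 0.
Proof. by case: hm => /get_cvE ->. Qed.
Let gapE : rarr st a_gap 0%N 0%N = G.
Proof. by case: hm. Qed.
Let wE (i : 'I_n) : rarr st a_w i 0%N = m_w m i.
Proof. by case: hm. Qed.

Let horacle : all_hold solver st oracle_code /\ all_hold solver st update_code.
Proof.
move: hsearch; rewrite /search_code; elim: oracle_code => //= t P IH [ht /IH[hP hu]].
by [].
Qed.

Lemma radiusE : rarr st t_radius 0%N 0%N = radius s G.
Proof.
have [[/= H _] _] := horacle.
by rewrite H// !(evalE hp) gapE div1r.
Qed.

Lemma oracle_code_res (i : 'I_n) : rarr st t_res i 0%N = resid A b x i.
Proof.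
have [[/= _ [H1 [H2 _]]] _] := horacle.
rewrite H2 ?stn// H1 ?stn// rhsE /resid !mxE; congr (_ - _).
by rewrite std big_mkord; apply: eq_bigr => j _; rewrite matE xE.
Qed.

Lemma oracle_code_curv (i : 'I_n) :
  rarr st t_curv i 0%N = `|resid A b x i| `^ (s - 2).
Proof.
have [[/= _ [_ [_ [H _]]]] _] := horacle.
by rewrite H ?stn// !(evalE hp) reval_abs /= oracle_code_res.
Qed.

Lemma oracle_code_grad (j : 'I_d) :
  rarr st t_grad j 0%N = \sum_i s * spow s (resid A b x i) * A i j.
Proof.
have [[/= _ [_ [_ [_ [H _]]]]] _] := horacle.
rewrite H ?std// stn big_mkord; apply: eq_bigr => i _.
by rewrite !(evalE hp) oracle_code_curv oracle_code_res matE.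
Qed.

Lemma lin_grad (u : 'cV[R]_d) :
  lin s A b x u = \sum_(j < d) rarr st t_grad j 0%N * u j 0.
Proof.
rewrite /lin; under [RHS]eq_bigr do rewrite oracle_code_grad mulr_suml.
rewrite exchange_big /=; apply: eq_bigr => i _.
by rewrite /im mxE mulr_sumr; apply: eq_bigr => j _; rewrite mulrA.
Qed.

Lemma oracle_code_obj (u : 'cV[R]_d) : 0 < G -> (forall i, 0 <= m_w m i) ->
  smoothed_obj p (store_problem d st (NAdd (NConst 1) (NVar 0)) (NVar 0)
    t_g t_A t_b t_C t_h) u = oracle_obj p s A b x G (m_w m) u.
Proof.
move=> G0 w0.
have [[/= _ [_ [_ [_ [_ [HA [Hb [HC [Hg [Hh _]]]]]]]]]] _] := horacle.
rewrite store_problemE// /= stn in HA Hb HC Hg Hh *.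
rewrite std in HA HC Hg.
rewrite big1 ?add0r; last by move=> j _; rewrite Hg// mul0r.
have p0 : 0 < p by have := p2; lra.
rewrite /oracle_obj; congr (_ + _); last first.
  rewrite big_mkord; apply: eq_bigr => i _; rewrite Hh// subr0.
  under eq_bigr => j _ do rewrite HC// !(evalE hp) matE wE radiusE -mulrA.
  rewrite -mulr_sumr -[X in `|_ * X|](_ : im A u i = _); last by rewrite /im mxE.
  rewrite -mulrA [_^-1 * _]mulrC normrM powRM// ger0_norm ?powR_ge0//.
  by rewrite -powRrM divfK// gt_eqF.
rewrite add1n big_nat_recr//= addrC; congr (_ + _).
  rewrite Hb// addnK.
  have -> : \sum_(j < d) rarr st t_A n j * u j 0 = 4 * (lin s A b x u / G).
    rewrite lin_grad mulr_suml mulr_sumr; apply: eq_bigr => j _.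
    rewrite HA// addnK.
    have -> : rarr st 0 n j = 0.
      by case: hin => _ -> _; rewrite /entry insubF// ltnn.
    rewrite gapE; ring.
  ring.
rewrite big_mkord /quad mulr_sumr; apply: eq_bigr => i _.
have lastE : (1 + i - n)%N = 0%N by apply/eqP; rewrite subn_eq0 add1n.
have cl0 : 0 < c_low s by exact: c_low_gt0.
have iS : (i < n.+1)%N by rewrite ltnS ltnW.
rewrite Hb// lastE mul0r subr0.
under eq_bigr => j _ do
  rewrite HA// lastE mul0r addr0 !(evalE hp) matE gapE oracle_code_curv -mulrA.
rewrite -mulr_sumr -[X in _ * X](_ : im A u i = _); last by rewrite /im mxE.
rewrite exprMn powR_halfX2 ?mulrA//.
by rewrite mulr_ge0 ?powR_ge0// divr_ge0 ?ltW// divr_gt0.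
Qed.

Lemma oracle_code_min : 0 < G -> (forall i, 0 <= m_w m i) ->
  oracle_min p s A b x G (m_w m) v.
Proof.
move=> G0 w0 u.
have [[/= _ [_ [_ [_ [_ [_ [_ [_ [Hg [_ [-> _]]]]]]]]]]] _] := horacle.
have := oracle_code_obj u G0 w0; have := oracle_code_obj (solver (store_problem d st
  (NAdd (NConst 1) (NVar 0)) (NVar 0) t_g t_A t_b t_C t_h)) G0 w0.
move=> <- <-; apply: solverP.
apply: (smoothed_minimizer_exists p2).
by apply/matrixP => i j; rewrite !mxE Hg ?std.
Qed.

Local Notation m1 := (next_search m v).

Let flowsE : rarr st a_flows 0%N 0%N = (m_flows m)%:R.
Proof. by case: hm => _ _ _ _ []. Qed.
Let stepsE : rarr st a_steps 0%N 0%N = (m_steps m)%:R.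
Proof. by case: hm => _ _ _ _ []. Qed.
Let accE (j : 'I_d) : rarr st a_acc j 0%N = m_acc m j 0.
Proof. by case: hm => _ _ _ /get_cvE ->. Qed.

Lemma next_search_x : m_x m1 = x /\ m_gap m1 = G.
Proof. by rewrite /next_search; case: ifP => // _; case: ifP. Qed.

Lemma update_code_load (i : 'I_n) : rarr st t_load i 0%N = `|im A v i / radius s G|.
Proof.
have [_ /= [H1 [H2 _]]] := horacle.
rewrite H2 ?stn// reval_abs /= radiusE H1 ?stn// std big_mkord.
congr (`|_ / _|); rewrite /im mxE; apply: eq_bigr => j _.
by rewrite matE [v j 0]mxE.
Qed.

Lemma update_code_small : rarr st t_small 0%N 0%N = (flow_ok m v)%:R.
Proof.
have [_ /= [_ [_ [H1 [H2 _]]]]] := horacle.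
rewrite H2// reval_pos /= !(evalE hp) not_pos /flow_ok H1// stn big_mkord.
by under eq_bigr do rewrite !(evalE hp) update_code_load.
Qed.

Lemma update_code_flow : rarr st t_flow 0%N 0%N =
  (flow_ok m v && ((m_flows m)%:R < flow_time s / flow_step p s n))%:R.
Proof.
have [_ /= [_ [_ [_ [_ [H _]]]]]] := horacle.
rewrite H// reval_pos /= !(evalE hp) update_code_small flowsE subr_gt0.
by case: (flow_ok m v); rewrite ?mul1r ?mul0r.
Qed.

Lemma update_code_w (i : 'I_n) : rarr st t_w i 0%N = m_w m1 i.
Proof.
have [_ /= [_ [_ [_ [_ [_ [H _]]]]]]] := horacle.
rewrite H ?stn// reval_pos /= !(evalE hp) update_code_small update_code_flow.
rewrite update_code_load wE subr_gt0 /next_search.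
case: (flow_ok m v) => /=; last first.
  rewrite mul0r addr0 subr0 mul1r /widen_weight.
  by case: ifP => _; rewrite ?mul1r ?mul0r ?addr0//; ring.
rewrite subrr !mul0r addr0; case: ifP => _; rewrite ?mul1r ?mul0r ?addr0//.
Qed.

Lemma update_code_acc (j : 'I_d) : rarr st t_acc j 0%N = m_acc m1 j 0.
Proof.
have [_ /= [_ [_ [_ [_ [_ [_ [H _]]]]]]]] := horacle.
rewrite H ?std// update_code_flow accE /next_search.
case: (flow_ok m v) => /=; last by rewrite mul0r addr0.
by case: ifP => _; rewrite ?mul0r ?addr0// mul1r !mxE.
Qed.

Lemma update_code_flows : rarr st t_flows 0%N 0%N = (m_flows m1)%:R.
Proof.
have [_ /= [_ [_ [_ [_ [_ [_ [_ [H _]]]]]]]]] := horacle.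
rewrite H// update_code_flow flowsE /next_search.
case: (flow_ok m v) => /=; last by rewrite addr0.
by case: ifP => _; rewrite ?addr0//= natr1.
Qed.

Lemma update_code_steps : rarr st t_steps 0%N 0%N = (m_steps m1)%:R.
Proof.
have [_ /= [_ [_ [_ [_ [_ [_ [_ [_ [H _]]]]]]]]]] := horacle.
rewrite H// stepsE /next_search natr1.
by case: (flow_ok m v) => //=; case: ifP.
Qed.

Lemma update_code_end :
  rarr st t_end 0%N 0%N = (phase_len p s n <= (m_steps m1)%:R)%R%:R.
Proof.
have [_ /= [_ [_ [_ [_ [_ [_ [_ [_ [_ [H _]]]]]]]]]]] := horacle.
by rewrite H// reval_pos /= !(evalE hp) update_code_steps not_pos.
Qed.

Lemma update_code_cand (j : 'I_d) : rarr st t_cand j 0%N = candidate m1 j 0.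
Proof.
have [_ /= [_ [_ [_ [_ [_ [_ [_ [_ [_ [_ [H _]]]]]]]]]]]] := horacle.
rewrite H ?std// !(evalE hp) update_code_flows update_code_acc xE.
by rewrite /candidate (proj1 next_search_x) !mxE.
Qed.

Lemma update_code_accept : rarr st t_accept 0%N 0%N =
  ((phase_len p s n <= (m_steps m1)%:R)
   && (pobj s A b (candidate m1) <= pobj s A b x))%R%:R.
Proof.
have [_ /= [_ [_ [_ [_ [_ [_ [_ [_ [_ [_ [_ [H1 [H2 [H3 [H4 _]]]]]]]]]]]]]]]]
  := horacle.
rewrite H4// reval_pos /= update_code_end not_pos.
have -> : rarr st t_cobj 0%N 0%N = pobj s A b (candidate m1).
  rewrite H2// stn big_mkord; apply: eq_bigr => i _.
  rewrite !(evalE hp) reval_abs /= H1 ?stn// rhsE std big_mkord.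
  congr (`|_| `^ _); rewrite /resid !mxE; congr (_ - _).
  by apply: eq_bigr => j _; rewrite matE update_code_cand.
have -> : rarr st t_obj 0%N 0%N = pobj s A b x.
  rewrite H3// stn big_mkord; apply: eq_bigr => i _.
  by rewrite !(evalE hp) reval_abs /= oracle_code_res.
by case: (phase_len _ _ _ <= _); rewrite ?mul1r ?mul0r.
Qed.

Definition next_in_temporaries : Prop :=
  [/\ forall j : 'I_d, rarr st t_x' j 0%N = m_x (advance m v) j 0,
      rarr st t_gap' 0%N 0%N = m_gap (advance m v),
      forall i : 'I_n, rarr st t_w' i 0%N = m_w (advance m v) i,
      forall j : 'I_d, rarr st t_acc' j 0%N = m_acc (advance m v) j 0 &
      rarr st t_flows' 0%N 0%N = (m_flows (advance m v))%:R
      /\ rarr st t_steps' 0%N 0%N = (m_steps (advance m v))%:R].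

Lemma update_code_next : next_in_temporaries.
Proof.
have [_ /= [_ [_ [_ [_ [_ [_ [_ [_ [_ [_ [_ [_ [_ [_ [_
  [H1 [H2 [H3 [H4 [H5 [H6 _]]]]]]]]]]]]]]]]]]]]]] := horacle.
have [nx ng] := next_search_x.
split=> [j||i|j|]; last split.
- rewrite H1 ?std// update_code_accept xE update_code_cand /advance /next_phase.
  case: ifP => _; rewrite ?mul0r ?addr0 ?nx//.
  case: ifP => _; rewrite ?mul0r ?addr0// mul1r addrC subrK//.
- rewrite H2// !(evalE hp) update_code_end gapE /advance /next_phase.
  by case: ifP => _; rewrite ?mul0r ?subr0 ?mul1r ng.
- rewrite H3 ?stn// !(evalE hp) update_code_end update_code_w /advance /next_phase.
  by case: ifP => _; rewrite ?mul0r ?addr0// mul1r addrC subrK.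
- rewrite H4 ?std// update_code_end update_code_acc /advance /next_phase.
  by case: ifP => _; rewrite ?subrr ?mul0r ?mxE// subr0 mul1r.
- rewrite H5// update_code_end update_code_flows /advance /next_phase.
  by case: ifP => _; rewrite ?subrr ?mul0r// subr0 mul1r.
- rewrite H6// update_code_end update_code_steps /advance /next_phase.
  by case: ifP => _; rewrite ?subrr ?mul0r// subr0 mul1r.
Qed.

End Search.
Lemma commit_represents st st' m v : next_in_temporaries st m ->
  v = get_cv st t_v d ->
  (forall c, c \notin map target commit_code -> forall i j, rarr st' c i j = rarr st c i j) ->
  nvar st' 0%N = n -> nvar st' 1%N = d ->
  all_hold solver st' commit_code -> represents st' (advance m v).
Proof.
move=> [hx hg hw hacc [hf hs]] -> fr stn std /= [H1 [H2 [H3 [H4 [H5 [H6 _]]]]]].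
split; last split.
- by apply/matrixP => j k; rewrite ord1 mxE H1 ?std// fr.
- by rewrite H2// fr.
- by move=> i; rewrite H3 ?stn// fr.
- by apply/matrixP => j k; rewrite ord1 mxE H4 ?std// fr.
- by rewrite H5// fr.
- by rewrite H6// fr.
Qed.

Lemma same_inputs st st' : same_vars st st' ->
  (forall c, (c < 10)%N -> forall i j, rarr st' c i j = rarr st c i j) ->
  has_inputs st -> has_inputs st'.
Proof.
move=> sv fr [[h0 h1 h2 h3 h4] hA hb]; split; first split.
- by rewrite sv.
- by rewrite sv.
- by rewrite fr.
- by rewrite fr.
- by rewrite fr.
- by move=> i j; rewrite fr.
- by move=> i j; rewrite fr.
Qed.

Lemma same_represents st st' m :
  (forall c, (c < 10)%N -> forall i j, rarr st' c i j = rarr st c i j) ->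
  represents st m -> represents st' m.
Proof.
move=> fr [h1 h2 h3 h4 [h5 h6]]; split; last split; rewrite ?fr//.
- by rewrite -h1; apply/matrixP => i j; rewrite !mxE fr.
- by move=> i; rewrite fr.
- by rewrite -h4; apply/matrixP => i j; rewrite !mxE fr.
Qed.

Definition micro_cost : nat := code_size search_code + code_size commit_code + 20.

Lemma micro_step_runs st m goal :
  has_inputs st -> represents st m -> rarr st a_goal 0%N 0%N = goal ->
  runs solver micro_step st (micro_cost * (n.+1 * d.+1)) [:: (n.+1, n)]
    (fun st' => exists v,
       [/\ 0 < m_gap m -> (forall i, 0 <= m_w m i) ->
             oracle_min p s A b (m_x m) (m_gap m) (m_w m) v,
           has_inputs st', represents st' (advance m v), rarr st' a_goal 0%N 0%N = goal &
           [/\ nvar st' v_started = nvar st v_started, nvar st' v_count = nvar st v_count &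
             halted st' = halted st || (m_gap (advance m v) <= goal)]]).
Proof.
move=> hin hm hg; have [[stn std _ _ _] _ _] := hin.
have -> : [:: (n.+1, n)] = queries_of st search_code ++ queries_of st commit_code ++ [::].
  by rewrite /queries_of /= stn.
have X0 : (0 < n.+1 * d.+1)%N by [].
apply: (@runs_weaken R d solver micro_step st
  (code_size search_code * (n.+1 * d.+1) + (code_size commit_code * (n.+1 * d.+1) + 20))).
- rewrite /micro_cost; move: (code_size search_code) (code_size commit_code) X0.
  by move: (n.+1 * d.+1)%N => X c1 c2; nia.
- by move=> st'; exact.
apply: runs_seq (runs_compile solver stn std search_code_ok) _ => st1 [sv1 fr1 h1].
have small1 c : (c < 10)%N -> c \notin map target search_code.
  by move: c; do 10?[case=> //].
have fr1' c : (c < 10)%N -> forall i j, rarr st1 c i j = rarr st c i j.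
  by move=> /small1; exact: fr1.
have hin1 := same_inputs sv1 fr1' hin; have hm1 := same_represents fr1' hm.
have hold1 := all_holdP h1.
have [[stn1 std1 _ _ _] _ _] := hin1.
have hnext := update_code_next hin1 hm1 hold1.
have hmin := oracle_code_min hin1 hm1 hold1.
have -> : queries_of st commit_code = queries_of st1 commit_code by [].
apply: runs_seq (runs_compile solver stn1 std1 commit_code_ok) _ => st2 [sv2 fr2 h2].
have hm2 := commit_represents hnext erefl fr2 (etrans (sv2 0%N isT) stn1)
  (etrans (sv2 1%N isT) std1) (all_holdP h2).
have hin2 : has_inputs st2.
  case: hin1 => [[k0 k1 k2 k3 k4] kA kb]; split; first split.
  - by rewrite sv2.
  - by rewrite sv2.
  - by rewrite fr2.
  - by rewrite fr2.
  - by rewrite fr2.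
  - by move=> i j; rewrite fr2.
  - by move=> i j; rewrite fr2.
have hg2 : rarr st2 a_goal 0%N 0%N = goal by rewrite fr2// fr1'.
have n3 : nvar st2 v_started = nvar st v_started by rewrite sv2// sv1.
have n4 : nvar st2 v_count = nvar st v_count by rewrite sv2// sv1.
have nh : halted st2 = halted st by rewrite /halted sv2// sv1.
have tE : beval st2 (BRle (e_scalar a_gap) (e_scalar a_goal))
    = (m_gap (advance m (get_cv st1 t_v d)) <= goal).
  by case: hm2 => _ /= -> _ _ _; rewrite hg2.
case le_goal: (m_gap (advance m (get_cv st1 t_v d)) <= goal).
- exists (set_nvar st2 2 1), (cost_add (Cost 8 [::]) (Cost 2 [::])); split=> //.
    by apply: ExecIf; rewrite tE le_goal; exact: ExecNSet.
  by exists (get_cv st1 t_v d); split=> //; split=> //; rewrite le_goal orbT.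
- exists st2, (cost_add (Cost 8 [::]) (Cost 1 [::])); split=> //.
    by apply: ExecIf; rewrite tE le_goal; exact: ExecSkip.
  by exists (get_cv st1 t_v d); split=> //; split=> //; rewrite le_goal orbF.
Qed.

End MicroStep.

(** * Invariant across phases *)

Section GapArithmetic.
Variable R : realType.
Implicit Types f c h g e : R.

Lemma half_gap_gt0 f h g : f - h <= g -> g / 2 < f - h -> 0 < g.
Proof. lra. Qed.

Lemma shrunk_gap_ge0 g e : 0 <= g -> e <= g -> 0 <= g - e / 4.
Proof. lra. Qed.

Lemma gap_progress f c h g e : 0 <= e -> f - h <= g -> c <= f - e / 4 ->
  (if c <= f then c else f) - h <= g - e / 4.
Proof. by case: (leP c f) => ? ? ? ?; lra. Qed.

Lemma gap_stalled f c h g e : 0 <= g -> e <= g -> f - h <= g / 2 ->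
  (if c <= f then c else f) - h <= g - e / 4.
Proof. by case: (leP c f) => ? ? ? ?; lra. Qed.

End GapArithmetic.

Section Outer.
Variables (R : realType) (p s eps : R) (n d : nat) (A : 'M[R]_(n, d)) (b : 'cV[R]_n).
Variable solver : smoothed_problem R d -> 'cV[R]_d.
Hypotheses (p2 : 2 <= p) (ps : p < s) (n0 : (0 < n)%N).
Hypothesis solverP : smoothed_solver p solver.
Variable xmin : 'cV[R]_d.

Implicit Types (m : mstate R n d) (v : 'cV[R]_d).
Local Notation F := (pobj s A b).

Definition outer_inv m : Prop :=
  [/\ 0 <= m_gap m, F (m_x m) - F xmin <= m_gap m &
    m_gap m / 2 < F (m_x m) - F xmin ->
    phase_inv p s A b (m_x m) (m_gap m) (m_w m) (m_acc m) (m_flows m) (m_steps m)].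

(** A query divides by [G] and takes roots of powers of the weights, so an answer
    is a minimizer only under these two conditions. *)
Definition oracle_answer m v : Prop :=
  0 < m_gap m -> (forall i, 0 <= m_w m i) ->
  oracle_min p s A b (m_x m) (m_gap m) (m_w m) v.

Lemma outer_inv_start x G : 0 <= G -> F x - F xmin <= G ->
  outer_inv (MState x G (fun=> weight0 s n) 0 0 0).
Proof.
move=> G0 xG; split=> //= Glo; apply: phase_inv_start => //.
exact: half_gap_gt0 Glo.
Qed.

Lemma phase_inv_oracle m v : outer_inv m -> oracle_answer m v ->
  m_gap m / 2 < F (m_x m) - F xmin ->
  0 < m_gap m /\ oracle_min p s A b (m_x m) (m_gap m) (m_w m) v.
Proof.
move=> [G0 xG inv] ans good; have G1 : 0 < m_gap m := half_gap_gt0 xG good.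
split=> //; apply: ans => // i; have [w0 _ _ _ _] := inv good.
by apply: le_trans (w0 i); rewrite ltW// weight0_gt0.
Qed.

Lemma next_search_inv m v : outer_inv m -> oracle_answer m v ->
  outer_inv (next_search p s A m v).
Proof.
move=> inv ans; have [G0 xG _] := inv.
have eqx : m_x (next_search p s A m v) = m_x m.
  by rewrite /next_search; case: ifP => // _; case: ifP.
have eqg : m_gap (next_search p s A m v) = m_gap m.
  by rewrite /next_search; case: ifP => // _; case: ifP.
split; rewrite ?eqg ?eqx// => good.
have [G1 mv] := phase_inv_oracle inv ans good.
have [cheap [cl cq cs]] := cheap_direction p2 ps good xG.
have {}inv : phase_inv p s A b (m_x m) (m_gap m) (m_w m) (m_acc m) (m_flows m) (m_steps m).
  by case: inv => _ _; apply.
rewrite /next_search; case: ifP => [small|/negbT]; last first.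
  rewrite /flow_ok -ltNge => large /=.
  exact: (phase_inv_widen p2 ps n0 G1 cl cq cs inv mv large).
case: ltP => fl /=.
  exact: (phase_inv_flow p2 ps n0 G1 cl cq cs inv mv small fl).
exact: phase_inv_idle.
Qed.

(** Running one step from this store shows that the oracle's objective has a
    minimizer, namely the answer of the solver. *)
Definition store_of m : store R :=
  Store (nth 0%N [:: n; d]) (fun a i j => nth 0 [:: entry A i j; entry b i j;
    nth 0 [:: eps; s; p] i; entry (m_x m) i j; oapp (m_w m) 0 (insub i);
    entry (m_acc m) i j; m_gap m; (m_flows m)%:R; (m_steps m)%:R] a).

Lemma store_of_inputs m : has_inputs p s eps A b (store_of m).
Proof. by []. Qed.

Lemma store_of_represents m : represents (store_of m) m.
Proof.
split=> //=.
- by apply/matrixP => i j; rewrite !mxE ord1; exact: (entry_ord _ i 0).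
- by move=> i; rewrite valK.
- by apply/matrixP => i j; rewrite !mxE ord1; exact: (entry_ord _ i 0).
Qed.

Lemma oracle_answer_exists m : exists v, oracle_answer m v.
Proof.
have [st [co [_ _ _ [v [hv _ _ _ _]]]]] :=
  micro_step_runs p2 solverP (store_of_inputs m) (store_of_represents m) erefl.
by exists v.
Qed.

(** If the gap is at most half of the bound, lowering the bound by a quarter or
    less keeps it valid without any progress. *)
Lemma next_phase_inv m : outer_inv m -> outer_inv (next_phase p s A b m).
Proof.
move=> inv; rewrite /next_phase; case: ifP => klen; last exact: inv.
have [G0 xG ginv] := inv.
have sl0 := step_len_gt0 p2 ps; have sl1 := step_len_le1 p2 ps.
have slG0 := mulr_ge0 (ltW sl0) G0.
have slG : step_len s * m_gap m <= m_gap m by rewrite ler_piMl.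
apply: outer_inv_start; first exact: shrunk_gap_ge0.
rewrite (fun_if F).
have [good|bad] := ltP (m_gap m / 2) (F (m_x m) - F xmin); last exact: gap_stalled.
have [v ans] := oracle_answer_exists m.
have [G1 mv] := phase_inv_oracle inv ans good.
have [cheap [cl cq cs]] := cheap_direction p2 ps good xG.
apply: gap_progress slG0 xG _.
exact: (phase_progress p2 ps n0 G1 cl cq cs (ginv good) mv klen).
Qed.

Lemma advance_inv m v : outer_inv m -> oracle_answer m v ->
  outer_inv (advance p s A b m v).
Proof. by move=> inv ans; apply: next_phase_inv; exact: next_search_inv. Qed.

(** An integer threshold makes all phases equally long. *)
Lemma phase_length_nat : exists L : nat,
  [/\ (0 < L)%N, forall k : nat, (phase_len p s n <= k%:R) = (L <= k)%N &
      L%:R <= phase_len p s n + 1].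
Proof.
have T1 := iters_ge1 p2 ps n0; have T0 := lt_le_trans ltr01 T1.
have len0 : 0 < phase_len p s n.
  apply: ltr_pwDl; first exact: divr_gt0 (flow_time_gt0 p2 ps) (flow_step_gt0 p2 ps n0).
  by rewrite mulr_ge0 ?(ltW T0)// mulr_ge0// powR_ge0.
have ex : exists k : nat, phase_len p s n <= k%:R.
  by exists (Num.bound (phase_len p s n)); rewrite ltW// archi_boundP// ltW.
case: (ex_minnP ex) => L hL Lmin; exists L; split.
- by rewrite lt0n; apply/eqP => L0; move: hL; rewrite L0 leNgt len0.
- move=> k; apply/idP/idP => [|Lk]; first exact: Lmin.
  by apply: le_trans hL _; rewrite ler_nat.
- case: L hL Lmin => [|L] hL Lmin; first by rewrite addr_ge0// ltW.
  rewrite -natr1 lerD2r leNgt; apply/negP => h.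
  by have := Lmin L (ltW h); rewrite ltnn.
Qed.

End Outer.

(** * Runs of the program *)

Section Run.
Variables (R : realType) (p s eps : R) (n d : nat) (A : 'M[R]_(n, d)) (b : 'cV[R]_n).
Variable solver : smoothed_problem R d -> 'cV[R]_d.
Hypotheses (p2 : 2 <= p) (ps : p < s) (n0 : (0 < n)%N).
Hypothesis solverP : smoothed_solver p solver.
Variable xmin : 'cV[R]_d.
Variable L : nat.
Hypothesis lenP : forall k : nat, (phase_len p s n <= k%:R) = (L <= k)%N.
Variables G0 goal : R.

Local Notation shrink := (1 - step_len s / 4).

(** All phases have the same length, so the number [j] of steps made so far
    determines the phase and with it the bound on the gap. *)
Definition clocked (j : nat) (st : store R) : Prop :=
  exists m ph, [/\ has_inputs p s eps A b st, represents st m,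
    outer_inv p s A b xmin m, rarr st a_goal 0%N 0%N = goal /\ nvar st v_started = 1%N &
    [/\ (m_steps m < L)%N, j = (ph * L + m_steps m)%N, m_gap m = G0 * shrink ^+ ph,
      halted st -> m_gap m <= goal & (0 < j)%N -> m_gap m <= goal -> halted st]].

Lemma advance_steps m v : m_steps (next_search p s A m v) = (m_steps m).+1.
Proof. by rewrite /next_search; case: ifP => // _; case: ifP. Qed.

Lemma advance_gap m v : m_gap (next_search p s A m v) = m_gap m.
Proof. by rewrite /next_search; case: ifP => // _; case: ifP. Qed.

Lemma micro_step_clocked j st : clocked j st ->
  runs solver micro_step st (micro_cost * (n.+1 * d.+1)) [:: (n.+1, n)]
    (fun st' => clocked j.+1 st' /\ nvar st' v_count = nvar st v_count).
Proof.
move=> [m [ph [hin hm inv [hg h3] [hL hj hgap hh hh']]]].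
apply: runs_weaken (micro_step_runs p2 solverP hin hm hg) => //.
move=> st' [v [ans hin' hm' hg' [h3' h4' hhalt]]]; split=> //.
have gap_le : m_gap (advance p s A b m v) <= m_gap m.
  rewrite /advance /next_phase; case: ifP => _ /=; rewrite advance_gap//.
  have [gap0 _ _] := inv.
  by rewrite lerBlDr lerDl divr_ge0// mulr_ge0// ltW// (step_len_gt0 p2 ps).
exists (advance p s A b m v).
have clock : exists ph', [/\ (m_steps (advance p s A b m v) < L)%N,
    j.+1 = (ph' * L + m_steps (advance p s A b m v))%N &
    m_gap (advance p s A b m v) = G0 * shrink ^+ ph'].
  rewrite /advance /next_phase lenP advance_steps.
  case: (leqP L (m_steps m).+1) => hk /=.
    exists ph.+1; split; first exact: leq_ltn_trans (leq0n _) hL.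
      have LE : L = (m_steps m).+1 by apply/eqP; rewrite eqn_leq hk hL.
      by rewrite hj addn0 mulSn {2}LE addSn addnC.
    by rewrite advance_gap hgap exprSr; ring.
  by exists ph; rewrite advance_steps advance_gap hgap; split=> //; rewrite hj addnS.
have [ph' [c1 c2 c3]] := clock; exists ph'; split; [exact: hin'|exact: hm'| | |].
- exact: (advance_inv eps p2 ps n0 solverP inv ans).
- by rewrite hg' h3'.
split; [exact: c1|exact: c2|exact: c3| |].
- by rewrite hhalt => /orP[/hh h|//]; exact: le_trans gap_le h.
- by move=> _ le_goal; rewrite hhalt le_goal orbT.
Qed.

Variable q : nat.
Hypothesis q0 : (0 < q)%N.
Hypothesis quotaP : forall k : nat,
  (k%:R <= budget p s * (1 + ln n%:R)) = (k < q)%N.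

Definition main_cost : nat := micro_cost + rsize e_quota + 30.

Lemma quota_test st : has_inputs p s eps A b st ->
  beval st (BRle (RNat (NVar v_count)) e_quota) = (nvar st v_count < q)%N.
Proof.
case=> hp _ _; rewrite -quotaP /=.
by rewrite (reval_rows hp) (reval_budget hp).
Qed.

Lemma main_loop_runs r j st : (nvar st v_count + r = q)%N -> clocked j st ->
  runs solver
    (While (BRle (RNat (NVar v_count)) e_quota)
       (Seq micro_step (NSet v_count (NAdd (NVar v_count) (NConst 1))))) st
    (r * (main_cost * (n.+1 * d.+1)) + rsize e_quota + 10) (nseq r (n.+1, n))
    (clocked (j + r)).
Proof.
elim: r j st => [|r IH] j st hr cl; have [m [ph [hin _ _ _ _]]] := cl.
  exists st, (Cost (bsize (BRle (RNat (NVar v_count)) e_quota)).+1 [::]); split=> //.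
  - by apply: ExecWhileF; rewrite quota_test// -leqNgt; lia.
  - by rewrite addn0.
have test : beval st (BRle (RNat (NVar v_count)) e_quota) by rewrite quota_test//; lia.
have [st1 [k1 [e1 qs1 o1 [cl1 n1]]]] := micro_step_clocked cl.
pose st2 := set_nvar st1 v_count (nvar st1 v_count + 1)%N.
have cl2 : clocked j.+1 st2.
  case: cl1 => m' [ph' [[hp' hA' hb'] hm' hinv' hg' hr']].
  by exists m', ph'.
have hr2 : (nvar st2 v_count + r = q)%N by rewrite /st2 /= n1; lia.
have [st3 [k3 [e3 qs3 o3 cl3]]] := IH j.+1 st2 hr2 cl2.
exists st3, (cost_add (Cost (bsize (BRle (RNat (NVar v_count)) e_quota)).+1 [::])
  (cost_add (cost_add k1 (Cost 4 [::])) k3)); split.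
- apply: ExecWhileT e3 => //; apply: ExecSeq e1 _; exact: ExecNSet.
- by rewrite /= qs1 qs3.
- have X0 : (0 < n.+1 * d.+1)%N by [].
  rewrite -[ops _]/((2 + rsize e_quota).+2 + (ops k1 + 4 + ops k3))%N.
  move: o1 o3 X0; rewrite /main_cost.
  move: micro_cost (n.+1 * d.+1)%N (ops k1) (ops k3) (rsize e_quota) => mc X a c t; nia.
- by rewrite -addSnnS.
Qed.

Lemma main_step_runs j st : clocked j st ->
  runs solver iteration st (q * (3 * main_cost * (n.+1 * d.+1))) (nseq q (n.+1, n))
    (clocked (j + q)).
Proof.
move=> cl; have [m [ph [hin hm hinv [hg h3] hr]]] := cl.
pose st1 := set_nvar st v_count 0.
have cl1 : clocked j st1 by case: hin => *; exists m, ph.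
have hq : (nvar st1 v_count + q = q)%N by [].
have [st2 [k2 [e2 qs2 o2 cl2]]] := main_loop_runs hq cl1.
exists st2, (cost_add (Cost 4 [::]) (cost_add (Cost 2 [::]) k2)); split=> //.
- apply: ExecIf; rewrite /= h3; apply: ExecSeq e2; exact: ExecNSet.
- have X0 : (0 < n.+1 * d.+1)%N by [].
  rewrite -[ops _]/(4 + (2 + ops k2))%N.
  move: o2 X0 q0; rewrite /main_cost.
  by move: micro_cost (n.+1 * d.+1)%N (ops k2) (rsize e_quota) => mc X a t; nia.
Qed.

(** A phase that achieves nothing lowers the bound on the gap like any other, so
    termination is a matter of counting steps. *)
Lemma iterates_main PH J j st : (0 < PH)%N -> G0 * shrink ^+ PH <= goal -> 0 <= G0 ->
  (PH * L <= j + J * q)%N -> clocked j st ->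
  exists ks st', [/\ iterates solver iteration st ks st', (size ks <= J)%N,
    exists2 m, represents st' m /\ outer_inv p s A b xmin m & m_gap m <= goal &
    all (fun c => (queries c == nseq q (n.+1, n))
      && (ops c <= q * (3 * main_cost * (n.+1 * d.+1)))%N) ks].
Proof.
move=> PH0 hPH G00; elim: J j st => [|J IH] j st hJ cl;
  have [m [ph [hin hm hinv [hg h3] [hL hj hgap hh hh']]]] := cl.
  have L0 : (0 < L)%N by case: L hL.
  have phPH : (PH <= ph)%N by rewrite leqNgt; apply/negP => h; nia.
  have gle : m_gap m <= goal.
    apply: le_trans hPH; rewrite hgap; apply: ler_wpM2l => //.
    have sl0 := step_len_gt0 p2 ps; have sl1 := step_len_le1 p2 ps.
    by apply: ler_wiXn2l => //; lra.
  have hst : halted st by apply: hh' => //; nia.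
  by exists [::], st; split=> //; [exact: IterStop|exists m].
case hst : (halted st).
  by exists [::], st; split=> //; [exact: IterStop|exists m => //; exact: hh].
have [st1 [k1 [e1 qs1 o1 cl1]]] := main_step_runs cl.
have hJ' : (PH * L <= (j + q) + J * q)%N by rewrite -addnA -mulSn.
have [ks [st2 [it2 sz2 fin2 all2]]] := IH (j + q)%N st1 hJ' cl1.
exists (k1 :: ks), st2; split=> //.
- by apply: IterStep it2; rewrite ?hst.
- by rewrite /= qs1 eqxx o1.
Qed.

End Run.

(** * The first point *)

Section Start.
Variables (R : realType) (p s eps : R) (n d : nat) (A : 'M[R]_(n, d)) (b : 'cV[R]_n).
Variable solver : smoothed_problem R d -> 'cV[R]_d.
Hypotheses (p2 : 2 <= p) (ps : p < s) (n0 : (0 < n)%N).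
Hypothesis solverP : smoothed_solver p solver.
Variable xmin : 'cV[R]_d.
Variable L : nat.
Hypothesis L0 : (0 < L)%N.

Lemma init_store_inputs : has_inputs p s eps A b (init_store s p eps A b).
Proof. by []. Qed.

Definition init_cost : nat := code_size init_code + 20.

Lemma init_runs :
  runs solver iteration (init_store s p eps A b) (init_cost * (n.+1 * d.+1)) [:: (0%N, n)]
    (fun st => exists2 x, is_minimizer (pobj p A b) x &
       clocked p s eps A b xmin L (pobj s A b x)
         (eps * pobj s A b x / n%:R `^ s) 0 st).
Proof.
set st0 := init_store s p eps A b.
have hin := init_store_inputs; rewrite -/st0 in hin.
have [st1 [k1 [e1 q1 o1 [sv1 fr1 h1]]]] :=
  runs_compile solver (erefl : nvar st0 0%N = n) (erefl : nvar st0 1%N = d) init_code_ok.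
have hin1 : has_inputs p s eps A b st1.
  case: hin => [[k0 k1' k2 k3 k4] kA kb]; split; first split.
  - by rewrite sv1.
  - by rewrite sv1.
  - by rewrite fr1.
  - by rewrite fr1.
  - by rewrite fr1.
  - by move=> i j; rewrite fr1.
  - by move=> i j; rewrite fr1.
have [hp hA hb] := hin1; have [stn std _ _ _] := hp.
pose x := get_cv st1 a_x d.
have := all_holdP h1; rewrite /=.
move=> [Hg [Hx [Hmul [Hobj [Hgoal [Hgap [Hw [Hacc [Hf [Hs _]]]]]]]]]].
have s0 : 0 < s by have := p2; have := ps; lra.
have p0 : 0 < p by have := p2; lra.
have matE (i : 'I_n) (j : 'I_d) : rarr st1 a_mat i j = A i j by rewrite hA entry_ord.
have rhsE (i : 'I_n) : rarr st1 a_rhs i 0%N = b i 0 by rewrite hb; exact: (entry_ord b i 0).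
have mulE (i : 'I_n) : rarr st1 t_mul i 0%N = (A *m x) i 0.
  rewrite Hmul ?stn// std big_mkord mxE; apply: eq_bigr => j _.
  by rewrite matE [x _ _]mxE.
have objE : rarr st1 t_obj 0%N 0%N = pobj s A b x.
  rewrite Hobj// stn big_mkord; apply: eq_bigr => i _.
  by rewrite (evalE hp) reval_abs /= mulE rhsE /resid !mxE.
have xP : is_minimizer (pobj p A b) x.
  have queryE u : smoothed_obj p
      (store_problem d st1 (NConst 0) (NVar 0) t_g t_g t_g a_mat a_rhs) u = pobj p A b u.
    rewrite (store_problemE p2) /= stn big_geq// addr0 big1 ?add0r; last first.
      by move=> j _; rewrite Hg ?std// mul0r.
    rewrite big_mkord; apply: eq_bigr => i _; rewrite /resid !mxE rhsE.
    by congr (`|_ - _| `^ _); apply: eq_bigr => j _; rewrite matE.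
  move=> u; rewrite /x Hx -!queryE; apply: solverP.
  apply: (smoothed_minimizer_exists p2).
  by apply/matrixP => i j; rewrite !mxE Hg ?std.
exists (set_nvar st1 v_started 1), (cost_add (Cost 4 [::]) (cost_add k1 (Cost 2 [::]))); split.
- apply: ExecIf; apply: ExecSeq e1 _; exact: ExecNSet.
- by rewrite /= q1.
- rewrite -[ops _]/(4 + (ops k1 + 2))%N; move: o1; rewrite /init_cost.
  have : (0 < n.+1 * d.+1)%N by [].
  by move: (code_size init_code) (n.+1 * d.+1)%N (ops k1) => c X o; nia.
exists x => //; exists (MState x (pobj s A b x) (fun=> weight0 s n) 0 0 0), 0%N.
have F0 := pobj_ge0 s A b xmin.
split; first exact: hin1.
- split=> //=; last split.
  + by rewrite Hgap.
  + by move=> i; rewrite Hw ?stn// (evalE hp).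
  + by apply/matrixP => i j; rewrite ord1 !mxE Hacc ?std.
  + by rewrite Hf.
  + by rewrite Hs.
- apply: (@outer_inv_start R p s n d A b p2 ps n0 xmin); first exact: pobj_ge0.
  by rewrite lerBlDr lerDl.
- by split=> //=; rewrite Hgoal// !(evalE hp) objE.
- split; [exact: L0|exact: erefl|by rewrite mulr1| |by []].
  by rewrite /halted /= sv1.
Qed.

End Start.

(** Each residual of the p-norm minimizer is bounded by its p-norm, hence by the
    p-norm of any other residual vector, hence by [n^(1/p)] times the s-norm of
    that one. *)
Lemma pobj_start (R : realType) (p s : R) (n d : nat) (A : 'M[R]_(n, d))
    (b : 'cV[R]_n) x y : 2 <= p -> p < s -> (0 < n)%N ->
  is_minimizer (pobj p A b) x -> pobj s A b x <= n%:R `^ s * pobj s A b y.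
Proof.
move=> p2 ps n0 xP.
have s0 : 0 < s by lra. have p0 : 0 < p by lra.
have nR : 1 <= n%:R :> R by rewrite ler1n.
have n0R : 0 < n%:R :> R by rewrite ltr0n.
pose M := pobj s A b y; have M0 : 0 <= M by exact: pobj_ge0.
have hy i : `|resid A b y i| `^ p <= M `^ (p / s).
  have E : p = s * (p / s) by field; rewrite gt_eqF.
  rewrite {1}E powRrM; apply: ge0_ler_powR; rewrite ?nnegrE ?powR_ge0//.
  - by rewrite divr_ge0 ?ltW.
  - by rewrite /M /pobj (bigD1 i)//= lerDl; apply: sumr_ge0 => k _; exact: powR_ge0.
have hx i : `|resid A b x i| `^ s <= n%:R `^ (s / p) * M.
  have H : `|resid A b x i| `^ p <= n%:R * M `^ (p / s).
    apply: le_trans (_ : pobj p A b x <= _).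
      by rewrite /pobj (bigD1 i)//= lerDl; apply: sumr_ge0 => k _; exact: powR_ge0.
    apply: le_trans (xP y) _.
    apply: le_trans (_ : \sum_(i < n) M `^ (p / s) <= _); first exact: ler_sum.
    by rewrite sumr_const card_ord mulr_natl.
  have E : s = p * (s / p) by field; rewrite gt_eqF.
  rewrite {1}E powRrM; apply: le_trans (_ : (n%:R * M `^ (p / s)) `^ (s / p) <= _).
    apply: ge0_ler_powR; [by rewrite divr_ge0 ?ltW| | |exact: H].
      exact: powR_ge0.
    by rewrite nnegrE mulr_ge0 ?powR_ge0.
  rewrite powRM ?powR_ge0 ?(ltW n0R)// -powRrM.
  have -> : p / s * (s / p) = 1 by field; rewrite !gt_eqF.
  by rewrite powRr1.
apply: le_trans (_ : \sum_(i < n) n%:R `^ (s / p) * M <= _); first exact: ler_sum.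
rewrite sumr_const card_ord -[leLHS]mulr_natl mulrA; apply: ler_wpM2r => //.
rewrite -{1}(powRr1 (ltW n0R)) -powRD; last by rewrite (gt_eqF n0R) implybT.
apply: ler_powR => //.
have : s / p <= s / 2 by apply: ler_wpM2l; [exact: ltW|rewrite lef_pV2 ?posrE; lra].
lra.
Qed.

(** * Counting iterations and the theorem *)

Section Counting.
Variable R : realType.
Implicit Types x a l e s K T : R.

Lemma nat_floor x : 0 <= x -> exists q : nat,
  [/\ (0 < q)%N, forall k : nat, (k%:R <= x) = (k < q)%N & q%:R <= x + 1].
Proof.
move=> x0; have ex : exists k : nat, x < k%:R.
  by exists (Num.bound x); exact: archi_boundP.
case: (ex_minnP ex) => q hq qmin; exists q.
have tests k : (k%:R <= x) = (k < q)%N.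
  rewrite leNgt; apply/idP/idP => [|kq].
    by rewrite ltnNge; apply: contraNN => qk; rewrite (lt_le_trans hq) ?ler_nat.
  by apply/negP => /qmin; rewrite leqNgt kq.
split=> //; first by rewrite -tests.
case: q tests hq qmin => [|q] tests _ _; first by rewrite addr_ge0.
by rewrite -natr1 lerD2r tests.
Qed.

(** [1 - x <= exp (- x)] turns phases into a logarithm; the sum of [s * ln n]
    and [ln (1 / eps)] is then majorized by a product of logarithms. *)
Lemma phase_count s e a (eps l : R) : 0 < e -> e <= 1 -> 1 <= s -> 0 <= a -> 1 <= l ->
  - ln eps <= l -> 0 < eps ->
  exists PH : nat, [/\ (0 < PH)%N, expR (s * a) * (1 - e / 4) ^+ PH <= eps &
    PH%:R <= (4 * s / e + 1) * ((1 + a) * l)].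
Proof.
move=> e0 e1 s1 a0 l1 le_l eps0.
pose r := 4 / e * (s * a + l).
have sa0 : 0 <= s * a by rewrite mulr_ge0//; lra.
have k0 : 0 < 4 / e by rewrite divr_gt0.
have r0 : 0 <= r by rewrite mulr_ge0 ?(ltW k0)// addr_ge0//; lra.
have [PH [PH0 tests PHle]] := nat_floor r0; exists PH; split=> //.
- have rPH : r <= PH%:R by rewrite ltW// ltNge tests ltnn.
  have sh0 : 0 <= 1 - e / 4 by lra.
  have sh1 : 1 - e / 4 <= expR (- (e / 4)) by exact: expR_ge1Dx.
  apply: le_trans (_ : expR (s * a) * expR (- (e / 4)) ^+ PH <= _).
    apply: ler_wpM2l; first exact: expR_ge0.
    by apply: lerXn2r; rewrite ?nnegrE ?expR_ge0.
  rewrite -expRM_natl -expRD -[leRHS]lnK ?posrE// ler_expR.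
  have eP : e / 4 * r <= PH%:R * (e / 4).
    by rewrite mulrC; apply: ler_wpM2r => //; lra.
  have eE : e / 4 * r = s * a + l by rewrite /r; field; rewrite gt_eqF.
  by move: eP; rewrite eE mulrN; lra.
- apply: le_trans PHle _; rewrite /r.
  have -> : 4 * s / e = 4 / e * s by ring.
  move: (4 / e) k0 => k k0.
  have h1 : s * a + l <= s * ((1 + a) * l).
    have : s * a * 1 <= s * a * l by apply: ler_wpM2l.
    have : 1 * l <= s * l by apply: ler_wpM2r => //; lra.
    lra.
  have h2 : 1 <= (1 + a) * l.
    have : 0 <= a * l by rewrite mulr_ge0//; lra.
    lra.
  by have := ler_wpM2l (ltW k0) h1; rewrite mulrDl mul1r mulrA; lra.
Qed.

Lemma logb_ge1 x : 1 <= logb x.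
Proof. by rewrite le_max lexx. Qed.

Lemma ln_le_logb x : ln x <= logb x.
Proof. by rewrite le_max lexx orbT. Qed.

Lemma iteration_count s T l (J m : nat) : 2 <= s -> 1 <= T -> 1 <= l ->
  J%:R <= T * l + 1 -> (m <= J.+1)%N -> m%:R <= 2 * (s * T * l ^+ 2).
Proof.
move=> s2 T1 l1 hJ hm.
apply: le_trans (_ : J.+1%:R <= _); first by rewrite ler_nat.
rewrite -natr1; apply: le_trans (_ : 3 * (T * l) <= _).
  have : 1 * 1 <= T * l by apply: ler_pM.
  lra.
have Tl0 : 0 <= T * l by rewrite mulr_ge0//; lra.
have : T * l * 1 <= T * l * l by apply: ler_wpM2l.
have -> : 2 * (s * T * l ^+ 2) = 2 * s * (T * l * l) by ring.
have Z0 : 0 <= T * l * l by rewrite mulr_ge0//; lra.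
by move: (T * l * l) Z0 => z z0 h; have : 4 * z <= 2 * s * z;
  [apply: ler_wpM2r => //; lra|lra].
Qed.

Lemma quota_bound x a l : 0 <= x -> a <= l -> 1 <= l ->
  x * (1 + a) + 1 <= (2 * x + 1) * l.
Proof.
move=> x0 al l1; have h : 1 + a <= 2 * l by lra.
by have := ler_wpM2l x0 h; lra.
Qed.

End Counting.

Lemma sum_problem_size d q r :
  (\sum_(x <- nseq q r) problem_size d x = q * problem_size d r)%N.
Proof. by rewrite big_nseq iter_addn_0 mulnC. Qed.

Lemma main_iteration_cost (R : realType) (N : R) (n d q K M : nat) c : (0 < n)%N ->
  q%:R <= N -> queries c = nseq q (n.+1, n) -> (ops c <= q * (M * (n.+1 * d.+1)))%N ->
  (M <= K)%N -> (3 <= K)%N -> iteration_cost_bound K n d N c.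
Proof.
move=> n0 qN qs os MK K3; rewrite /iteration_cost_bound qs size_nseq qN /=.
apply/andP; split.
  by apply/allP => r /nseqP[-> _] /=; nia.
rewrite sum_problem_size; apply: leq_trans os _.
have : (n.+1 * d.+1 <= problem_size d (n.+1, n))%N by rewrite /problem_size /=; nia.
move: (n.+1 * d.+1)%N (problem_size _ _) => X Z XZ.
have : (M * X <= K * Z)%N by exact: leq_mul.
by move: (M * X)%N => Y YZ; nia.
Qed.

Lemma init_iteration_cost (R : realType) (N : R) (n d K M : nat) c : (0 < n)%N ->
  1 <= N -> queries c = [:: (0%N, n)] -> (ops c <= M * (n.+1 * d.+1))%N ->
  (2 * M <= K)%N -> (0 < K)%N -> iteration_cost_bound K n d N c.
Proof.
move=> n0 N1 qs os MK K0; rewrite /iteration_cost_bound qs /= N1 /= andbT.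
apply/andP; split; first by rewrite leq_pmull.
rewrite big_seq1 /problem_size /=; apply: leq_trans os _.
have : (n.+1 * d.+1 <= 2 * (n * d.+1))%N by nia.
move: (n.+1 * d.+1)%N (n * d.+1)%N => X Y XY.
have : (M * X <= M * (2 * Y))%N by rewrite leq_mul2l XY orbT.
have : (2 * M * Y <= K * Y)%N by rewrite leq_mul2r MK orbT.
nia.
Qed.

Section Final.
Variables (R : realType) (p s : R) (n : nat).
Hypotheses (p2 : 2 <= p) (ps : p < s) (n0 : (0 < n)%N).

Lemma phase_len_le : phase_len p s n + 1
  <= (flow_time s / flow_coef p s + 8 * 4 `^ p + 1) * iters p s n.
Proof.
have T1 := iters_ge1 p2 ps n0; have T0 := lt_le_trans ltr01 T1.
rewrite /phase_len /flow_step invf_div mulrCA mulrC.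
move: (8 * _) (_ / flow_coef p s) => z y.
by rewrite 2!mulrDl mul1r lerD.
Qed.

Lemma budget_ge0 : 0 <= budget p s.
Proof.
have ft := flow_time_gt0 p2 ps; have fc := flow_coef_gt0 p2 ps.
have sl := step_len_gt0 p2 ps; have s0 : 0 <= s by have := p2; have := ps; lra.
rewrite /budget mulr_ge0//.
  by rewrite addr_ge0// addr_ge0 ?divr_ge0 ?mulr_ge0 ?powR_ge0// ltW.
by rewrite addr_ge0// divr_ge0 ?(ltW sl)// mulr_ge0.
Qed.

End Final.

Theorem theorem1p2 (R : realType) :
  exists (body : cmd) (K k : nat) (Q : R -> R -> R),
  forall (p s eps : R) (n d : nat) (A : 'M[R]_(n, d)) (b : 'cV[R]_n)
    (solver : smoothed_problem R d -> 'cV[R]_d),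
  2 <= p -> p < s -> 0 < eps -> (0 < n)%N -> (0 < d)%N ->
  smoothed_solver p solver ->
  let nu := p^-1 - s^-1 in
  exists (ks : seq cost) (st : store R),
  [/\ iterates solver body (init_store s p eps A b) ks st,
      approx_solution s eps A b (output d st),
      (size ks)%:R
        <= K%:R * (s * n%:R `^ (nu / (1 + nu)) * logb (n%:R / eps) ^+ 2) &
      all (iteration_cost_bound K n d (Q p s * logb n%:R ^+ k)) ks].
Proof.
have [K [K_init K_main K3]] : exists K : nat,
    [/\ 2 * init_cost <= K, 3 * main_cost <= K & 3 <= K]%N.
  exists (2 * init_cost + 3 * main_cost + 3)%N; split.
  - exact: leq_trans (leq_addr _ _) (leq_addr _ _).
  - exact: leq_trans (leq_addl _ _) (leq_addr _ _).
  - exact: leq_addl.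
exists iteration, K, 1%N, (fun p s => 2 * budget p s + 1).
move=> p s eps n d A b solver p2 ps eps0 n0 d0 solverP nu.
rewrite -/(iters p s n).
have s2 := s_gt2 p2 ps; have s0 : 0 < s by lra.
have nR : 1 <= n%:R :> R by rewrite ler1n.
have nR0 : 0 < n%:R :> R by rewrite ltr0n.
have a0 : 0 <= ln n%:R :> R by exact: ln_ge0.
have l1 := logb_ge1 (n%:R / eps); set l := logb (n%:R / eps) in l1 *.
have T1 := iters_ge1 p2 ps n0; set T := iters p s n in T1 *.
have sl0 := step_len_gt0 p2 ps; have sl1 := step_len_le1 p2 ps.
have [xmin xminP] := pobj_minimizer_exists A b s2.
have [L [L0 lenP Lle]] := phase_length_nat p2 ps n0.
have bud0 := budget_ge0 p2 ps.
have quota0 : 0 <= budget p s * (1 + ln n%:R) by rewrite mulr_ge0// addr_ge0.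
have [q [q0 quotaP qle]] := nat_floor quota0.
have le_l : - ln eps <= l.
  by apply: le_trans (ln_le_logb _); rewrite ln_div ?posrE//; lra.
have s1 : 1 <= s by lra.
have [PH [PH0 PHeps PHle]] := phase_count sl0 sl1 s1 a0 l1 le_l eps0.
have Tl0 : 0 <= T * l by rewrite mulr_ge0//; lra.
have [J [J0 Jtest Jle]] := nat_floor Tl0.
have enough : (PH * L <= 0 + J * q)%N.
  rewrite add0n -(ler_nat R) !natrM.
  have c0 : 0 <= (4 * s / step_len s + 1) * ((1 + ln n%:R) * l).
    by apply: le_trans PHle.
  apply: le_trans (_ : (4 * s / step_len s + 1) * ((1 + ln n%:R) * l) *
    ((flow_time s / flow_coef p s + 8 * 4 `^ p + 1) * T) <= _).
    by apply: ler_pM => //; apply: le_trans Lle _; exact: phase_len_le.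
  have -> : (4 * s / step_len s + 1) * ((1 + ln n%:R) * l) *
      ((flow_time s / flow_coef p s + 8 * 4 `^ p + 1) * T)
    = T * l * (budget p s * (1 + ln n%:R)) by rewrite /budget; ring.
  apply: ler_pM => //; first by rewrite ltW// ltNge Jtest ltnn.
  by rewrite ltW// ltNge quotaP ltnn.
have [st1 [k1 [e1 qs1 o1 [x0 x0P cl]]]] := init_runs eps A b p2 ps n0 solverP xmin L0.
have F0 := pobj_ge0 s A b x0.
have ns0 : 0 < n%:R `^ s :> R by rewrite powR_gt0.
have PHgoal : pobj s A b x0 * (1 - step_len s / 4) ^+ PH
    <= eps * pobj s A b x0 / n%:R `^ s.
  rewrite ler_pdivlMr// -mulrA mulrC; apply: ler_wpM2r => //.
  by rewrite mulrC /powR gt_eqF.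
have [ks [st2 [it sz [m [hm [_ gapm _]] mgoal] costs]]] :=
  iterates_main p2 ps n0 solverP lenP q0 quotaP PH0 PHgoal F0 enough cl.
exists (k1 :: ks), st2; split.
- by apply: IterStep it.
- exists xmin; first by move=> y; rewrite !(regression_objE _ _ _ s0); exact: xminP.
  rewrite !(regression_objE _ _ _ s0).
  have -> : output d st2 = m_x m by case: hm.
  have hx0 : pobj s A b x0 / n%:R `^ s <= pobj s A b xmin.
    by rewrite ler_pdivrMr// mulrC; exact: pobj_start p2 ps n0 x0P.
  have h := ler_wpM2l (ltW eps0) hx0; rewrite mulrA in h.
  by rewrite mulrDl mul1r -lerBlDl; exact: le_trans gapm (le_trans mgoal h).
- apply: le_trans (iteration_count (ltW s2) T1 l1 Jle (sz : (size ks).+1 <= J.+1)%N) _.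
  apply: ler_wpM2r; last by rewrite ler_nat; exact: leq_trans K3.
  by rewrite mulr_ge0 ?sqr_ge0// mulr_ge0//; [exact: ltW|exact: le_trans T1].
- have lgn := logb_ge1 (n%:R : R).
  have qQ : q%:R <= (2 * budget p s + 1) * logb n%:R ^+ 1.
    by rewrite expr1; apply: le_trans qle _; exact: quota_bound (ln_le_logb _) lgn.
  have Q1 : 1 <= (2 * budget p s + 1) * logb n%:R ^+ 1.
    by rewrite expr1 -[leLHS]mulr1; apply: ler_pM => //; rewrite lerDr mulr_ge0.
  apply/andP; split.
    exact: init_iteration_cost n0 Q1 qs1 o1 K_init (leq_trans _ K3).
  apply: sub_all costs => c /andP[/eqP qc oc].
  exact: main_iteration_cost n0 qQ qc oc K_main K3.
Qed.
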